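(* Let $V$ be an $\mathbb{R}$-vector space of finite dimension $n$, let $N$ be a $\mathbb{Z}$-structure on $V$, let $\Sigma$ be an $N$-fan in $V$, let $S$ be a scheme, and let $t_\Sigma(S)\colon X_\Sigma(S)\to S$ be the toric scheme over $S$ associated with $\Sigma$. The following statements are equivalent: (i) $t_\Sigma(S)$ is regular; (ii) $t_\Sigma(S)$ has $(R_n)$; (iii) $\Sigma$ is $N$-regular or $S=\emptyset$.
   Context: Toric schemes. A $\mathbb{Z}$-structure on $V$ is a subgroup $N$ of the additive group of $V$ with $\langle N\rangle_{\mathbb{R}}=V$ and $\operatorname{rk}_{\mathbb{Z}}(N)=n=\dim_{\mathbb{R}}(V)$; $M=N^*$ is the dual $\mathbb{Z}$-structure on $V^*$, $M=\{u\in V^*\mid u(N)\subseteq\mathbb{Z}\}$. For $A\subseteq V$ put $A^\vee=\{u\in V^*\mid u(A)\subseteq\mathbb{R}_{\ge 0}\}$ and $A^\vee_M=A^\vee\cap M$. An $N$-polycone in $V$ is a set of the form $\operatorname{cone}(A)$ (nonnegative real linear combinations of $A$) with $A\subseteq N$ finite, that does not contain a line. A face of an $N$-polycone $\sigma$ is a set $\sigma\cap\operatorname{Ker}(u)$ with $u\in\sigma^\vee_M$. An $N$-fan is a finite (possibly empty) set $\Sigma$ of $N$-polycones such that $\sigma\cap\tau\in\operatorname{face}(\sigma)\subseteq\Sigma$ for all $\sigma,\tau\in\Sigma$, where $\operatorname{face}(\sigma)$ is the set of faces of $\sigma$. It is $N$-regular if every $\sigma\in\Sigma$ is generated (as a cone)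 by a subset of a $\mathbb{Z}$-basis of $N$. If $\tau$ is a face of $\sigma$, then $\sigma^\vee_M$ is a submonoid of $\tau^\vee_M$ and the induced $\operatorname{Spec}(\mathbb{Z}[\tau^\vee_M])\to\operatorname{Spec}(\mathbb{Z}[\sigma^\vee_M])$ is an open immersion. $X_\Sigma(\mathbb{Z})$ is the scheme obtained by gluing the affine schemes $X_\sigma(\mathbb{Z})=\operatorname{Spec}(\mathbb{Z}[\sigma^\vee_M])$, $\sigma\in\Sigma$, along the open subschemes $X_{\sigma\cap\tau}(\mathbb{Z})$ ($\mathbb{Z}[\cdot]$ denoting monoid algebras). For a scheme $S$, $X_\Sigma(S)=X_\Sigma(\mathbb{Z})\times_{\mathbb{Z}}S$ and $t_\Sigma(S)\colon X_\Sigma(S)\to S$ is the projection. Regularity. For $k\in\mathbb{N}$ a scheme $X$ has $(R_k)$ if it is locally noetherian and $\mathcal{O}_{X,x}$ is regular for every $x\in X$ with $\dim(\mathcal{O}_{X,x})\le k$. A morphism of schemes $X\to Y$ has $(R_k)$ if it is flat and $X_z\otimes_{\kappa(z)}K$ has $(R_k)$ for every $z\in Y$ and every finite field extension $\kappa(z)\to K$, where $X_z$ is the fibre over $z$. A scheme or morphism is regular if it has $(R_k)$ for every $k\in\mathbb{N}$. *)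

(* Defs.v *)
(* Commutative rings are [comPzRingType]s: the zero ring must be allowed, since
   it is the ring of sections over the empty set. *)
From HB Require Import structures.
From mathcomp Require Import all_boot all_algebra all_field ring.
From mathcomp Require Import generic_quotient.
From mathcomp Require Import finmap monalg.
From mathcomp Require Import all_classical reals topology.

Set Implicit Arguments.
Unset Strict Implicit.
Unset Printing Implicit Defensive.

Import GRing.Theory Num.Theory.

Local Open Scope classical_set_scope.
Local Open Scope ring_scope.
Local Open Scope quotient_scope.

(* A type with operations satisfying the axioms of commutative rings up to a
   congruence [pr_eq]; localizations and stalks are quotients of such. *)
Record prering := PreRing {
  pr_sort :> Type;
  pr_eq : pr_sort -> pr_sort -> Prop;
  pr_zero : pr_sort;
  pr_one : pr_sort;
  pr_add : pr_sort -> pr_sort -> pr_sort;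
  pr_opp : pr_sort -> pr_sort;
  pr_mul : pr_sort -> pr_sort -> pr_sort;
  pr_eq_refl : forall x, pr_eq x x;
  pr_eq_sym : forall x y, pr_eq x y -> pr_eq y x;
  pr_eq_trans : forall x y z, pr_eq x y -> pr_eq y z -> pr_eq x z;
  pr_addP : forall x x' y y',
    pr_eq x x' -> pr_eq y y' -> pr_eq (pr_add x y) (pr_add x' y');
  pr_oppP : forall x x', pr_eq x x' -> pr_eq (pr_opp x) (pr_opp x');
  pr_mulP : forall x x' y y',
    pr_eq x x' -> pr_eq y y' -> pr_eq (pr_mul x y) (pr_mul x' y');
  pr_addA : forall x y z,
    pr_eq (pr_add x (pr_add y z)) (pr_add (pr_add x y) z);
  pr_addC : forall x y, pr_eq (pr_add x y) (pr_add y x);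
  pr_add0 : forall x, pr_eq (pr_add pr_zero x) x;
  pr_addN : forall x, pr_eq (pr_add (pr_opp x) x) pr_zero;
  pr_mulA : forall x y z,
    pr_eq (pr_mul x (pr_mul y z)) (pr_mul (pr_mul x y) z);
  pr_mulC : forall x y, pr_eq (pr_mul x y) (pr_mul y x);
  pr_mul1 : forall x, pr_eq (pr_mul pr_one x) x;
  pr_mulD : forall x y z,
    pr_eq (pr_mul (pr_add x y) z) (pr_add (pr_mul x z) (pr_mul y z)) }.

Section QuotientRing.
Context (P : prering).

Definition pr_rel (x y : {classic P}) : bool := `[< pr_eq x y >].

Lemma pr_rel_refl : reflexive pr_rel.
Proof. by move=> x; apply/asboolP/pr_eq_refl. Qed.

Lemma pr_rel_sym : symmetric pr_rel.
Proof. by move=> x y; apply/asboolP/asboolP; exact: pr_eq_sym. Qed.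

Lemma pr_rel_trans : transitive pr_rel.
Proof.
by move=> y x z /asboolP xy /asboolP yz; apply/asboolP/(pr_eq_trans xy yz).
Qed.

Canonical pr_equiv := EquivRel pr_rel pr_rel_refl pr_rel_sym pr_rel_trans.

Definition quot : Type := {eq_quot pr_equiv}.
HB.instance Definition _ := Choice.on quot.

Definition qpi (x : P) : quot := \pi_({eq_quot pr_equiv}) (x : {classic P}).
Definition qrepr (t : quot) : P := repr (t : {eq_quot pr_equiv}).

Lemma qreprK t : qpi (qrepr t) = t.
Proof. exact: reprK. Qed.

Lemma qpiP x y : (qpi x = qpi y) <-> pr_eq x y.
Proof.
split; first by move/eqmodP => /asboolP.
by move=> xy; apply/eqmodP/asboolP.
Qed.

Lemma qrepr_pi x : pr_eq (qrepr (qpi x)) x.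
Proof. by apply/qpiP; rewrite qreprK. Qed.

Definition qadd (s t : quot) := qpi (pr_add (qrepr s) (qrepr t)).
Definition qopp (s : quot) := qpi (pr_opp (qrepr s)).
Definition qmul (s t : quot) := qpi (pr_mul (qrepr s) (qrepr t)).

Lemma qaddE x y : qadd (qpi x) (qpi y) = qpi (pr_add x y).
Proof. by apply/qpiP/pr_addP; exact: qrepr_pi. Qed.

Lemma qoppE x : qopp (qpi x) = qpi (pr_opp x).
Proof. by apply/qpiP/pr_oppP; exact: qrepr_pi. Qed.

Lemma qmulE x y : qmul (qpi x) (qpi y) = qpi (pr_mul x y).
Proof. by apply/qpiP/pr_mulP; exact: qrepr_pi. Qed.

Let qind (Q : quot -> Prop) : (forall x, Q (qpi x)) -> forall t, Q t.
Proof. by move=> QP t; rewrite -[t]qreprK. Qed.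

Lemma qaddA : associative qadd.
Proof.
elim/qind=> x; elim/qind=> y; elim/qind=> z.
by rewrite !qaddE; apply/qpiP/pr_addA.
Qed.

Lemma qaddC : commutative qadd.
Proof. by elim/qind=> x; elim/qind=> y; rewrite !qaddE; apply/qpiP/pr_addC. Qed.

Lemma qadd0 : left_id (qpi (pr_zero P)) qadd.
Proof. by elim/qind=> x; rewrite qaddE; apply/qpiP/pr_add0. Qed.

Lemma qaddN : left_inverse (qpi (pr_zero P)) qopp qadd.
Proof. by elim/qind=> x; rewrite qoppE qaddE; apply/qpiP/pr_addN. Qed.

HB.instance Definition _ := GRing.isZmodule.Build quot qaddA qaddC qadd0 qaddN.

Lemma qmulA : associative qmul.
Proof.
elim/qind=> x; elim/qind=> y; elim/qind=> z.
by rewrite !qmulE; apply/qpiP/pr_mulA.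
Qed.

Lemma qmulC : commutative qmul.
Proof. by elim/qind=> x; elim/qind=> y; rewrite !qmulE; apply/qpiP/pr_mulC. Qed.

Lemma qmul1 : left_id (qpi (pr_one P)) qmul.
Proof. by elim/qind=> x; rewrite qmulE; apply/qpiP/pr_mul1. Qed.

Lemma qmulD : left_distributive qmul qadd.
Proof.
elim/qind=> x; elim/qind=> y; elim/qind=> z.
by rewrite qaddE !qmulE qaddE; apply/qpiP/pr_mulD.
Qed.

HB.instance Definition _ :=
  GRing.Zmodule_isComPzRing.Build quot qmulA qmulC qmul1 qmulD.

Lemma qpiD x y : qpi (pr_add x y) = qpi x + qpi y.
Proof. by rewrite -qaddE. Qed.

Lemma qpiN x : qpi (pr_opp x) = - qpi x.
Proof. by rewrite -qoppE. Qed.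

Lemma qpiM x y : qpi (pr_mul x y) = qpi x * qpi y.
Proof. by rewrite -qmulE. Qed.

Lemma qpi0 : qpi (pr_zero P) = 0.
Proof. by []. Qed.

Lemma qpi1 : qpi (pr_one P) = 1.
Proof. by []. Qed.

End QuotientRing.

Section CommutativeAlgebra.
Context (A : comPzRingType).
Implicit Types (x y : A) (I p : set A).

Definition is_unit x : Prop := exists y, y * x = 1.

Definition is_ideal I : Prop :=
  [/\ I 0, forall x y, I x -> I y -> I (x + y) & forall x y, I y -> I (x * y)].

Definition is_prime p : Prop :=
  [/\ is_ideal p, ~ p 1 & forall x y, p (x * y) -> p x \/ p y].

Definition ideal_gen (s : seq A) : set A :=
  [set x | exists c : 'I_(size s) -> A, x = \sum_(i < size s) c i * s`_i].

Definition noetherian : Prop :=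
  forall I, is_ideal I -> exists s, I = ideal_gen s.

(* the non-units form an ideal, which is then the unique maximal ideal *)
Definition max_ideal : set A := [set x | ~ is_unit x].
Definition is_local : Prop := is_ideal max_ideal.

Definition prime_chain (m : nat) : Prop :=
  exists p : nat -> set A,
    (forall i, (i <= m)%N -> is_prime (p i)) /\
    (forall i, (i < m)%N -> p i `<` p i.+1).

Definition dim_le (d : nat) : Prop := forall m, prime_chain m -> (m <= d)%N.

Definition has_dim (d : nat) : Prop := prime_chain d /\ dim_le d.

Definition regular_local : Prop :=
  [/\ is_local, noetherian &
      exists d (s : d.-tuple A), has_dim d /\ max_ideal = ideal_gen s].

End CommutativeAlgebra.

Section Localization.
Context (A : comPzRingType).

Record spec := Prime { prime_set :> A -> Prop; primeP : is_prime prime_set }.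

Lemma prime0 (p : spec) : p 0.
Proof. by case: (primeP p) => -[]. Qed.

Lemma prime1 (p : spec) : ~ p 1.
Proof. by case: (primeP p). Qed.

Lemma primeMl (p : spec) x y : p y -> p (x * y).
Proof. by case: (primeP p) => -[_ _ h] _ _; exact: h. Qed.

Lemma primeMr (p : spec) x y : p x -> p (x * y).
Proof. by rewrite mulrC; exact: primeMl. Qed.

Lemma primeNM (p : spec) x y : ~ p x -> ~ p y -> ~ p (x * y).
Proof. by move=> px py; case: (primeP p) => _ _ h /h[]. Qed.

Context (p : spec).

Record fraction := Fraction { num : A; den : A; denP : ~ p den }.

Definition fr_eq (u v : fraction) : Prop :=
  exists2 w, ~ p w & w * (num u * den v) = w * (num v * den u).

Definition fr_zero := Fraction 0 (@prime1 p).
Definition fr_one := Fraction 1 (@prime1 p).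
Definition fr_add u v :=
  Fraction (num u * den v + num v * den u) (primeNM (@denP u) (@denP v)).
Definition fr_opp u := Fraction (- num u) (@denP u).
Definition fr_mul u v :=
  Fraction (num u * num v) (primeNM (@denP u) (@denP v)).

Lemma fr_eqW u v : num u * den v = num v * den u -> fr_eq u v.
Proof. by move=> e; exists 1; [exact: prime1 | rewrite e]. Qed.

Lemma fr_eq_refl u : fr_eq u u.
Proof. exact: fr_eqW. Qed.

Lemma fr_eq_sym u v : fr_eq u v -> fr_eq v u.
Proof. by case=> w pw e; exists w. Qed.

Lemma fr_eq_trans u v w : fr_eq u v -> fr_eq v w -> fr_eq u w.
Proof.
case: u v w => [a s ps] [b t pt] [c r pr] [x px /= ex] [y py /= ey].
exists (x * y * t) => /=; first by do 2?apply: primeNM.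
transitivity (y * r * (x * (a * t))); first by ring.
rewrite ex; transitivity (x * s * (y * (b * r))); first by ring.
by rewrite ey; ring.
Qed.

Lemma fr_addP u u' v v' :
  fr_eq u u' -> fr_eq v v' -> fr_eq (fr_add u v) (fr_add u' v').
Proof.
case: u u' v v' => [a s ps] [a' s' ps'] [b t pt] [b' t' pt'].
move=> [x px /= ex] [y py /= ey]; exists (x * y) => /=; first exact: primeNM.
transitivity (y * t * t' * (x * (a * s')) + x * s * s' * (y * (b * t'))).
  by ring.
by rewrite ex ey; ring.
Qed.

Lemma fr_oppP u u' : fr_eq u u' -> fr_eq (fr_opp u) (fr_opp u').
Proof. by case=> x px e; exists x => //=; rewrite !mulNr !mulrN e. Qed.

Lemma fr_mulP u u' v v' :
  fr_eq u u' -> fr_eq v v' -> fr_eq (fr_mul u v) (fr_mul u' v').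
Proof.
case: u u' v v' => [a s ps] [a' s' ps'] [b t pt] [b' t' pt'].
move=> [x px /= ex] [y py /= ey]; exists (x * y) => /=; first exact: primeNM.
transitivity ((x * (a * s')) * (y * (b * t'))); first by ring.
by rewrite ex ey; ring.
Qed.

Definition loc_prering : prering.
Proof.
apply: (@PreRing fraction fr_eq fr_zero fr_one fr_add fr_opp fr_mul).
- exact: fr_eq_refl.
- exact: fr_eq_sym.
- exact: fr_eq_trans.
- exact: fr_addP.
- exact: fr_oppP.
- exact: fr_mulP.
all: by move=> *; apply: fr_eqW => /=; ring.
Defined.

Definition loc : comPzRingType := quot loc_prering.

Definition frac (a s : A) (ps : ~ p s) : loc := @qpi loc_prering (Fraction a ps).

Lemma fracP a s (ps : ~ p s) b t (pt : ~ p t) :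
  frac a ps = frac b pt <-> exists2 w, ~ p w & w * (a * t) = w * (b * s).
Proof. exact: qpiP. Qed.

Lemma frac_ind (Q : loc -> Prop) :
  (forall a s (ps : ~ p s), Q (frac a ps)) -> forall t, Q t.
Proof.
move=> QP t; rewrite -(qreprK t); case: (qrepr t) => a s ps; exact: QP.
Qed.

Lemma fracD a s (ps : ~ p s) b t (pt : ~ p t) :
  frac a ps + frac b pt = frac (a * t + b * s) (primeNM ps pt).
Proof. by rewrite /frac -qpiD. Qed.

Lemma fracN a s (ps : ~ p s) : - frac a ps = frac (- a) ps.
Proof. by rewrite /frac -qpiN. Qed.

Lemma fracM a s (ps : ~ p s) b t (pt : ~ p t) :
  frac a ps * frac b pt = frac (a * b) (primeNM ps pt).
Proof. by rewrite /frac -qpiM. Qed.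

Lemma frac0 : 0 = frac 0 (@prime1 p). Proof. by []. Qed.
Lemma frac1 : 1 = frac 1 (@prime1 p). Proof. by []. Qed.

End Localization.

Record opens (X : topologicalType) :=
  Opens { oset :> X -> Prop; opensP : open oset }.

Definition opens_sub (X : topologicalType) (V U : opens X) : Prop :=
  forall x, V x -> U x.
Notation "V `<=o` U" := (opens_sub V U) (at level 70, no associativity).

Lemma opens_refl (X : topologicalType) (U : opens X) : U `<=o` U.
Proof. by []. Qed.

Lemma opens_trans (X : topologicalType) (U V W : opens X) :
  W `<=o` V -> V `<=o` U -> W `<=o` U.
Proof. by move=> WV VU x /WV/VU. Qed.

Definition opensT (X : topologicalType) : opens X := Opens (@openT X).
Definition opensI (X : topologicalType) (U V : opens X) : opens X :=
  Opens (openI (opensP U) (opensP V)).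

Lemma opensIl (X : topologicalType) (U V : opens X) : opensI U V `<=o` U.
Proof. by move=> x []. Qed.

Lemma opensIr (X : topologicalType) (U V : opens X) : opensI U V `<=o` V.
Proof. by move=> x []. Qed.

Arguments opens_refl {X U}.
Arguments opensIl {X U V}.
Arguments opensIr {X U V}.

Lemma opens_preim_subproof (X Y : topologicalType) (f : X -> Y)
  (cf : continuous f) (U : opens Y) : open (f @^-1` U).
Proof. by move/continuousP : cf; apply; exact: opensP. Qed.

Definition opens_preim (X Y : topologicalType) (f : X -> Y)
  (cf : continuous f) (U : opens Y) : opens X :=
  Opens (opens_preim_subproof cf U).

Record ringed_space := RingedSpace {
  points :> topologicalType;
  sections : opens points -> comPzRingType;
  res : forall U V : opens points, V `<=o` U ->
    {rmorphism sections U -> sections V};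
  res_id : forall U (h : U `<=o` U) s, res h s = s;
  res_comp : forall (U V W : opens points)
    (VU : V `<=o` U) (WV : W `<=o` V) (WU : W `<=o` U) s,
    res WV (res VU s) = res WU s;
  res_sep : forall (U : opens points) (C : set (opens points))
    (CU : forall V, C V -> V `<=o` U) (s t : sections U),
    (forall x, U x -> exists2 V : opens points, C V & V x) ->
    (forall V (CV : C V), res (CU V CV) s = res (CU V CV) t) -> s = t;
  res_glue : forall (U : opens points) (C : set (opens points))
    (CU : forall V, C V -> V `<=o` U) (s : forall V, sections V),
    (forall x, U x -> exists2 V : opens points, C V & V x) ->
    (forall V W, C V -> C W ->
      res (@opensIl _ V W : opensI V W `<=o` V) (s V) =
      res (@opensIr _ V W : opensI V W `<=o` W) (s W)) ->
    exists t : sections U, forall V (CV : C V), res (CU V CV) t = s V }.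

Section Stalk.
Context (X : ringed_space) (x : X).

Record germ_rep := GermRep {
  germ_dom : opens X; germ_domP : germ_dom x; germ_sec : sections germ_dom }.

Definition gr_eq (u v : germ_rep) : Prop :=
  exists (W : opens X) (Wu : W `<=o` germ_dom u) (Wv : W `<=o` germ_dom v),
    W x /\ res Wu (germ_sec u) = res Wv (germ_sec v).

Definition gr_lift2 (op : forall A : comPzRingType, A -> A -> A)
    (u v : germ_rep) : germ_rep :=
  @GermRep (opensI (germ_dom u) (germ_dom v))
    (conj (germ_domP u) (germ_domP v))
    (op _ (res (opensIl) (germ_sec u))
          (res (opensIr) (germ_sec v))).

Definition gr_zero := @GermRep (opensT X) I 0.
Definition gr_one := @GermRep (opensT X) I 1.
Definition gr_add := gr_lift2 (fun A => @GRing.add A).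
Definition gr_mul := gr_lift2 (fun A => @GRing.mul A).
Definition gr_opp (u : germ_rep) : germ_rep :=
  GermRep (germ_domP u) (- germ_sec u).

Lemma res_comp2 (U V V' W : opens X) (VU : V `<=o` U) (WV : W `<=o` V)
    (V'U : V' `<=o` U) (WV' : W `<=o` V') s :
  res WV (res VU s) = res WV' (res V'U s).
Proof.
have WU : W `<=o` U by move=> y /WV/VU.
by rewrite !(res_comp _ _ WU).
Qed.

Lemma gr_eq_refl u : gr_eq u u.
Proof. by exists (germ_dom u), opens_refl, opens_refl; split=> //; exact: germ_domP. Qed.

Lemma gr_eq_sym u v : gr_eq u v -> gr_eq v u.
Proof. by case=> W [Wu [Wv [Wx e]]]; exists W, Wv, Wu. Qed.

Lemma gr_eq_trans u v w : gr_eq u v -> gr_eq v w -> gr_eq u w.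
Proof.
case=> W [Wu [Wv [Wx e]]] [W' [W'v [W'w [W'x e']]]].
have h1 : opensI W W' `<=o` W by exact: opensIl.
have h2 : opensI W W' `<=o` W' by exact: opensIr.
exists (opensI W W'), (opens_trans h1 Wu), (opens_trans h2 W'w).
split=> //; rewrite -(res_comp Wu h1) e (res_comp2 _ _ W'v h2) e'.
exact: res_comp.
Qed.

Lemma gr_lift2P op
    (opP : forall (A B : comPzRingType) (f : {rmorphism A -> B}) a b,
      f (op A a b) = op B (f a) (f b)) u u' v v' :
  gr_eq u u' -> gr_eq v v' -> gr_eq (gr_lift2 op u v) (gr_lift2 op u' v').
Proof.
case=> W [Wu [Wu' [Wx e]]] [Z [Zv [Zv' [Zx e']]]].
have h1 : opensI W Z `<=o` W by exact: opensIl.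
have h2 : opensI W Z `<=o` Z by exact: opensIr.
have k : opensI W Z `<=o` opensI (germ_dom u) (germ_dom v).
  by move=> y [/Wu ? /Zv].
have k' : opensI W Z `<=o` opensI (germ_dom u') (germ_dom v').
  by move=> y [/Wu' ? /Zv'].
exists (opensI W Z), k, k'; split=> //=; rewrite !opP; congr (op _ _ _).
  by rewrite (res_comp2 opensIl k Wu h1) e (res_comp2 Wu' h1 opensIl k').
by rewrite (res_comp2 opensIr k Zv h2) e' (res_comp2 Zv' h2 opensIr k').
Qed.

Lemma gr_eqW (W : opens X) (u v : germ_rep)
    (Wu : W `<=o` germ_dom u) (Wv : W `<=o` germ_dom v) :
  W x -> res Wu (germ_sec u) = res Wv (germ_sec v) -> gr_eq u v.
Proof. by move=> Wx e; exists W, Wu, Wv. Qed.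

Lemma res_trans (U V W : opens X) (VU : V `<=o` U) (WV : W `<=o` V) s :
  res WV (res VU s) = res (opens_trans WV VU) s.
Proof. exact: res_comp. Qed.

Ltac res_irr := repeat match goal with
  | |- context [@res ?X ?U ?W ?h] =>
    match goal with |- context [@res X U W ?k] =>
      tryif constr_eq h k then fail else rewrite (Prop_irrelevance k h) end
  end.

Ltac germ_ring W :=
  unshelve eapply (@gr_eqW W);
  [by move=> y /=; tauto | by move=> y /=; tauto
  | by repeat split; first [exact: germ_domP | assumption]
  | rewrite /= ?(rmorphD, rmorphM, rmorphN, rmorph0, rmorph1, res_trans);
    res_irr].

Definition stalk_prering : prering.
Proof.
apply: (@PreRing germ_rep gr_eq gr_zero gr_one gr_add gr_opp gr_mul).
- exact: gr_eq_refl.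
- exact: gr_eq_sym.
- exact: gr_eq_trans.
- by apply: gr_lift2P => A B f a b; rewrite rmorphD.
- move=> u u' [W [Wu [Wu' [Wx e]]]].
  by exists W, Wu, Wu'; split=> //=; rewrite !rmorphN e.
- by apply: gr_lift2P => A B f a b; rewrite rmorphM.
- move=> u v w.
  by germ_ring (opensI (germ_dom u) (opensI (germ_dom v) (germ_dom w))); ring.
- by move=> u v; germ_ring (opensI (germ_dom u) (germ_dom v)); ring.
- by move=> u; germ_ring (germ_dom u); ring.
- by move=> u; germ_ring (germ_dom u); ring.
- move=> u v w.
  by germ_ring (opensI (germ_dom u) (opensI (germ_dom v) (germ_dom w))); ring.
- by move=> u v; germ_ring (opensI (germ_dom u) (germ_dom v)); ring.
- by move=> u; germ_ring (germ_dom u); ring.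
- move=> u v w.
  by germ_ring (opensI (germ_dom u) (opensI (germ_dom v) (germ_dom w))); ring.
Defined.

Definition stalk : comPzRingType := quot stalk_prering.

Definition germ (U : opens X) (Ux : U x) (s : sections U) : stalk :=
  @qpi stalk_prering (GermRep Ux s).

Lemma germP (U V : opens X) (Ux : U x) (Vx : V x) s t :
  germ Ux s = germ Vx t <->
  exists (W : opens X) (WU : W `<=o` U) (WV : W `<=o` V),
    W x /\ res WU s = res WV t.
Proof. exact: qpiP. Qed.

Lemma germ_ind (Q : stalk -> Prop) :
  (forall (U : opens X) (Ux : U x) s, Q (germ Ux s)) -> forall t, Q t.
Proof.
move=> QP t; rewrite -(qreprK t); case: (qrepr t) => U Ux s; exact: QP.
Qed.

Lemma germ_res (U V : opens X) (Ux : U x) (Vx : V x) (VU : V `<=o` U) s :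
  germ Vx (res VU s) = germ Ux s.
Proof.
by apply/germP; exists V, opens_refl, VU; split=> //; rewrite res_id.
Qed.

Section GermMorphism.
Context (U : opens X) (Ux : U x).

Lemma germD : {morph germ Ux : s t / s + t}.
Proof.
move=> s t; rewrite /germ -qpiD; apply/qpiP.
by germ_ring U; rewrite !res_id.
Qed.

Lemma germM : {morph germ Ux : s t / s * t}.
Proof.
move=> s t; rewrite /germ -qpiM; apply/qpiP.
by germ_ring U; rewrite !res_id.
Qed.

Lemma germ1 : germ Ux 1 = 1.
Proof. by rewrite -qpi1; apply/qpiP; germ_ring U. Qed.

Lemma germ0 : germ Ux 0 = 0.
Proof. by rewrite -qpi0; apply/qpiP; germ_ring U. Qed.

Lemma germN : {morph germ Ux : s / - s}.
Proof. by move=> s; apply/eqP; rewrite -subr_eq0 opprK -germD addNr germ0. Qed.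

End GermMorphism.
End Stalk.

Record lrs := LRS {
  lrs_space :> ringed_space;
  lrsP : forall x : lrs_space, is_local (stalk x) }.

Record rs_mor (X Y : ringed_space) := RSMor {
  mor_pt :> X -> Y;
  mor_cont : continuous mor_pt;
  mor_sec : forall U : opens Y,
    {rmorphism sections U -> sections (opens_preim mor_cont U)};
  mor_res : forall (U V : opens Y) (VU : V `<=o` U)
    (fVU : opens_preim mor_cont V `<=o` opens_preim mor_cont U) s,
    mor_sec V (res VU s) = res fVU (mor_sec U s) }.

Arguments mor_cont {X Y} r.
Arguments mor_sec {X Y} r U.

(* Defined on a chosen representative; [stalk_mapE] shows independence. *)
Definition stalk_map (X Y : ringed_space) (f : rs_mor X Y) (x : X)
    (t : stalk (f x)) : stalk x :=
  let r := qrepr t in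
  @germ X x (opens_preim (mor_cont f) (germ_dom r)) (germ_domP r)
    (mor_sec f (germ_dom r) (germ_sec r)).

Lemma stalk_mapE (X Y : ringed_space) (f : rs_mor X Y) (x : X)
    (U : opens Y) (Ux : U (f x)) s :
  stalk_map (germ Ux s) =
    @germ X x (opens_preim (mor_cont f) U) Ux (mor_sec f U s).
Proof.
rewrite /stalk_map /germ; have := qrepr_pi (P := stalk_prering (f x)) (GermRep Ux s).
set r := qrepr _ => -[W [WU [WV [Wx e]]]]; apply/qpiP.
have h1 : opens_preim (mor_cont f) W `<=o` opens_preim (mor_cont f) (germ_dom r).
  by move=> y; exact: WU.
have h2 : opens_preim (mor_cont f) W `<=o` opens_preim (mor_cont f) U.
  by move=> y; exact: WV.
exists (opens_preim (mor_cont f) W), h1, h2; split=> //=.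
by rewrite -(mor_res WU) -(mor_res WV) e.
Qed.

Record mor (X Y : lrs) := Mor {
  mor_rs :> rs_mor X Y;
  mor_local : forall (x : X) (t : stalk (mor_rs x)),
    is_unit (stalk_map t) -> is_unit t }.

(* Equality of morphisms. The preimages of U under f and g are only
   propositionally equal, so sections are compared after restriction to a
   common open subset W, which may be the whole preimage. *)
Definition mor_eq (X Y : ringed_space) (f g : rs_mor X Y) : Prop :=
  (forall x, f x = g x) /\
  (forall (U : opens Y) (W : opens X)
     (Wf : W `<=o` opens_preim (mor_cont f) U)
     (Wg : W `<=o` opens_preim (mor_cont g) U) s,
     res Wf (mor_sec f U s) = res Wg (mor_sec g U s)).

Notation "f =m g" := (mor_eq f g) (at level 70, no associativity).

Section IdComp.

Lemma mor_id_cont (X : topologicalType) : continuous (@idfun X).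
Proof. by move=> x; exact: cvg_id. Qed.

Lemma mor_id_sub (X : topologicalType) (U : opens X) :
  opens_preim (@mor_id_cont X) U `<=o` U.
Proof. by []. Qed.

Definition rs_id (X : ringed_space) : rs_mor X X.
Proof.
apply: (@RSMor X X idfun (@mor_id_cont X)
  (fun U => res (@mor_id_sub X U))) => U V VU fVU s.
exact: res_comp2.
Defined.

Lemma mor_id_local (X : lrs) (x : X) (t : stalk (rs_id X x)) :
  is_unit (stalk_map t) -> is_unit t.
Proof.
elim/germ_ind: t => U Ux s; rewrite stalk_mapE /=.
by rewrite (germ_res (V := opens_preim (@mor_id_cont X) U) Ux).
Qed.

Definition mor_id (X : lrs) : mor X X := Mor (@mor_id_local X).

Lemma mor_comp_cont (X Y Z : ringed_space) (g : rs_mor Y Z) (f : rs_mor X Y) :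
  continuous (g \o f).
Proof. by move=> x; apply: continuous_comp; apply: mor_cont. Qed.

Definition rs_comp (X Y Z : ringed_space) (g : rs_mor Y Z) (f : rs_mor X Y) :
  rs_mor X Z.
Proof.
apply: (@RSMor X Z (g \o f) (@mor_comp_cont X Y Z g f)
  (fun U => [the {rmorphism _ -> _} of
     (res (fun x (h : opens_preim (@mor_comp_cont X Y Z g f) U x) => h :
       opens_preim (mor_cont f) (opens_preim (mor_cont g) U) x))
     \o mor_sec f (opens_preim (mor_cont g) U) \o mor_sec g U])).
move=> U V VU fVU s /=.
have gVU : opens_preim (mor_cont g) V `<=o` opens_preim (mor_cont g) U.
  by move=> y; exact: VU.
have hVU : opens_preim (mor_cont f) (opens_preim (mor_cont g) V) `<=o`
           opens_preim (mor_cont f) (opens_preim (mor_cont g) U).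
  by move=> y; exact: VU.
by rewrite (mor_res VU gVU) (mor_res gVU hVU); exact: res_comp2.
Defined.

Lemma mor_comp_local (X Y Z : lrs) (g : mor Y Z) (f : mor X Y) (x : X)
    (t : stalk (rs_comp g f x)) : is_unit (stalk_map t) -> is_unit t.
Proof.
elim/germ_ind: t => U Ux s; rewrite stalk_mapE /= => h.
apply: (@mor_local _ _ g (f x)); rewrite stalk_mapE.
apply: (@mor_local _ _ f x); rewrite stalk_mapE.
by rewrite germ_res in h.
Qed.

Definition mor_comp (X Y Z : lrs) (g : mor Y Z) (f : mor X Y) : mor X Z :=
  Mor (@mor_comp_local X Y Z g f).

End IdComp.

Notation "g \m f" := (mor_comp g f) (at level 50, left associativity).

Section Spec.
Context (A : comPzRingType).

HB.instance Definition _ := gen_eqMixin (spec A).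
HB.instance Definition _ := gen_choiceMixin (spec A).

(* the open sets of the Zariski topology are the complements of the sets V(E) *)
Definition zariski_open (U : set (spec A)) : Prop :=
  exists E : set A, U = [set p : spec A | exists2 a, E a & ~ p a].

Lemma zariski_openT : zariski_open setT.
Proof.
exists setT; apply/seteqP; split=> // p _.
by exists 1 => //; exact: prime1.
Qed.

Lemma zariski_openI : setI_closed zariski_open.
Proof.
move=> _ _ [E ->] [F ->].
exists [set c | exists a b, [/\ E a, F b & c = a * b]].
apply/seteqP; split=> [p [[a Ea pa] [b Fb pb]]|p [_ [a [b [Ea Fb ->]]] pab]].
  by exists (a * b); [exists a, b | exact: primeNM].
split; [exists a | exists b] => // h; apply: pab; last exact: primeMl.
exact: primeMr.
Qed.

Lemma zariski_open_bigcup (I : Type) (f : I -> set (spec A)) :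
  (forall i, zariski_open (f i)) -> zariski_open (\bigcup_i f i).
Proof.
move=> fo; exists [set a | exists i, [set p : spec A | ~ p a] `<=` f i].
apply/seteqP; split=> [p [i _ fip]|p [a [i fi] pa]]; last by exists i => //; exact: fi.
have [E fE] := fo i; move: fip; rewrite fE => -[a Ea pa].
by exists a => //; exists i; rewrite fE => q qa; exists a.
Qed.

HB.instance Definition _ := isOpenTopological.Build (spec A)
  zariski_openT zariski_openI zariski_open_bigcup.

Lemma spec_openE (U : set (spec A)) : open U = zariski_open U.
Proof. by []. Qed.

Lemma basic_open_subproof (a : A) : open [set p : spec A | ~ p a].
Proof.
rewrite spec_openE; exists [set a]; apply/seteqP.
by split=> [p pa|p [_ -> pa]] //; exists a.
Qed.

Definition basic_open (a : A) : opens (spec A) := Opens (@basic_open_subproof a).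

Definition locally_fraction (U : opens (spec A))
    (s : forall p : spec A, U p -> loc p) : Prop :=
  forall p, U p -> exists (W : opens (spec A)) (a f : A), W p /\
    forall q (Uq : U q), W q -> exists qf : ~ q f, s q Uq = frac a qf.

(* The structure sheaf of the spectrum: families of elements of the local rings
   that are locally given by a single fraction. *)
Record spec_sec (U : opens (spec A)) := SpecSec {
  sec_val :> forall p : spec A, U p -> loc p;
  sec_valP : locally_fraction sec_val }.

Section Sections.
Context (U : opens (spec A)).
Implicit Types s t : spec_sec U.

HB.instance Definition _ := gen_eqMixin (spec_sec U).
HB.instance Definition _ := gen_choiceMixin (spec_sec U).

Lemma spec_secP s t : (forall p (Up : U p), s p Up = t p Up) -> s = t.
Proof.
case: s t => [s sP] [t tP] /= e.
have est : s = t by apply: functional_extensionality_dep => p; apply/funext => Up; exact: e.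
by subst t; congr SpecSec; exact: Prop_irrelevance.
Qed.

Lemma sec_cst_subproof (a : A) :
  locally_fraction (fun p (_ : U p) => frac a (@prime1 _ p)).
Proof. by move=> p Up; exists U, a, 1; split=> // q Uq _; exists (@prime1 _ q). Qed.

Definition sec_cst (a : A) : spec_sec U := SpecSec (@sec_cst_subproof a).

Lemma sec_add_subproof s t : locally_fraction (fun p Up => s p Up + t p Up).
Proof.
move=> p Up; have [W [a [f [Wp sW]]]] := sec_valP s Up.
have [Z [b [g [Zp tZ]]]] := sec_valP t Up.
exists (opensI W Z), (a * g + b * f), (f * g); split=> // q Uq [Wq Zq].
have [qf ->] := sW q Uq Wq; have [qg ->] := tZ q Uq Zq.
by exists (primeNM qf qg); rewrite fracD.
Qed.

Lemma sec_opp_subproof s : locally_fraction (fun p Up => - s p Up).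
Proof.
move=> p Up; have [W [a [f [Wp sW]]]] := sec_valP s Up.
exists W, (- a), f; split=> // q Uq Wq; have [qf ->] := sW q Uq Wq.
by exists qf; rewrite fracN.
Qed.

Lemma sec_mul_subproof s t : locally_fraction (fun p Up => s p Up * t p Up).
Proof.
move=> p Up; have [W [a [f [Wp sW]]]] := sec_valP s Up.
have [Z [b [g [Zp tZ]]]] := sec_valP t Up.
exists (opensI W Z), (a * b), (f * g); split=> // q Uq [Wq Zq].
have [qf ->] := sW q Uq Wq; have [qg ->] := tZ q Uq Zq.
by exists (primeNM qf qg); rewrite fracM.
Qed.

Definition sec_add s t : spec_sec U := SpecSec (sec_add_subproof s t).
Definition sec_opp s : spec_sec U := SpecSec (sec_opp_subproof s).
Definition sec_mul s t : spec_sec U := SpecSec (sec_mul_subproof s t).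

Lemma sec_addA : associative sec_add.
Proof. by move=> s t u; apply: spec_secP => p Up /=; rewrite addrA. Qed.
Lemma sec_addC : commutative sec_add.
Proof. by move=> s t; apply: spec_secP => p Up /=; rewrite addrC. Qed.
Lemma sec_add0 : left_id (sec_cst 0) sec_add.
Proof. by move=> s; apply: spec_secP => p Up /=; rewrite -frac0 add0r. Qed.
Lemma sec_addN : left_inverse (sec_cst 0) sec_opp sec_add.
Proof. by move=> s; apply: spec_secP => p Up /=; rewrite -frac0 addNr. Qed.

HB.instance Definition _ :=
  GRing.isZmodule.Build (spec_sec U) sec_addA sec_addC sec_add0 sec_addN.

Lemma sec_mulA : associative sec_mul.
Proof. by move=> s t u; apply: spec_secP => p Up /=; rewrite mulrA. Qed.
Lemma sec_mulC : commutative sec_mul.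
Proof. by move=> s t; apply: spec_secP => p Up /=; rewrite mulrC. Qed.
Lemma sec_mul1 : left_id (sec_cst 1) sec_mul.
Proof. by move=> s; apply: spec_secP => p Up /=; rewrite -frac1 mul1r. Qed.
Lemma sec_mulD : left_distributive sec_mul sec_add.
Proof. by move=> s t u; apply: spec_secP => p Up /=; rewrite mulrDl. Qed.

HB.instance Definition _ :=
  GRing.Zmodule_isComPzRing.Build (spec_sec U) sec_mulA sec_mulC sec_mul1 sec_mulD.

Lemma sec_valD s t p (Up : U p) : (s + t) p Up = s p Up + t p Up.
Proof. by []. Qed.
Lemma sec_valM s t p (Up : U p) : (s * t) p Up = s p Up * t p Up.
Proof. by []. Qed.
Lemma sec_val0 p (Up : U p) : (0 : spec_sec U) p Up = 0.
Proof. by []. Qed.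
Lemma sec_val1 p (Up : U p) : (1 : spec_sec U) p Up = 1.
Proof. by []. Qed.
Lemma sec_valN s p (Up : U p) : (- s) p Up = - s p Up.
Proof. by []. Qed.

End Sections.

Section Restriction.
Context (U V : opens (spec A)) (VU : V `<=o` U).

Lemma sec_res_subproof (s : spec_sec U) :
  locally_fraction (fun p (Vp : V p) => s p (VU Vp)).
Proof.
move=> p Vp; have [W [a [f [Wp sW]]]] := sec_valP s (VU Vp).
by exists W, a, f; split=> // q Vq; exact: sW.
Qed.

Definition sec_res (s : spec_sec U) : spec_sec V :=
  SpecSec (sec_res_subproof s).

Lemma sec_res_zmod : zmod_morphism sec_res.
Proof. by move=> s t; exact: spec_secP. Qed.
Lemma sec_res_monoid : monoid_morphism sec_res.
Proof. by split=> [|s t]; exact: spec_secP. Qed.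

HB.instance Definition _ :=
  GRing.isZmodMorphism.Build (spec_sec U) (spec_sec V) sec_res sec_res_zmod.
HB.instance Definition _ :=
  GRing.isMonoidMorphism.Build (spec_sec U) (spec_sec V) sec_res sec_res_monoid.

End Restriction.

Definition spec_rs : ringed_space.
Proof.
apply: (@RingedSpace (spec A) (fun U => spec_sec U)
  (fun U V VU => [the {rmorphism spec_sec U -> spec_sec V} of sec_res VU])).
- by move=> U h s; apply: spec_secP => p Up /=; rewrite (Prop_irrelevance (h p Up) Up).
- move=> U V W VU WV WU s; apply: spec_secP => p Wp /=.
  by rewrite (Prop_irrelevance (VU p (WV p Wp)) (WU p Wp)).
- move=> U C CU s t cov e; apply: spec_secP => p Up.
  have [V CV Vp] := cov p Up.
  have /(congr1 (fun u : spec_sec V => u p Vp)) /= := e V CV.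
  by rewrite (Prop_irrelevance (CU V CV p Vp) Up).
- move=> U C CU s cov e.
  have key V W p (CV : C V) (CW : C W) (Vp : V p) (Wp : W p) : s V p Vp = s W p Wp.
    have Ip : opensI V W p by split.
    have /(congr1 (fun u : spec_sec (opensI V W) => u p Ip)) /= := e V W CV CW.
    by rewrite (Prop_irrelevance (opensIl p Ip) Vp) (Prop_irrelevance (opensIr p Ip) Wp).
  pose c p (Up : U p) := cid2 (cov p Up).
  pose t p (Up : U p) := s (s2val (c p Up)) p (s2valP' (c p Up)).
  have tP V p (CV : C V) (Vp : V p) (Up : U p) : t p Up = s V p Vp.
    by apply: key => //; exact: (s2valP (c p Up)).
  have tF : locally_fraction t.
    move=> p Up; have [V CV Vp] := cov p Up.
    have [W [a [f [Wp sW]]]] := sec_valP (s V) Vp.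
    exists (opensI V W), a, f; split=> // q Uq [Vq Wq].
    by rewrite (tP V _ CV Vq); exact: sW.
  by exists (SpecSec tF) => V CV; apply: spec_secP => p Vp /=; exact: tP.
Defined.

Lemma frac_unit (p : spec A) a s (ps : ~ p s) : is_unit (frac a ps) <-> ~ p a.
Proof.
split=> [[t]|pa]; last first.
  exists (frac s pa); rewrite fracM frac1; apply/fracP.
  by exists 1; [exact: prime1 | ring].
elim/frac_ind: t => b t pt; rewrite fracM frac1 => /fracP[w pw e] pa.
have : ~ p (w * (1 * (t * s))) by apply: primeNM => //; rewrite mul1r; exact: primeNM.
by apply; rewrite -e; apply: primeMl; apply: primeMr; exact: primeMl.
Qed.

Lemma loc_local (p : spec A) : is_local (loc p).
Proof.
split=> [|x y|x y].
- by rewrite frac0 => /frac_unit; apply; exact: prime0.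
- elim/frac_ind: x => a s ps; elim/frac_ind: y => b t pt.
  move=> ha hb; rewrite fracD => /frac_unit; apply.
  have pa : p a by apply: contrapT => pa; apply: ha; exact/frac_unit.
  have pb : p b by apply: contrapT => pb; apply: hb; exact/frac_unit.
  by case: (primeP p) => -[_ pD _] _ _; apply: pD; exact: primeMr.
- by move=> hy [z zxy]; apply: hy; exists (z * x); rewrite -mulrA.
Qed.

Lemma germ_unit (p : spec A) (U : opens (spec A)) (Up : U p) (s : spec_sec U) :
  is_unit (@germ spec_rs p U Up s) <-> is_unit (s p Up).
Proof.
split.
  case; elim/(@germ_ind spec_rs) => V Vp t.
  rewrite -(@germ_res spec_rs p U (opensI V U) Up (conj Vp Up) opensIr).
  rewrite -(@germ_res spec_rs p V (opensI V U) Vp (conj Vp Up) opensIl).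
  rewrite -(@germM spec_rs) -(@germ1 spec_rs p (opensI V U) (conj Vp Up)).
  move=> /(@germP spec_rs)[W [W1 [W2 [Wp]]]].
  move=> /(congr1 (fun u : spec_sec W => u p Wp)) /= e.
  exists (t p (opensIl _ (W1 _ Wp))).
  by move: e; rewrite (Prop_irrelevance (opensIr _ (W1 _ Wp)) Up).
have [W [a [f [Wp sW]]]] := sec_valP s Up.
have [pf spE] := sW p Up Wp; rewrite spE => /frac_unit pa.
pose Z := opensI U (opensI W (basic_open a)).
have Zp : Z p by split.
have tF : locally_fraction (fun q (Zq : Z q) => frac f (opensIr _ (opensIr _ Zq))).
  move=> q Zq; exists Z, f, a; split=> // q' Zq' _.
  by exists (opensIr _ (opensIr _ Zq')).
exists (@germ spec_rs p Z Zp (SpecSec tF)).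
rewrite -(@germ_res spec_rs p U Z Up Zp opensIl) -(@germM spec_rs).
rewrite -(@germ1 spec_rs p Z Zp); congr germ; apply: spec_secP => q Zq.
rewrite sec_valM sec_val1 /=.
have [qf ->] := sW q (opensIl _ Zq) (opensIl _ (opensIr _ Zq)).
rewrite fracM frac1; apply/fracP; exists 1; [exact: prime1 | by ring].
Qed.

Lemma spec_local (p : spec_rs) : is_local (stalk p).
Proof.
have [l0 lD lM] := loc_local p; split=> [|x y|x y].
- rewrite /max_ideal /= -(@germ0 spec_rs p (opensT (spec A)) I).
  by move/germ_unit; exact: l0.
- elim/germ_ind: x => U Up s; elim/germ_ind: y => V Vp t.
  rewrite -(@germ_res spec_rs p U (opensI U V) Up (conj Up Vp) opensIl).
  rewrite -(@germ_res spec_rs p V (opensI U V) Vp (conj Up Vp) opensIr).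
  move=> hs ht; rewrite -(@germD spec_rs) => /germ_unit.
  by rewrite sec_valD; apply: lD => /germ_unit.
- by move=> hy [z zxy]; apply: hy; exists (z * x); rewrite -mulrA.
Qed.

Definition spec_lrs : lrs := LRS spec_local.

End Spec.

Section SpecMap.
Context (A B : comPzRingType) (phi : {rmorphism A -> B}).

Lemma comap_prime (q : spec B) : is_prime [set a | q (phi a)].
Proof.
have [[q0 qD qM] q1 qP] := primeP q; split=> /=.
- split=> [|x y|x y] /=; first by rewrite rmorph0.
  + by rewrite rmorphD; exact: qD.
  + by rewrite rmorphM; exact: qM.
- by rewrite rmorph1.
- by move=> x y; rewrite rmorphM; exact: qP.
Qed.

Definition comap (q : spec B) : spec A := Prime (comap_prime q).

Lemma comap_cont : continuous (comap : spec B -> spec A).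
Proof.
apply/continuousP => _ [E ->]; exists (phi @` E); apply/seteqP.
split=> [q [a Ea qa]|q [_ [a Ea <-] qa]]; last by exists a.
by exists (phi a) => //; exists a.
Qed.

Definition loc_map (q : spec B) (t : loc (comap q)) : loc q :=
  let r := qrepr t in
  @frac B q (phi (num r)) (phi (den r)) (@denP A (comap q) r).

Lemma loc_mapE (q : spec B) a s (qs : ~ comap q s) :
  loc_map (frac a qs) = @frac B q (phi a) (phi s) qs.
Proof.
rewrite /loc_map; have := qrepr_pi (P := loc_prering (comap q)) (Fraction a qs).
set r := qrepr _ => -[w qw /= e]; apply/fracP; exists (phi w) => //.
by rewrite -!rmorphM e.
Qed.

Section SecMap.
Context (U : opens (spec A)).
Let V := opens_preim comap_cont U.

Lemma sec_map_subproof (s : spec_sec U) :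
  @locally_fraction B V (fun q (Vq : V q) => loc_map (s (comap q) Vq)).
Proof.
move=> q Vq; have [W [a [f [Wq sW]]]] := sec_valP s (Vq : U (comap q)).
exists (opens_preim comap_cont W), (phi a), (phi f); split=> // q' Vq' Wq'.
have [q'f e] := sW (comap q') Vq' Wq'.
by exists q'f; rewrite e loc_mapE.
Qed.

Definition sec_map (s : spec_sec U) : spec_sec V := SpecSec (sec_map_subproof s).

Lemma loc_mapB q : {morph @loc_map q : x y / x - y}.
Proof.
elim/frac_ind=> a s qs; elim/frac_ind=> b t qt.
rewrite fracN fracD !loc_mapE fracN fracD; apply/fracP.
by exists 1; [exact: prime1 | rewrite !(rmorphD, rmorphM, rmorphN)].
Qed.

Lemma loc_mapM q : {morph @loc_map q : x y / x * y}.
Proof.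
elim/frac_ind=> a s qs; elim/frac_ind=> b t qt.
rewrite fracM !loc_mapE fracM; apply/fracP.
by exists 1; [exact: prime1 | rewrite !rmorphM].
Qed.

Lemma loc_map1 q : @loc_map q 1 = 1.
Proof.
rewrite frac1 loc_mapE frac1; apply/fracP.
by exists 1; [exact: prime1 | rewrite !rmorph1].
Qed.

Lemma sec_map_zmod : zmod_morphism sec_map.
Proof. by move=> s t; apply: spec_secP => q Vq; exact: loc_mapB. Qed.
Lemma sec_map_monoid : monoid_morphism sec_map.
Proof.
split=> [|s t]; apply: spec_secP => q Vq; [exact: loc_map1 | exact: loc_mapM].
Qed.

HB.instance Definition _ :=
  GRing.isZmodMorphism.Build (spec_sec U) (spec_sec V) sec_map sec_map_zmod.
HB.instance Definition _ :=
  GRing.isMonoidMorphism.Build (spec_sec U) (spec_sec V) sec_map sec_map_monoid.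

End SecMap.

Definition spec_map_rs : rs_mor (spec_lrs B) (spec_lrs A).
Proof.
apply: (@RSMor (spec_lrs B) (spec_lrs A) comap comap_cont
  (fun U => [the {rmorphism _ -> _} of @sec_map U])) => U V VU fVU s.
apply: spec_secP => q Vq /=.
by rewrite (Prop_irrelevance (VU (comap q) Vq) (fVU q Vq)).
Defined.

Lemma spec_map_local (q : spec_lrs B) (t : stalk (spec_map_rs q)) :
  is_unit (stalk_map t) -> is_unit t.
Proof.
elim/germ_ind: t => U Uq s; rewrite stalk_mapE => /germ_unit /=.
rewrite germ_unit; elim/frac_ind: (s _ _) => a f qf.
by rewrite loc_mapE => /frac_unit h; exact/frac_unit.
Qed.

Definition spec_map : mor (spec_lrs B) (spec_lrs A) := Mor spec_map_local.

End SpecMap.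

(* An isomorphism onto an open subspace of the target; accordingly, a scheme is
   a locally ringed space covered by images of open immersions of spectra. *)
Definition open_immersion (X Y : lrs) (j : mor X Y) : Prop :=
  [/\ injective j,
      forall U : opens X, open (j @` U) &
      forall U : opens Y, U `<=` range j -> bijective (mor_sec j U)].

Definition is_scheme (X : lrs) : Prop :=
  forall x : X, exists (A : comPzRingType) (j : mor (spec_lrs A) X),
    open_immersion j /\ range j x.

Record scheme := Scheme { scheme_lrs :> lrs; schemeP : is_scheme scheme_lrs }.

Lemma open_immersion_id (X : lrs) : open_immersion (mor_id X).
Proof.
split=> [x y //|U|U _].
  suff -> : mor_id X @` U = U by exact: opensP.
  by apply/seteqP; split=> [_ [x Ux <-]|x Ux] //; exists x.
have h : U `<=o` opens_preim (mor_cont (mor_id X)) U by [].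
by exists (res h) => s /=; rewrite (res_comp _ _ opens_refl) res_id.
Qed.

Lemma spec_is_scheme (A : comPzRingType) : is_scheme (spec_lrs A).
Proof.
by move=> x; exists A, (mor_id _); split; [exact: open_immersion_id | exists x].
Qed.

Definition Spec (A : comPzRingType) : scheme := Scheme (@spec_is_scheme A).

Definition Spec_map (A B : comPzRingType) (phi : {rmorphism A -> B}) :
  mor (Spec B) (Spec A) := spec_map phi.

(* P, with the projections p and q, is the fibre product of X and Y over Z *)
Definition is_pullback (X Y Z P : scheme) (f : mor X Z) (g : mor Y Z)
    (p : mor P X) (q : mor P Y) : Prop :=
  f \m p =m g \m q /\
  forall (T : scheme) (a : mor T X) (b : mor T Y), f \m a =m g \m b ->
    exists u : mor T P, [/\ p \m u =m a, q \m u =m b &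
      forall v : mor T P, p \m v =m a -> q \m v =m b -> v =m u].

(* A field onto which a local ring surjects is its residue field, since the
   kernel is the maximal ideal. *)
Record residue_field (Y : lrs) (z : Y) := ResidueField {
  kappa :> fieldType;
  kappa_proj : {rmorphism stalk z -> kappa};
  kappa_surj : forall c, exists t, kappa_proj t = c }.

Section PointMorphism.
Context (Y : lrs) (z : Y) (k : residue_field z).

Let pt (p : spec k) : Y := z.

Lemma pt_cont : continuous pt.
Proof. exact: cst_continuous. Qed.

Section PtSec.
Context (U : opens Y).
Let V := opens_preim pt_cont U.

Lemma pt_sec_subproof (s : sections U) :
  @locally_fraction k V
    (fun p (Uz : V p) => frac (kappa_proj k (germ (Uz : U z) s)) (@prime1 _ p)).
Proof.
move=> p Uz; exists V, (kappa_proj k (germ (Uz : U z) s)), 1; split=> // q Uz' _.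
by exists (@prime1 _ q); rewrite (Prop_irrelevance (Uz' : U z) Uz).
Qed.

Definition pt_sec (s : sections U) : spec_sec V := SpecSec (pt_sec_subproof s).

Lemma pt_sec_zmod : zmod_morphism pt_sec.
Proof.
move=> s t; apply: spec_secP => p Uz /=.
rewrite germD germN rmorphB fracN fracD; apply/fracP.
by exists 1; [exact: prime1 | ring].
Qed.
Lemma pt_sec_monoid : monoid_morphism pt_sec.
Proof.
split=> [|s t]; apply: spec_secP => p Uz /=.
  by rewrite germ1 rmorph1.
rewrite germM rmorphM fracM; apply/fracP.
by exists 1; [exact: prime1 | ring].
Qed.

HB.instance Definition _ :=
  GRing.isZmodMorphism.Build (sections U) (spec_sec V) pt_sec pt_sec_zmod.
HB.instance Definition _ :=
  GRing.isMonoidMorphism.Build (sections U) (spec_sec V) pt_sec pt_sec_monoid.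

End PtSec.

Definition point_rs : rs_mor (spec_lrs k) Y.
Proof.
apply: (@RSMor (spec_lrs k) Y pt pt_cont
  (fun U => [the {rmorphism _ -> _} of @pt_sec U])) => U V VU fVU s.
apply: spec_secP => p Vz /=.
by rewrite (germ_res (fVU p Vz : U z)).
Defined.

Lemma kappa_proj_unit (t : stalk z) : kappa_proj k t != 0 -> is_unit t.
Proof.
move=> t0; have [_ mD mM] := lrsP z; apply: contrapT => mt.
have [u ut] := kappa_surj (kappa_proj k t)^-1.
have [v] : is_unit (1 - u * t).
  apply: contrapT => m; have := mD _ _ m (mM u t mt).
  by rewrite subrK; apply; exists 1; rewrite mulr1.
move=> /(congr1 (kappa_proj k)) /eqP.
by rewrite rmorphM rmorphB rmorphM ut rmorph1 mulVf // subrr mulr0 eq_sym oner_eq0.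
Qed.

Lemma point_local (p : spec_lrs k) (t : stalk (point_rs p)) :
  is_unit (stalk_map t) -> is_unit t.
Proof.
elim/germ_ind: t => U Uz s; rewrite stalk_mapE => /germ_unit /frac_unit h.
apply: kappa_proj_unit; apply/eqP => e; apply: h; rewrite e; exact: prime0.
Qed.

Definition point_mor : mor (Spec k) Y := Mor point_local.

End PointMorphism.

Definition locally_noetherian (X : scheme) : Prop :=
  forall x : X, exists (A : comPzRingType) (j : mor (Spec A) X),
    [/\ noetherian A, open_immersion j & range j x].

Definition scheme_R (k : nat) (X : scheme) : Prop :=
  locally_noetherian X /\
  forall x : X, dim_le (stalk x) k -> regular_local (stalk x).

Section Flat.
Context (A B : comPzRingType) (phi : A -> B).

(* A-balanced biadditive maps, B being an A-module through phi *)
Definition balanced (N : lmodType A) (P : zmodType) (b : N -> B -> P) : Prop :=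
  [/\ forall n n' m, b (n + n') m = b n m + b n' m,
      forall n m m', b n (m + m') = b n m + b n m' &
      forall a n m, b (a *: n) m = b n (phi a * m)].

(* By the universal property of the tensor product, this says that the sum of
   the n (x) m, for (n, m) in t, is zero in the tensor product of N and B over A. *)
Definition tensor_zero (N : lmodType A) (t : seq (N * B)) : Prop :=
  forall (P : zmodType) (b : N -> B -> P), balanced b ->
    \sum_(x <- t) b x.1 x.2 = 0.

(* tensoring with B preserves injectivity of morphisms of A-modules *)
Definition flat : Prop :=
  forall (N N' : lmodType A) (i : {linear N -> N'}), injective i ->
  forall t : seq (N * B),
    tensor_zero [seq (i x.1, x.2) | x <- t] -> tensor_zero t.

End Flat.

Definition flat_mor (X Y : lrs) (f : mor X Y) : Prop :=
  forall x : X, flat (@stalk_map X Y f x).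

(* F is the fibre of f over z, and W its base change to K; as they are unique up
   to unique isomorphism, it does not matter which models are considered. *)
Definition mor_R (k : nat) (X Y : scheme) (f : mor X Y) : Prop :=
  flat_mor f /\
  forall (z : Y) (kz : residue_field z) (K : fieldExtType kz)
    (F : scheme) (p : mor F X) (q : mor F (Spec kz))
    (W : scheme) (p' : mor W F) (q' : mor W (Spec K)),
    is_pullback f (point_mor kz) p q ->
    is_pullback q (Spec_map (in_alg K)) p' q' ->
    scheme_R k W.

Definition mor_regular (X Y : scheme) (f : mor X Y) : Prop :=
  forall k, mor_R k f.

(* {malg k[G]} is the module of finitely supported functions from G to k; the
   library equips it with a product only for monoids without nontrivial units. *)
Section MonoidAlgebra.
Context (k : comNzRingType) (G : nmodType).

Definition monoid_algebra : Type := {malg k[G]}.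
HB.instance Definition _ := GRing.Zmodule.on monoid_algebra.

Implicit Types f g h : monoid_algebra.

Definition ma_one : monoid_algebra := << 1 *g (0 : G)%R >>.

Definition ma_mul f g : monoid_algebra :=
  \sum_(a <- msupp f) \sum_(b <- msupp g) << f@_a * g@_b *g (a + b)%R >>.

Lemma ma_mulw (d d' : {fset G}) f g :
  (msupp f `<=` d)%fset -> (msupp g `<=` d')%fset ->
  ma_mul f g = \sum_(a <- d) \sum_(b <- d') << f@_a * g@_b *g (a + b)%R >>.
Proof.
move=> le_d le_d'; rewrite /ma_mul (big_fset_incl _ le_d) /=.
  apply/eq_bigr=> a _; apply/big_fset_incl => // b _ /mcoeff_outdom ->.
  by rewrite mulr0 monalgU0.
move=> a _ /mcoeff_outdom fa.
by rewrite big1 // => b _; rewrite fa mul0r monalgU0.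
Qed.

Lemma ma_mulC : commutative ma_mul.
Proof.
move=> f g; rewrite /ma_mul exchange_big; apply/eq_bigr=> a _; apply/eq_bigr=> b _.
by rewrite mulrC addrC.
Qed.

Lemma ma_mulDl : left_distributive ma_mul +%R.
Proof.
move=> f f' g.
rewrite (@ma_mulw (msupp f `|` msupp f')%fset (msupp g) _ _ (msuppD_le _ _)) //.
rewrite (@ma_mulw (msupp f `|` msupp f')%fset (msupp g) f) ?fsubsetUl //.
rewrite (@ma_mulw (msupp f `|` msupp f')%fset (msupp g) f') ?fsubsetUr //.
rewrite -big_split /=; apply/eq_bigr=> a _.
rewrite -big_split /=; apply/eq_bigr=> b _.
by rewrite mcoeffD mulrDl monalgUD.
Qed.

Lemma ma_mulDr : right_distributive ma_mul +%R.
Proof. by move=> f g h; rewrite ma_mulC ma_mulDl !(ma_mulC f). Qed.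

Lemma ma_mul0 f : ma_mul 0 f = 0.
Proof. by rewrite /ma_mul msupp0 big_seq_fset0. Qed.

Lemma ma_mulUU c d a b :
  ma_mul << c *g a >> << d *g b >> = << c * d *g (a + b)%R >>.
Proof. by rewrite (ma_mulw msuppU_le msuppU_le) !big_seq_fset1 !mcoeffUU. Qed.

Lemma ma_mul1 : left_id ma_one ma_mul.
Proof.
move=> f; rewrite (ma_mulw msuppU_le (fsubset_refl _)) big_seq_fset1 [RHS]monalgE.
by apply/eq_bigr=> b _; rewrite mcoeffUU mul1r add0r.
Qed.

Lemma ma_mul_suml (I : Type) (r : seq I) (F : I -> monoid_algebra) g :
  ma_mul (\sum_(i <- r) F i) g = \sum_(i <- r) ma_mul (F i) g.
Proof.
exact: (big_morph (ma_mul^~ g) (fun _ _ => ma_mulDl _ _ _) (ma_mul0 g)).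
Qed.

Lemma ma_mul_sumr (I : Type) (r : seq I) (F : I -> monoid_algebra) g :
  ma_mul g (\sum_(i <- r) F i) = \sum_(i <- r) ma_mul g (F i).
Proof. by rewrite ma_mulC ma_mul_suml; apply/eq_bigr=> i _; exact: ma_mulC. Qed.

Lemma ma_ind (Q : monoid_algebra -> Prop) :
  Q 0 -> (forall f g, Q f -> Q g -> Q (f + g)) ->
  (forall c a, Q << c *g a >>) -> forall f, Q f.
Proof.
move=> Q0 QD QU f; rewrite [f]monalgE.
by elim/big_rec: _ => // a g _; apply: QD.
Qed.

Lemma ma_mulA : associative ma_mul.
Proof.
move=> f g h; elim/ma_ind: f => [|f f' Hf Hf'|c a]; first by rewrite !ma_mul0.
  by rewrite !ma_mulDl Hf Hf'.
elim/ma_ind: g => [|g g' Hg Hg'|d b].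
- by rewrite ma_mul0 (ma_mulC _ 0) !ma_mul0.
- by rewrite ma_mulDr !ma_mulDl ma_mulDr Hg Hg'.
elim/ma_ind: h => [|h h' Hh Hh'|e u].
- by rewrite !(ma_mulC _ 0) !ma_mul0 (ma_mulC _ 0) ma_mul0.
- by rewrite !ma_mulDr Hh Hh'.
by rewrite !ma_mulUU mulrA addrA.
Qed.

HB.instance Definition _ := GRing.Zmodule_isComPzRing.Build monoid_algebra
  ma_mulA ma_mulC ma_mul1 ma_mulDl.

End MonoidAlgebra.

Section MonoidAlgebraMap.
Context (k : comNzRingType) (G H : nmodType) (h : {additive G -> H}).

Definition ma_map (f : monoid_algebra k G) : monoid_algebra k H :=
  \sum_(a <- msupp f) << f@_a *g h a >>.

Lemma ma_mapw (d : {fset G}) (f : monoid_algebra k G) : (msupp f `<=` d)%fset ->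
  ma_map f = \sum_(a <- d) << f@_a *g h a >>.
Proof.
move=> le_d; apply: big_fset_incl => // a _ /mcoeff_outdom ->.
by rewrite monalgU0.
Qed.

Lemma ma_mapU c a : ma_map << c *g a >> = << c *g h a >>.
Proof. by rewrite (ma_mapw msuppU_le) big_seq_fset1 mcoeffUU. Qed.

Lemma ma_map_zmod : zmod_morphism ma_map.
Proof.
move=> f g; rewrite (@ma_mapw (msupp f `|` msupp g)%fset _ (msuppB_le _ _)).
rewrite (@ma_mapw (msupp f `|` msupp g)%fset f) ?fsubsetUl //.
rewrite (@ma_mapw (msupp f `|` msupp g)%fset g) ?fsubsetUr //.
by rewrite -sumrB; apply/eq_bigr=> a _; rewrite mcoeffB monalgUB.
Qed.

HB.instance Definition _ := GRing.isZmodMorphism.Build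
  (monoid_algebra k G) (monoid_algebra k H) ma_map ma_map_zmod.

Lemma ma_map_monoid : monoid_morphism ma_map.
Proof.
split=> [|f g]; first by rewrite [LHS]ma_mapU raddf0.
elim/ma_ind: f => [|f f' Hf Hf'|c a]; first by rewrite !(mul0r, raddf0).
  by rewrite mulrDl !raddfD /= mulrDl Hf Hf'.
elim/ma_ind: g => [|g g' Hg Hg'|d b]; first by rewrite !(mulr0, raddf0).
  by rewrite mulrDr !raddfD /= mulrDr Hg Hg'.
by rewrite [_ * _]ma_mulUU !ma_mapU raddfD [RHS]ma_mulUU.
Qed.

HB.instance Definition _ := GRing.isMonoidMorphism.Build
  (monoid_algebra k G) (monoid_algebra k H) ma_map ma_map_monoid.

End MonoidAlgebraMap.

Section Fans.
Context (R : realType) (V : vectType R).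
Implicit Types (N A sigma tau : set V) (Sigma : set (set V)).

Definition Zbasis N (e : seq V) : Prop :=
  N = [set x | exists c : 'I_(size e) -> int, x = \sum_(i < size e) e`_i *~ c i] /\
  forall c : 'I_(size e) -> int, \sum_(i < size e) e`_i *~ c i = 0 -> forall i, c i = 0.

Definition Rspan A : set V :=
  [set x | exists (s : seq V) (c : V -> R),
     (forall a, a \in s -> A a) /\ x = \sum_(a <- s) c a *: a].

Definition cone A : set V :=
  [set x | exists (s : seq V) (c : V -> R),
     (forall a, a \in s -> A a /\ 0 <= c a) /\ x = \sum_(a <- s) c a *: a].

(* The rank is that of a free abelian group: N has a basis of dim V elements. *)
Definition Zstructure N : Prop :=
  [/\ N 0, forall x y, N x -> N y -> N (x - y), Rspan N = setT &
      exists2 e, Zbasis N e & size e = \dim {:V}].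

(* sigma^vee_M: the elements of the dual Z-structure M of N that are nonnegative
   on sigma *)
Definition dual_cone N sigma : {pred 'Hom(V, R^o)} :=
  fun u => `[< (forall x, N x -> u x \is a Num.int) /\
               (forall x, sigma x -> 0 <= u x) >].

Definition contains_line sigma : Prop :=
  exists x v : V, v != 0 /\ forall r : R, sigma (x + r *: v).

Definition polycone N sigma : Prop :=
  (exists A, [/\ finite_set A, A `<=` N & sigma = cone A]) /\
  ~ contains_line sigma.

Definition face N sigma : set (set V) :=
  [set tau | exists2 u, u \in dual_cone N sigma &
     tau = sigma `&` [set x | u x = 0]].

Definition fan N Sigma : Prop :=
  [/\ finite_set Sigma,
      forall sigma, Sigma sigma -> polycone N sigma &
      forall sigma tau, Sigma sigma -> Sigma tau ->
        face N sigma (sigma `&` tau) /\ face N sigma `<=` Sigma].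

Definition regular_fan N Sigma : Prop :=
  forall sigma, Sigma sigma ->
    exists e A, [/\ Zbasis N e, A `<=` [set` e] & sigma = cone A].

Section DualMonoid.
Context (N sigma : set V).

Lemma dual_cone_addr_closed : addr_closed (dual_cone N sigma).
Proof.
split=> [|u v]; rewrite !unfold_in.
  by apply/asboolP; split=> x _; rewrite lfunE // rpred0.
move=> /asboolP[uN us] /asboolP[vN vs]; apply/asboolP; split=> x hx; rewrite lfunE /=.
  by apply: rpredD; [exact: uN | exact: vN].
by apply: addr_ge0; [exact: us | exact: vs].
Qed.

HB.instance Definition _ :=
  GRing.isAddClosed.Build 'Hom(V, R^o) (dual_cone N sigma) dual_cone_addr_closed.

Record dual_monoid := DualMonoid {
  dm_val :> 'Hom(V, R^o); dm_valP : dm_val \in dual_cone N sigma }.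

HB.instance Definition _ := [isSub for dm_val].
HB.instance Definition _ := [Choice of dual_monoid by <:].
HB.instance Definition _ := GRing.SubChoice_isSubNmodule.Build
  'Hom(V, R^o) (fun u => u \in dual_cone N sigma) dual_monoid
  dual_cone_addr_closed.

End DualMonoid.

Section DualInclusion.
Context (N sigma tau : set V) (ts : tau `<=` sigma).

Lemma dual_incl_subproof (u : dual_monoid N sigma) :
  dm_val u \in dual_cone N tau.
Proof.
have := dm_valP u; rewrite !unfold_in => /asboolP[uN us].
by apply/asboolP; split=> // x /ts; exact: us.
Qed.

Definition dual_incl (u : dual_monoid N sigma) : dual_monoid N tau :=
  DualMonoid (dual_incl_subproof u).

Lemma dual_incl_nmod : nmod_morphism dual_incl.
Proof. by split=> [|u v]; exact: val_inj. Qed.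

HB.instance Definition _ := GRing.isNmodMorphism.Build
  (dual_monoid N sigma) (dual_monoid N tau) dual_incl dual_incl_nmod.

End DualInclusion.

Definition affine_toric N sigma : scheme :=
  Spec (monoid_algebra int (dual_monoid N sigma)).

(* X_tau(Z) -> X_sigma(Z), induced by the inclusion of sigma^vee_M into
   tau^vee_M *)
Definition affine_toric_map N sigma tau (ts : tau `<=` sigma) :
    mor (affine_toric N tau) (affine_toric N sigma) :=
  Spec_map (@ma_map int (dual_monoid N sigma) (dual_monoid N tau)
    (@dual_incl N sigma tau ts)).

(* X is obtained by gluing the X_sigma(Z), for sigma in Sigma, along the
   X_(sigma `&` tau)(Z), with canonical open immersions iota; these conditions
   characterize the result of the gluing up to unique isomorphism. *)
Definition toric_gluing N Sigma (X : scheme)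
    (iota : forall sigma, Sigma sigma -> mor (affine_toric N sigma) X) : Prop :=
  [/\ forall sigma (Ss : Sigma sigma), open_immersion (iota sigma Ss),
      forall x : X, exists sigma (Ss : Sigma sigma), range (iota sigma Ss) x,
      forall sigma tau (Ss : Sigma sigma) (St : Sigma tau),
        iota sigma Ss \m affine_toric_map N (@subIsetl _ sigma tau) =m
        iota tau St \m affine_toric_map N (@subIsetr _ sigma tau) &
      forall sigma tau (Ss : Sigma sigma) (St : Sigma tau),
        range (iota sigma Ss) `&` range (iota tau St) =
        range (iota sigma Ss \m affine_toric_map N (@subIsetl _ sigma tau))].

Definition is_toric_schemeZ N Sigma (X : scheme) : Prop :=
  exists iota, @toric_gluing N Sigma X iota.

(* t : X -> S is the projection of the base change of X_Sigma(Z) to S; the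
   morphisms a and b to Spec Z are uniquely determined. *)
Definition is_toric_scheme N Sigma (S X : scheme) (t : mor X S) : Prop :=
  exists (XZ : scheme) (a : mor XZ (Spec int)) (b : mor S (Spec int))
    (p : mor X XZ),
    is_toric_schemeZ N Sigma XZ /\ is_pullback a b p t.

End Fans.

(* Main.v *)
From HB Require Import structures.
Require Import Defs.
From mathcomp Require Import all_boot all_order all_algebra all_field ring.
From mathcomp Require Import finmap monalg zify.
From mathcomp Require Import all_classical reals topology.

(* Over an affine open Spec C of S and a chart Spec Z[G] of X_Sigma(Z), where G is
   the dual monoid of a cone, the toric scheme is Spec C[G]. Hence t is flat, and
   everything reduces to the monoid algebras K[G] over the residue field extensions
   K of the points of S. For a regular cone, K[G] is a localization of a polynomial
   ring, and prime by prime the local rings of a polynomial ring are seen to be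
   regular. Conversely, the local ring of K[G] at the distinguished point (chi^g maps
   to 1 if g is a unit of G, and to 0 otherwise) has dimension at most n, hence is
   regular by (R_n). Its cotangent space carries independent derivations: the
   coordinates of the units of G and the indicators of the classes of irreducible
   elements modulo units. So a basis of the group of units together with
   representatives of these classes has at most n elements; as it generates the
   lattice M, it is a Z-basis, and by Farkas' lemma the part of the dual basis of N
   that belongs to the irreducible elements generates the cone. *)

Set Implicit Arguments.
Unset Strict Implicit.
Unset Printing Implicit Defensive.

Import Order.TTheory GRing.Theory Num.Theory.

Local Open Scope classical_set_scope.
Local Open Scope ring_scope.

(** * Locally ringed spaces *)

(** Neither the toric scheme nor its fibres come from a construction: they are known through
    universal properties, tested against schemes. So the charts of $X$ have to be extracted from the
    universal property, and to see that they are open embeddings one tests it on open subspaces of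
    $X$, which must first be shown to be schemes. The hypothesis $(R_n)$ speaks of every model of a
    fibre but provides none; hence the fibre is built as a locally ringed space with its universal
    property there, and is then covered by the spectra of $\kappa(z)[G]$. Morphisms are handled
    stalk by stalk, because the preimages of an open set under two equal morphisms agree only
    propositionally. For a prime of a polynomial ring in $n$ variables a certificate of regularity
    ([regular_prime]) is carried through the induction on $n$; it bounds the dimension of the local
    ring from both sides. The upper bounds rest on the fact that more than $n$ elements of $K[G]$
    are algebraically dependent, which holds because the monomials in them outnumber the lattice
    points that can support them. *)

Section UnitLemmas.
Context (A B : comPzRingType).

Lemma is_unit1 : is_unit (1 : A).
Proof. by exists 1; rewrite mulr1. Qed.

Lemma is_unitM (x y : A) : is_unit x -> is_unit y -> is_unit (x * y).
Proof. by case=> u ux [v vy]; exists (v * u); rewrite -mulrA (mulrA u) ux mul1r. Qed.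

Lemma is_unitMl (x y : A) : is_unit (x * y) -> is_unit x.
Proof. by case=> u h; exists (u * y); rewrite -mulrA (mulrC y). Qed.

Lemma is_unitMr (x y : A) : is_unit (x * y) -> is_unit y.
Proof. by rewrite mulrC; exact: is_unitMl. Qed.

Lemma is_unit_morph (f : {rmorphism A -> B}) x : is_unit x -> is_unit (f x).
Proof. by case=> y yx; exists (f y); rewrite -rmorphM yx rmorph1. Qed.

Lemma is_unit_inj (x y z : A) : is_unit x -> x * y = x * z -> y = z.
Proof. by case=> u ux e; rewrite -[y]mul1r -[z]mul1r -ux -!mulrA e. Qed.

End UnitLemmas.

Section Stalks.
Context (X : ringed_space).

Lemma germ_zmod (x : X) (U : opens X) (Ux : U x) : zmod_morphism (germ Ux).
Proof. by move=> s t; rewrite germD germN. Qed.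
Lemma germ_monoid (x : X) (U : opens X) (Ux : U x) : monoid_morphism (germ Ux).
Proof. by split; [exact: germ1 | exact: germM]. Qed.

HB.instance Definition _ (x : X) (U : opens X) (Ux : U x) :=
  GRing.isZmodMorphism.Build (sections U) (stalk x) (germ Ux) (germ_zmod Ux).
HB.instance Definition _ (x : X) (U : opens X) (Ux : U x) :=
  GRing.isMonoidMorphism.Build (sections U) (stalk x) (germ Ux) (germ_monoid Ux).

Lemma germ_irr (x : X) (U : opens X) (h h' : U x) s : germ h s = germ h' s.
Proof. by rewrite (Prop_irrelevance h h'). Qed.

Lemma germ_sep (U : opens X) (s t : sections U) :
  (forall x (Ux : U x), germ Ux s = germ Ux t) -> s = t.
Proof.
move=> e.
pose C := [set V : opens X | exists h : V `<=o` U, res h s = res h t].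
have CU V : C V -> V `<=o` U by case.
apply: (@res_sep X U C CU s t) => [x Ux|V CV].
  move/germP: (e x Ux) => [W [h [h1 [Wx eW]]]].
  by exists W => //; exists h; rewrite eW (Prop_irrelevance h1 h).
by have [h eV] := CV; rewrite (Prop_irrelevance (CU V CV) h).
Qed.

Lemma germ_near (x : X) (U V : opens X) (Ux : U x) (Vx : V x) s t :
  germ Ux s = germ Vx t ->
  exists W : opens X, [/\ W x, W `<=o` U, W `<=o` V &
    forall y (Uy : U y) (Vy : V y), W y -> germ Uy s = germ Vy t].
Proof.
move=> /germP [W [WU [WV [Wx e]]]]; exists W; split=> // y Uy Vy Wy.
by apply/germP; exists W, WU, WV.
Qed.

(** The sheaf axiom for sections singled out by a property: uniqueness over the subsets of [U]
    replaces the compatibility of a chosen family. *)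
Lemma glue_prop (U : opens X) (Q : forall V : opens X, sections V -> Prop) :
  (forall (V W : opens X) (WV : W `<=o` V) s, Q V s -> Q W (res WV s)) ->
  (forall (V : opens X) s t, V `<=o` U -> Q V s -> Q V t -> s = t) ->
  (forall x, U x -> exists V : opens X, [/\ V x, V `<=o` U & exists s, Q V s]) ->
  exists t : sections U, forall x (Ux : U x), exists V : opens X,
    exists h : V `<=o` U, V x /\ Q V (res h t).
Proof.
move=> Qres Quniq Qex.
pose C := [set V : opens X | V `<=o` U /\ exists s, Q V s].
have CU V : C V -> V `<=o` U by case.
(* [res_glue] takes a section over every open set; off the cover the value 0 is arbitrary. *)
pose s (V : opens X) : sections V :=
  match pselect (exists s, Q V s) with left h => projT1 (cid h) | _ => 0 end.
have sQ V : C V -> Q V (s V).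
  by move=> [_ h]; rewrite /s; case: pselect => // h'; exact: (projT2 (cid h')).
have [x Ux||t tP] := @res_glue X U C CU s.
- by have [V [Vx VU sV]] := Qex x Ux; exists V.
- move=> V W CV CW; apply: Quniq; [|exact/Qres/sQ|exact/Qres/sQ].
  by apply: (opens_trans opensIl); exact: CU.
exists t => x Ux; have [V [Vx VU sV]] := Qex x Ux.
have CV : C V by [].
by exists V, (CU V CV); split=> //; rewrite (tP V CV); exact: sQ.
Qed.

(** Continuity of a section of the étalé space. Sections and morphisms are built from such families
    of germs, so that no representatives over open sets have to be matched. *)
Definition locally_sec (U : opens X) (psi : forall x, U x -> stalk x) :=
  forall x, U x -> exists (W : opens X) (s : sections W),
    W x /\ forall y (Wy : W y) (Uy : U y), psi y Uy = germ Wy s.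

Lemma glue_germs (U : opens X) (psi : forall x, U x -> stalk x) :
  locally_sec psi -> exists s : sections U, forall x (Ux : U x), germ Ux s = psi x Ux.
Proof.
move=> psiP.
pose Q (V : opens X) (s : sections V) :=
  forall x (Vx : V x) (Ux : U x), psi x Ux = germ Vx s.
have [V W WV s QV x Wx Ux|V s t VU Qs Qt|x Ux|s sP] := @glue_prop U Q.
- by rewrite (germ_res (WV _ Wx)).
- by apply: germ_sep => x Vx; rewrite -(Qs x Vx (VU _ Vx)) -(Qt x Vx (VU _ Vx)).
- have [W [s [Wx sW]]] := psiP x Ux.
  exists (opensI U W); split=> //; first exact: opensIl.
  exists (res (@opensIr _ U W) s) => y Vy Uy.
  by rewrite (germ_res (opensIr _ Vy)); apply: sW.
exists s => x Ux; have [V [h [Vx QV]]] := sP x Ux.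
by rewrite (QV x Vx Ux) (germ_res (h _ Vx)) (germ_irr _ Ux).
Qed.

End Stalks.

Section StalkMap.
Context (X Y : ringed_space) (f : rs_mor X Y) (x : X).

Lemma stalk_map_zmod : zmod_morphism (@stalk_map X Y f x).
Proof.
elim/germ_ind=> U Ux s; elim/germ_ind=> V Vx t.
have Ix : opensI U V (f x) by split.
rewrite -(germ_res Ux Ix opensIl) -(germ_res Vx Ix opensIr) -rmorphB !stalk_mapE.
by rewrite -rmorphB -rmorphB.
Qed.

Lemma stalk_map_monoid : monoid_morphism (@stalk_map X Y f x).
Proof.
split; first by rewrite -(germ1 (I : opensT Y (f x))) stalk_mapE !rmorph1.
elim/germ_ind=> U Ux s; elim/germ_ind=> V Vx t.
have Ix : opensI U V (f x) by split.
rewrite -(germ_res Ux Ix opensIl) -(germ_res Vx Ix opensIr) -rmorphM !stalk_mapE.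
by rewrite -rmorphM -rmorphM.
Qed.

HB.instance Definition _ := GRing.isZmodMorphism.Build
  (stalk (f x)) (stalk x) (@stalk_map X Y f x) stalk_map_zmod.
HB.instance Definition _ := GRing.isMonoidMorphism.Build
  (stalk (f x)) (stalk x) (@stalk_map X Y f x) stalk_map_monoid.

End StalkMap.

Section MorphismEquality.

(** The stalks at [f x] and [g x] are different types even when the points are equal; the comparison
    goes through one section read at both points. *)
Definition germ_eq (X Y : ringed_space) (f g : rs_mor X Y) (x : X) :=
  forall (U : opens Y) (h : U (f x)) (h' : U (g x)) s,
    @stalk_map X Y f x (germ h s) = @stalk_map X Y g x (germ h' s).

Lemma mor_eqP (X Y : ringed_space) (f g : rs_mor X Y) :
  f =m g <-> (forall x, f x = g x) /\ forall x, germ_eq f g x.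
Proof.
split=> -[e H]; split=> //.
- move=> x U h h' s; rewrite !stalk_mapE.
  pose Wo := opensI (opens_preim (mor_cont f) U) (opens_preim (mor_cont g) U).
  have Wx : Wo x by split.
  rewrite -(germ_res (h : opens_preim (mor_cont f) U x) Wx opensIl).
  by rewrite -(germ_res (h' : opens_preim (mor_cont g) U x) Wx opensIr); congr germ; exact: H.
- move=> U W Wf Wg s; apply: germ_sep => x Wx.
  rewrite (germ_res (Wf x Wx)) (germ_res (Wg x Wx)).
  by rewrite -(stalk_mapE (Wf x Wx)) -(stalk_mapE (Wg x Wx)); exact: H.
Qed.

Lemma mor_eq_refl (X Y : ringed_space) (f : rs_mor X Y) : f =m f.
Proof. by apply/mor_eqP; split=> // x U h h' s; rewrite (germ_irr h h'). Qed.

Lemma mor_eq_sym (X Y : ringed_space) (f g : rs_mor X Y) : f =m g -> g =m f.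
Proof. by move/mor_eqP=> [e H]; apply/mor_eqP; split=> // x U h h' s; rewrite (H x U h' h). Qed.

Lemma mor_eq_trans (X Y : ringed_space) (f g h : rs_mor X Y) :
  f =m g -> g =m h -> f =m h.
Proof.
move/mor_eqP=> [e H] /mor_eqP [e' H']; apply/mor_eqP; split=> [x|x U k k' s].
  by rewrite e.
have k2 : U (g x) by rewrite -e.
by rewrite (H x U k k2) (H' x U k2 k').
Qed.

Context (X Y Z : lrs).

Lemma stalk_map_comp (g : mor Y Z) (f : mor X Y) (x : X) (t : stalk (g (f x))) :
  @stalk_map X Z (g \m f) x t = @stalk_map X Y f x (@stalk_map Y Z g (f x) t).
Proof.
elim/germ_ind: t => U Ux s; rewrite (stalk_mapE (f := g \m f)) !stalk_mapE /=.
exact: germ_res.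
Qed.

Lemma mor_eq_comp (g g' : mor Y Z) (f f' : mor X Y) :
  g =m g' -> f =m f' -> g \m f =m g' \m f'.
Proof.
move/mor_eqP=> [e H] /mor_eqP [e' H']; apply/mor_eqP.
split=> [x|x U h h' s]; first by rewrite /= e e'.
have h2 : U (g' (f x)) by rewrite -e.
rewrite !stalk_map_comp (H (f x) U h h2) !(stalk_mapE (f := g')); exact: H'.
Qed.

End MorphismEquality.

Lemma mor_comp_id (X Y : lrs) (f : mor X Y) : mor_id Y \m f =m f.
Proof.
apply/mor_eqP; split=> // x U h h' s.
rewrite stalk_map_comp (stalk_mapE (f := mor_id Y)) /= (germ_res (V := opens_preim _ U) (h : U (f x))).
by rewrite (germ_irr h h').
Qed.

Lemma mor_id_comp (X Y : lrs) (f : mor X Y) : f \m mor_id X =m f.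
Proof.
apply/mor_eqP; split=> // x U h h' s.
rewrite stalk_map_comp (stalk_mapE (f := f) h) (stalk_mapE (f := f) h').
rewrite (stalk_mapE (f := mor_id X) (U := opens_preim (mor_cont f) U) h) /=.
exact: germ_res.
Qed.

Lemma mor_comp_assoc (X Y Z T : lrs) (h : mor Z T) (g : mor Y Z) (f : mor X Y) :
  h \m (g \m f) =m (h \m g) \m f.
Proof.
apply/mor_eqP; split=> // x U k k' s.
by rewrite !stalk_map_comp (germ_irr k k').
Qed.

(** * Morphisms assembled from stalk maps *)

Section MakeMorphism.
Context (X Y : lrs) (f : X -> Y) (cf : continuous f).
Context (phi : forall x, {rmorphism stalk (f x) -> stalk x}).
Hypothesis phi_sec : forall (U : opens Y) (s : sections U),
  @locally_sec X (opens_preim cf U) (fun x (Ux : U (f x)) => phi x (germ Ux s)).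
Hypothesis phi_local : forall x t, is_unit (phi x t) -> is_unit t.

Let sec_ex (U : opens Y) (s : sections U) :=
  cid (glue_germs (@phi_sec U s)).

Definition mk_sec (U : opens Y) (s : sections U) : sections (opens_preim cf U) :=
  projT1 (sec_ex s).

Lemma mk_secE (U : opens Y) (s : sections U) x (Ux : U (f x)) :
  @germ X x (opens_preim cf U) Ux (mk_sec s) = phi x (germ Ux s).
Proof. exact: (projT2 (sec_ex s)). Qed.

Lemma mk_sec_zmod U : zmod_morphism (@mk_sec U).
Proof.
by move=> s t; apply: germ_sep => x Ux; rewrite [RHS]rmorphB /= !mk_secE rmorphB rmorphB.
Qed.

Lemma mk_sec_monoid U : monoid_morphism (@mk_sec U).
Proof.
split=> [|s t]; apply: germ_sep => x Ux.
  by rewrite [RHS]rmorph1 mk_secE rmorph1 rmorph1.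
by rewrite [RHS]rmorphM /= !mk_secE rmorphM rmorphM.
Qed.

HB.instance Definition _ U := GRing.isZmodMorphism.Build
  (sections U) (sections (opens_preim cf U)) (@mk_sec U) (@mk_sec_zmod U).
HB.instance Definition _ U := GRing.isMonoidMorphism.Build
  (sections U) (sections (opens_preim cf U)) (@mk_sec U) (@mk_sec_monoid U).

Definition mk_rs : rs_mor X Y.
Proof.
apply: (@RSMor X Y f cf (fun U => [the {rmorphism _ -> _} of @mk_sec U])).
move=> U V VU fVU s; apply: germ_sep => x Vx /=.
rewrite mk_secE (germ_res (fVU x Vx)) (germ_res (VU _ Vx)).
by rewrite (mk_secE s (fVU x Vx)) (germ_irr (VU (f x) Vx) (fVU x Vx : U (f x))).
Defined.

Lemma stalk_map_mk_rs x (t : stalk (f x)) : @stalk_map X Y mk_rs x t = phi x t.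
Proof. by elim/germ_ind: t => U Ux s; rewrite (stalk_mapE (f := mk_rs)) mk_secE. Qed.

Lemma mk_rs_local (x : X) (t : stalk (mk_rs x)) : is_unit (stalk_map t) -> is_unit t.
Proof. by rewrite stalk_map_mk_rs; exact: phi_local. Qed.

Definition mk_mor : mor X Y := Mor mk_rs_local.

Lemma stalk_map_mk x (t : stalk (f x)) : @stalk_map X Y mk_mor x t = phi x t.
Proof. exact: stalk_map_mk_rs. Qed.

End MakeMorphism.

Section RingMorphisms.
Context (A B : comPzRingType).

Lemma rmorphism_of (f : A -> B) : zmod_morphism f -> monoid_morphism f ->
  exists g : {rmorphism A -> B}, forall x, g x = f x.
Proof.
move=> fz fm.
pose g : {rmorphism A -> B} := HB.pack_for {rmorphism A -> B} f
  (GRing.isZmodMorphism.Build A B f fz) (GRing.isMonoidMorphism.Build A B f fm).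
by exists g.
Qed.

(** A homomorphism as a functional relation: in the uses below a value is found through a fraction
    or a representing section, and what has to be shown is its independence of that choice. *)
Lemma rmorphism_of_rel (rel : A -> B -> Prop) :
  (forall a, exists b, rel a b) -> (forall a b b', rel a b -> rel a b' -> b = b') ->
  rel 1 1 -> (forall a a' b b', rel a b -> rel a' b' -> rel (a - a') (b - b')) ->
  (forall a a' b b', rel a b -> rel a' b' -> rel (a * a') (b * b')) ->
  exists g : {rmorphism A -> B}, forall x, rel x (g x).
Proof.
move=> ex uniq r1 rB rM.
pose f a := projT1 (cid (ex a)).
have fP a : rel a (f a) by exact: (projT2 (cid (ex a))).
have [x y||g gE] := @rmorphism_of f.
- by apply: uniq (fP _) _; exact: rB.
- by split=> [|x y]; apply: uniq (fP _) _ => //; exact: rM.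
by exists g => x; rewrite gE.
Qed.

End RingMorphisms.

Lemma rmorphism_inv (A B : comPzRingType) (h : {rmorphism A -> B}) : bijective h ->
  exists g : {rmorphism B -> A}, cancel h g /\ cancel g h.
Proof.
case=> g hK gK.
have hi := can_inj hK.
have [x y||g' gE] := @rmorphism_of B A g.
- by apply: hi; rewrite rmorphB !gK.
- by split=> [|x y]; apply: hi; rewrite ?rmorph1 ?rmorphM !gK.
by exists g'; split=> x; rewrite gE.
Qed.

(** * Localizations at a prime, up to isomorphism *)

Section IsLoc.
Context (A : comPzRingType) (p : spec A).

(** Being a localization at [p] is made a property of [al], so that stalks of spectra, stalks at
    points of charts and abstract localizations are treated alike. *)
Definition is_loc (L : comPzRingType) (al : A -> L) : Prop :=
  [/\ forall s, ~ p s -> is_unit (al s),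
      forall x, exists a s, ~ p s /\ al s * x = al a &
      forall a, al a = 0 -> exists2 w, ~ p w & w * a = 0].

Context (L : comPzRingType) (al : {rmorphism A -> L}) (alP : is_loc al).

Lemma loc_unitP s : is_unit (al s) <-> ~ p s.
Proof.
have [alu als alk] := alP; split; last exact: alu.
case=> x xs ps; have [a [t [pt e]]] := als x.
have : al (t - s * a) = 0.
  by rewrite rmorphB rmorphM -e mulrCA (mulrC (al s)) xs mulr1 subrr.
case/alk=> w pw e'; apply: (primeNM pw pt).
have -> : w * t = w * s * a by move/eqP: e'; rewrite mulrBr subr_eq0 mulrA => /eqP.
by apply/primeMr/primeMl.
Qed.

Lemma loc_univ (B : comPzRingType) (psi : {rmorphism A -> B}) :
  (forall s, ~ p s -> is_unit (psi s)) ->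
  exists h : {rmorphism L -> B}, forall a, h (al a) = psi a.
Proof.
move=> psiu; have [alu als alk] := alP.
pose rel l b := exists a s, [/\ ~ p s, al s * l = al a & psi s * b = psi a].
have uniq l b b' : rel l b -> rel l b' -> b = b'.
  move=> [a [s [ps e1 e2]]] [a' [s' [ps' e1' e2']]].
  have : al (s * a' - s' * a) = 0.
    by rewrite rmorphB !rmorphM -e1 -e1' mulrCA subrr.
  case/alk => w pw /(congr1 psi); rewrite rmorphM rmorphB !rmorphM rmorph0 -e2 -e2' => e.
  apply/esym/(is_unit_inj (psiu _ (primeNM pw (primeNM ps ps')))).
  apply/eqP; rewrite -subr_eq0 -mulrBr !rmorphM; apply/eqP; rewrite -[RHS]e; ring.
have [l||a a' b b'|a a' b b'|h hP] := @rmorphism_of_rel L B rel _ uniq.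
- have [a [s [ps e]]] := als l; have [u us] := psiu s ps.
  by exists (u * psi a), a, s; split=> //; rewrite mulrA (mulrC (psi s)) us mul1r.
- by exists 1, 1; split; rewrite ?mulr1 //; exact: prime1.
- move=> [c [s [ps e1 e2]]] [c' [s' [ps' e1' e2']]].
  exists (s' * c - s * c'), (s * s'); split; first exact: primeNM.
    by rewrite rmorphB !rmorphM -e1 -e1'; ring.
  by rewrite rmorphB !rmorphM -e2 -e2'; ring.
- move=> [c [s [ps e1 e2]]] [c' [s' [ps' e1' e2']]].
  exists (c * c'), (s * s'); split; first exact: primeNM.
    by rewrite !rmorphM -e1 -e1'; ring.
  by rewrite !rmorphM -e2 -e2'; ring.
exists h => a; apply: uniq (hP _) _.
by exists a, 1; rewrite !rmorph1 !mul1r; split=> //; exact: prime1.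
Qed.

Lemma loc_ext (B : comPzRingType) (h h' : {rmorphism L -> B}) :
  (forall a, h (al a) = h' (al a)) -> forall x, h x = h' x.
Proof.
move=> e x; have [alu als _] := alP; have [a [s [ps xs]]] := als x.
have hs := is_unit_morph h (alu s ps); apply: (is_unit_inj hs).
by rewrite -rmorphM xs e e -rmorphM xs.
Qed.

Lemma is_loc_comp (L' : comPzRingType) (h : {rmorphism L -> L'}) :
  bijective h -> is_loc (h \o al).
Proof.
move=> hb; have [alu als alk] := alP; have hi := bij_inj hb; split=> [s ps|x|a /=].
- exact: (is_unit_morph h (alu s ps)).
- case: hb => g hK gK; have [a [s [ps e]]] := als (g x).
  by exists a, s; split=> //=; rewrite -e rmorphM gK.
- by rewrite -[RHS](rmorph0 h) => /hi; exact: alk.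
Qed.

Lemma loc_bij (L' : comPzRingType) (al' : {rmorphism A -> L'}) (h : {rmorphism L -> L'}) :
  is_loc al' -> (forall a, h (al a) = al' a) -> bijective h.
Proof.
move=> alP' e; have [alu als alk] := alP; have [alu' als' alk'] := alP'.
have hi : injective h.
  move=> x y exy; apply/eqP; rewrite -subr_eq0; apply/eqP.
  have {}exy : h (x - y) = 0 by rewrite rmorphB exy subrr.
  move: (x - y) exy => {x y} x hx; have [a [s [ps xs]]] := als x.
  have : al' a = 0 by rewrite -e -xs rmorphM hx mulr0.
  move=> /alk' [w pw wa]; apply: (is_unit_inj (alu _ (primeNM pw ps))).
  by rewrite rmorphM -mulrA xs -rmorphM wa rmorph0 mulr0.
have hs y : exists x, h x = y.
  have [a [s [ps ys]]] := als' y; have [u us] := alu s ps.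
  exists (u * al a); apply: (is_unit_inj (alu' _ ps)).
  by rewrite ys -!e -rmorphM mulrA (mulrC (al s)) us mul1r.
pose g y := projT1 (cid (hs y)).
have gK : cancel g h by move=> y; exact: (projT2 (cid (hs y))).
by exists g => // x; apply: hi; rewrite gK.
Qed.

End IsLoc.

Section SpecStalk.
Context (A : comPzRingType).

Lemma sec_cst_zmod U : zmod_morphism (@sec_cst A U).
Proof.
move=> a b; apply: spec_secP => p Up; rewrite sec_valD sec_valN /= fracN fracD.
by apply/fracP; exists 1; [exact: prime1 | ring].
Qed.
Lemma sec_cst_monoid U : monoid_morphism (@sec_cst A U).
Proof.
split=> [|a b]; apply: spec_secP => p Up //.
rewrite sec_valM /= fracM.
by apply/fracP; exists 1; [exact: prime1 | ring].
Qed.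

HB.instance Definition _ U := GRing.isZmodMorphism.Build
  A (spec_sec U) (@sec_cst A U) (@sec_cst_zmod U).
HB.instance Definition _ U := GRing.isMonoidMorphism.Build
  A (spec_sec U) (@sec_cst A U) (@sec_cst_monoid U).

Definition spec_germ (p : spec_lrs A) (a : A) : stalk p :=
  @germ (spec_lrs A) p (opensT _) I (sec_cst _ a).

Lemma spec_germ_zmod p : zmod_morphism (spec_germ p).
Proof. by move=> a b; rewrite /spec_germ rmorphB [LHS]rmorphB. Qed.
Lemma spec_germ_monoid p : monoid_morphism (spec_germ p).
Proof.
split=> [|a b]; rewrite /spec_germ.
  by rewrite (rmorph1 (sec_cst (opensT (spec_lrs A)))); exact: (@germ1 (spec_lrs A)).
by rewrite rmorphM [LHS]rmorphM.
Qed.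

HB.instance Definition _ p := GRing.isZmodMorphism.Build
  A (stalk p) (spec_germ p) (spec_germ_zmod p).
HB.instance Definition _ p := GRing.isMonoidMorphism.Build
  A (stalk p) (spec_germ p) (spec_germ_monoid p).

Lemma spec_germE (p : spec_lrs A) (U : opens (spec_lrs A)) (Up : U p) a :
  @germ (spec_lrs A) p U Up (sec_cst U a) = spec_germ p a.
Proof.
have h : U `<=o` opensT (spec_lrs A) by [].
rewrite /spec_germ -(@germ_res (spec_lrs A) p (opensT (spec_lrs A)) U I Up h); congr germ.
exact: spec_secP.
Qed.

(** One fraction [a / f] represents [s] at all points near [p]; the equation is multiplied out so
    that it lives in the stalks. *)
Lemma spec_germ_near (p : spec_lrs A) (U : opens (spec_lrs A)) (Up : U p)
    (s : @sections (spec_lrs A) U) :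
  exists (W : opens (spec_lrs A)) (a f : A), W p /\
    forall q (Uq : U q), W q -> ~ q f /\ spec_germ q f * germ Uq s = spec_germ q a.
Proof.
have [W [a [f [Wp sW]]]] := sec_valP s Up.
exists W, a, f; split=> // q Uq Wq.
split; first by case: (sW q Uq Wq).
have Iq : opensI U W q by split.
rewrite -(spec_germE Iq) -(spec_germE Iq a).
rewrite -(@germ_res (spec_lrs A) q U (opensI U W) Uq Iq opensIl) -[LHS]rmorphM.
congr germ; apply: spec_secP => r Ir; rewrite sec_valM /=.
have [rf ->] := sW r (opensIl _ Ir) (opensIr _ Ir).
by rewrite fracM; apply/fracP; exists 1; [exact: prime1 | ring].
Qed.

Lemma spec_germ_unit (p : spec_lrs A) a : is_unit (spec_germ p a) <-> ~ p a.
Proof. by rewrite /spec_germ germ_unit /=; exact: frac_unit. Qed.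

Lemma spec_stalk_loc (p : spec_lrs A) : is_loc p (spec_germ p).
Proof.
split=> [s ps|x|a].
- exact/spec_germ_unit.
- elim/(@germ_ind (spec_lrs A)): x => U Up s.
  have [W [a [f [Wp H]]]] := spec_germ_near Up s.
  by have [pf e] := H p Up Wp; exists a, f.
- rewrite -[RHS](rmorph0 (spec_germ p)) => /germP [W [h1 [h2 [Wp]]]].
  move/(congr1 (fun t : spec_sec W => t p Wp)) => /= /fracP [w pw].
  by rewrite !mulr1 mulr0 => e; exists w.
Qed.

End SpecStalk.

(** * Morphisms to affine schemes *)

Section Adjunction.
Context (T : lrs) (A : comPzRingType).

(** The homomorphism from [A] to the stalk at [x] that belongs to a morphism to the spectrum of [A].
    Together, [glob_inj] and [adj_exists] are the adjunction between spectra and global sections, a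
    global section being replaced by its germs. *)
Definition glob (f : mor T (spec_lrs A)) (x : T) (a : A) : stalk x :=
  @stalk_map _ _ f x (spec_germ (f x) a).

Lemma glob_zmod f x : zmod_morphism (glob f x).
Proof. by move=> a b; rewrite /glob rmorphB [LHS]rmorphB. Qed.
Lemma glob_monoid f x : monoid_morphism (glob f x).
Proof.
split=> [|a b]; rewrite /glob.
  by rewrite (rmorph1 (spec_germ (f x))); exact: (rmorph1 (@stalk_map _ _ f x)).
by rewrite rmorphM [LHS]rmorphM.
Qed.

HB.instance Definition _ f x := GRing.isZmodMorphism.Build
  A (stalk x) (glob f x) (glob_zmod f x).
HB.instance Definition _ f x := GRing.isMonoidMorphism.Build
  A (stalk x) (glob f x) (glob_monoid f x).

Lemma glob_unit f x a : is_unit (glob f x a) <-> ~ f x a.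
Proof.
rewrite -spec_germ_unit; split; first exact: mor_local.
exact: (is_unit_morph (@stalk_map _ _ f x)).
Qed.

Lemma spec_eq (p q : spec A) : (forall a, p a <-> q a) -> p = q.
Proof.
case: p q => [p pP] [q qP] /= e.
have epq : p = q by apply/funext => a; exact/propext.
by subst q; congr Prime; exact: Prop_irrelevance.
Qed.

Lemma spec_unit_ext (x : T) (p q : spec A) (al be : A -> stalk x) :
  (forall a, is_unit (al a) <-> ~ p a) -> (forall a, is_unit (be a) <-> ~ q a) ->
  al =1 be -> p = q.
Proof.
move=> ap bq e; apply: spec_eq => a.
by split=> pa; apply: contrapT; [rewrite -bq -e ap | rewrite -ap e bq].
Qed.

(** The homomorphisms determine the point, since the prime [f x] consists of the elements with
    non-unit image, and then the stalk map, since a germ on the spectrum is a fraction. *)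
Lemma glob_inj (f g : mor T (spec_lrs A)) :
  (forall x a, glob f x a = glob g x a) -> f =m g.
Proof.
move=> e; apply/mor_eqP.
have fg x : f x = g x by apply: (spec_unit_ext (glob_unit f x) (glob_unit g x)).
split=> // x U h h' s.
have [W [a [c [Wx H]]]] := spec_germ_near h s.
have [fc e1] := H _ h Wx.
have Wx' : W (g x) by rewrite -fg.
have [gc e2] := H _ h' Wx'.
have uc : is_unit (glob f x c) by exact/glob_unit.
apply: (is_unit_inj uc); rewrite {1}/glob -[LHS]rmorphM /= e1.
by rewrite e /glob -[RHS]rmorphM /= e2; exact: e.
Qed.

End Adjunction.

Lemma germ_unit_near (X : ringed_space) (x : X) (U : opens X) (Ux : U x) (s : sections U) :
  is_unit (germ Ux s) ->
  exists (W : opens X) (h : W `<=o` U) (t : sections W), W x /\ t * res h s = 1.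
Proof.
case; elim/germ_ind => V Vx t.
have Ix : opensI V U x by split.
rewrite -(germ_res Vx Ix opensIl) -(germ_res Ux Ix opensIr) -rmorphM /=.
rewrite -(germ1 Ix) => /germP [W [W1 [W2 [Wx e]]]].
exists W, (opens_trans W1 opensIr), (res W1 (res opensIl t)); split=> //.
by rewrite -res_trans -rmorphM e rmorph1.
Qed.

Lemma locally_secM (X : ringed_space) (U : opens X) (psi psi' : forall x, U x -> stalk x) :
  locally_sec psi -> locally_sec psi' -> locally_sec (fun x Ux => psi x Ux * psi' x Ux).
Proof.
move=> H H' x Ux; have [W [s [Wx sW]]] := H x Ux; have [V [t [Vx tV]]] := H' x Ux.
exists (opensI W V), (res opensIl s * res opensIr t); split=> // y [Wy Vy] Uy.
by rewrite germM (sW y Wy) (tV y Vy) (germ_res Wy) (germ_res Vy).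
Qed.

Lemma locally_secD (X : ringed_space) (U : opens X) (psi psi' : forall x, U x -> stalk x) :
  locally_sec psi -> locally_sec psi' -> locally_sec (fun x Ux => psi x Ux + psi' x Ux).
Proof.
move=> H H' x Ux; have [W [s [Wx sW]]] := H x Ux; have [V [t [Vx tV]]] := H' x Ux.
exists (opensI W V), (res opensIl s + res opensIr t); split=> // y [Wy Vy] Uy.
by rewrite germD (sW y Wy) (tV y Vy) (germ_res Wy) (germ_res Vy).
Qed.

Section AdjunctionExistence.
Context (T : lrs) (A : comPzRingType) (psi : forall x : T, {rmorphism A -> stalk x}).
Hypothesis psi_sec : forall a, @locally_sec T (opensT T) (fun x _ => psi x a).

Lemma adj_prime x : is_prime [set a | ~ is_unit (psi x a)].
Proof.
have [l0 lD lM] := lrsP x; split=> /=.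
- split=> [|a b|a b] /=; first by rewrite rmorph0.
  + by rewrite rmorphD; exact: lD.
  + by rewrite rmorphM; exact: lM.
- by rewrite rmorph1; apply; exact: is_unit1.
- move=> a b /= h; apply: contrapT => /not_orP [/contrapT ha /contrapT hb].
  by apply: h; rewrite rmorphM; exact: is_unitM.
Qed.

Let pt (x : T) : spec_lrs A := Prime (adj_prime x).

Let psi_unit x a : is_unit (psi x a) <-> ~ pt x a.
Proof. by split=> /=; [move=> ? /(_ _)|exact: contrapT]. Qed.

(** A basic open set pulls back to the set where a germ is a unit, and an inverse of a germ remains
    an inverse on a neighbourhood. *)
Lemma adj_cont : continuous pt.
Proof.
apply/continuousP => _ [E ->].
rewrite openE => x [a Ea /psi_unit xa].
have [W [s [Wx sW]]] := @psi_sec a x I.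
rewrite (sW x Wx I) in xa; have [V [h [t [Vx e]]]] := germ_unit_near xa.
rewrite /interior nbhsE; exists V; first by split=> //; exact: opensP.
move=> y Vy; exists a => //; apply/psi_unit; rewrite (sW y (h _ Vy) I).
by exists (germ Vy t); rewrite -(germ_res _ Vy h) -germM e germ1.
Qed.

Let phi x := projT1 (cid (loc_univ (spec_stalk_loc (pt x)) (fun s => (psi_unit x s).2))).
Let phiE x a : phi x (spec_germ (pt x) a) = psi x a.
Proof. exact: (projT2 (cid (loc_univ (spec_stalk_loc (pt x)) (fun s => (psi_unit x s).2)))). Qed.

Lemma adj_exists : exists f : mor T (spec_lrs A), forall x a, glob f x a = psi x a.
Proof.
have phi_sec (U : opens (spec_lrs A)) (s : sections U) :
    @locally_sec T (opens_preim adj_cont U) (fun x (Ux : U (pt x)) => phi x (germ Ux s)).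
  move=> x Ux; have [W [a [f [Wx sW]]]] := spec_germ_near Ux s.
  have [pf e] := sW _ Ux Wx.
  have [V [t [Vx tV]]] := @psi_sec a x I.
  have [V' [t' [V'x tV']]] := @psi_sec f x I.
  move: (pf) => /psi_unit; rewrite (tV' x V'x I) => /germ_unit_near [V2 [h [t2 [V2x e2]]]].
  exists (opensI (opens_preim adj_cont W) (opensI V V2)), (res (fun y H => opensIl y (opensIr y H)) t * res (fun y H => opensIr y (opensIr y H)) t2).
  split=> // y [Wy [Vy V2y]] Uy; have [qf ey] := sW _ Uy Wy.
  have := congr1 (phi y) ey; rewrite rmorphM !phiE (tV y Vy I) (tV' y (h _ V2y) I) germM.
  rewrite (germ_res Vy) (germ_res V2y) => <-.
  by rewrite mulrC mulrA -(germ_res (h _ V2y) V2y h) -germM e2 germ1 mul1r.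
have phi_local x (t : stalk (pt x)) : is_unit (phi x t) -> is_unit t.
  have [lu ls _] := spec_stalk_loc (pt x); have [a [s [ps e]]] := ls t.
  move=> ut; have : is_unit (phi x (spec_germ (pt x) a)).
    by rewrite -e rmorphM; apply: is_unitM => //; rewrite phiE; exact/psi_unit.
  by rewrite phiE => /psi_unit /lu; rewrite -e => /is_unitMr.
exists (mk_mor phi_sec phi_local) => x a.
by rewrite /glob (stalk_map_mk phi_sec phi_local) phiE.
Qed.

End AdjunctionExistence.

Lemma glob_comp (A : comPzRingType) (T U : lrs) (f : mor U (spec_lrs A)) (g : mor T U) x a :
  glob (f \m g) x a = @stalk_map _ _ g x (glob f (g x) a).
Proof. exact: stalk_map_comp. Qed.

Section Glob.
Context (A B : comPzRingType) (phi : {rmorphism A -> B}) (T : lrs).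

Lemma glob_spec_map (q : spec_lrs B) a : glob (spec_map phi) q a = spec_germ q (phi a).
Proof.
rewrite /glob /spec_germ stalk_mapE /= -[RHS]/(spec_germ q (phi a)).
rewrite -(spec_germE (I : opens_preim (comap_cont (phi:=phi)) (opensT (spec A)) q)).
by congr germ; apply: spec_secP => r Ir /=; rewrite loc_mapE;
  apply/fracP; exists 1; [exact: prime1 | rewrite rmorph1; ring].
Qed.

Lemma glob_spec_comp (f : mor T (spec_lrs B)) x a :
  glob (spec_map phi \m f) x a = glob f x (phi a).
Proof. by rewrite glob_comp glob_spec_map. Qed.

Lemma glob_eq (f g : mor T (spec_lrs A)) : f =m g -> forall x a, glob f x a = glob g x a.
Proof. by move/mor_eqP=> [_ H] x a; exact: H. Qed.

Lemma glob_sec (f : mor T (spec_lrs A)) a :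
  @locally_sec T (opensT T) (fun x _ => glob f x a).
Proof.
move=> x _; exists (opens_preim (mor_cont f) (opensT _)), (mor_sec f _ (sec_cst _ a)).
by split=> // y Wy _; rewrite /glob /spec_germ stalk_mapE; exact: germ_irr.
Qed.

End Glob.

(** * Monomorphisms and lifting *)

Section Lifting.
Context (Y' Y : lrs) (j : mor Y' Y).

Definition stalk_onto := forall y t, exists s, @stalk_map _ _ j y s = t.

Lemma stalk_onto_near : stalk_onto ->
  forall y (U' : opens Y') (h : U' y) (s : sections U'),
  exists (U : opens Y) (t : sections U) (W : opens Y'), [/\ W y, W `<=o` U',
    forall z, W z -> U (j z) & forall z (Uz : U (j z)) (U'z : U' z), W z ->
    @stalk_map _ _ j z (germ Uz t) = germ U'z s].
Proof.
move=> js y U' h s; have [] := js y (germ h s); elim/germ_ind => U Uy t.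
rewrite stalk_mapE => /germ_near [W [Wy WU WU' H]].
exists U, t, W; split=> // z Uz U'z Wz; rewrite stalk_mapE; exact: H.
Qed.

(** Equal composites agree on points, and every germ on [Y'] comes from [Y], where the composites
    can be compared. The hypotheses hold for open subspaces and for fibres alike. *)
Lemma mor_mono (T : lrs) (g h : mor T Y') : injective j -> stalk_onto ->
  j \m g =m j \m h -> g =m h.
Proof.
move=> ji js /mor_eqP [e H]; apply/mor_eqP.
have gh x : g x = h x by apply: ji; exact: e.
split=> // x U' k k' s.
have [U [t [W [Wx WU WUj tW]]]] := stalk_onto_near js k s.
have Wx' : W (h x) by rewrite -gh.
rewrite -(tW _ (WUj _ Wx) k Wx) -(tW _ (WUj _ Wx') k' Wx').
by have := H x U (WUj _ Wx) (WUj _ Wx') t; rewrite !stalk_map_comp.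
Qed.

Context (T : lrs) (f : mor T Y).
Hypothesis j_top : forall U' : opens Y', exists U : opens Y, forall y, U' y <-> U (j y).
Hypothesis j_onto : stalk_onto.
Hypothesis f_range : forall x, exists y, j y = f x.
Hypothesis f_ker : forall x y, j y = f x -> forall (U : opens Y) (h : U (j y)) (h' : U (f x)) s,
  @stalk_map _ _ j y (germ h s) = 0 -> @stalk_map _ _ f x (germ h' s) = 0.

Let g x := projT1 (cid (f_range x)).
Let gE x : j (g x) = f x. Proof. exact: (projT2 (cid (f_range x))). Qed.

Lemma lift_cont : continuous g.
Proof.
apply/continuousP => A oA; have [U UE] := j_top (Opens oA).
have -> : g @^-1` A = f @^-1` U.
  by apply/seteqP; split=> x /=; rewrite -(gE x) => /UE.
by move/continuousP : (mor_cont f); apply; exact: opensP.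
Qed.

(** The graph of the wanted stalk map: [t] and [r] come from one section of [Y] near the point
    [j (g x) = f x]. By [f_ker] the section does not matter. *)
Let rel x (t : stalk (g x)) (r : stalk x) := exists (U : opens Y) (h : U (j (g x))) (h' : U (f x)) s,
  @stalk_map _ _ j (g x) (germ h s) = t /\ @stalk_map _ _ f x (germ h' s) = r.

Let rel_ex x t : exists r, @rel x t r.
Proof.
have [] := j_onto t; elim/germ_ind => U h s e.
have h' : U (f x) by rewrite -gE.
by exists (@stalk_map _ _ f x (germ h' s)), U, h, h', s.
Qed.

Let rel2 (op : forall A : comPzRingType, A -> A -> A) :
  (forall (A B : comPzRingType) (f : {rmorphism A -> B}) a b, f (op A a b) = op B (f a) (f b)) ->
  forall x t t' r r', @rel x t r -> @rel x t' r' -> @rel x (op _ t t') (op _ r r').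
Proof.
move=> opP x t t' r r' [U [h [h' [s [<- <-]]]]] [V [k [k' [u [<- <-]]]]].
have Ix : opensI U V (j (g x)) by split.
have Ix' : opensI U V (f x) by split.
exists (opensI U V), Ix, Ix', (op _ (res opensIl s) (res opensIr u)).
have E : germ Ix (op _ (res opensIl s) (res opensIr u)) = op _ (germ h s) (germ k u).
  by rewrite (opP _ _ (germ Ix)) /= (germ_res h) (germ_res k).
have E' : germ Ix' (op _ (res opensIl s) (res opensIr u)) = op _ (germ h' s) (germ k' u).
  by rewrite (opP _ _ (germ Ix')) /= (germ_res h') (germ_res k').
by rewrite E E' (opP _ _ (@stalk_map _ _ j (g x))) (opP _ _ (@stalk_map _ _ f x)).
Qed.

Let rel_uniq x t r r' : @rel x t r -> @rel x t r' -> r = r'.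
Proof.
move=> H1 H2.
have [U [h [h' [s [e <-]]]]] := H1; have [V [k [k' [u [e' <-]]]]] := H2.
have Ix : opensI U V (j (g x)) by split.
have Ix' : opensI U V (f x) by split.
have := f_ker (gE x) (h := Ix) Ix' (s := res opensIl s - res opensIr u).
rewrite !rmorphB /= !(germ_res h, germ_res k, germ_res h', germ_res k').
by rewrite e e' subrr => /(_ erefl) /eqP; rewrite subr_eq0 => /eqP.
Qed.

Let phi_ex x : exists h : {rmorphism stalk (g x) -> stalk x}, forall t, rel t (h t).
Proof.
apply: rmorphism_of_rel (@rel_ex x) (@rel_uniq x) _ _ _.
- by exists (opensT Y), I, I, 1; rewrite !germ1 !rmorph1.
- by move=> *; apply: (@rel2 (fun A a b => a - b)) => // *; rewrite rmorphB.
- by move=> *; apply: (@rel2 (fun A => @GRing.mul A)) => // *; rewrite rmorphM.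
Qed.

Let phi x := projT1 (cid (phi_ex x)).
Let phiP x t : rel t (phi x t). Proof. exact: (projT2 (cid (phi_ex x))). Qed.

Lemma lift_exists : exists u : mor T Y', j \m u =m f.
Proof.
have phi_sec (U : opens Y') (s : sections U) :
    @locally_sec T (opens_preim lift_cont U) (fun x (Ux : U (g x)) => phi x (germ Ux s)).
  move=> x Ux; have [V [t [W [Wx WU WV tW]]]] := stalk_onto_near j_onto Ux s.
  exists (opensI (opens_preim (mor_cont f) V) (opens_preim lift_cont W)).
  exists (res opensIl (mor_sec f V t)); split.
    by split=> //=; rewrite -gE; exact: WV.
  move=> y [Vy Wy] Uy; have Vy' := WV _ Wy.
  apply: rel_uniq (phiP _) _; exists V, Vy', Vy, t; split; first exact: tW.
  by rewrite stalk_mapE (germ_res (Vy : opens_preim (mor_cont f) V y)).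
have phi_local x (t : stalk (g x)) : is_unit (phi x t) -> is_unit t.
  have [U [h [h' [s [e1 e2]]]]] := phiP t; rewrite -e2 -e1 => /mor_local ut.
  apply/(is_unit_morph (@stalk_map _ _ j (g x))).
  by move: h' ut {e2}; rewrite -gE => h'; rewrite (germ_irr h' h).
exists (mk_mor phi_sec phi_local); apply/mor_eqP; split=> [x|x U h h' s]; first exact: gE.
rewrite stalk_map_comp (stalk_map_mk phi_sec phi_local).
by apply: rel_uniq (phiP _) _; exists U, h, h', s.
Qed.

End Lifting.

(** A stalkwise form of [open_immersion], equivalent to it by [open_immersion_emb] and
    [emb_open_immersion]; it is easier to compose and to cancel. *)
Definition open_emb (X Y : lrs) (j : mor X Y) : Prop :=
  [/\ injective j, forall U : opens X, open (j @` U) &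
     forall x, bijective (@stalk_map _ _ j x)].

Section OpenImmersion.
Context (X Y : lrs).
Implicit Types (j : mor X Y).

Let img j (jo : forall U : opens X, open (j @` U)) (U : opens X) : opens Y := Opens (jo U).

Lemma open_immersion_emb j : open_immersion j -> open_emb j.
Proof.
case=> ji jo jb; split=> // x.
have jr U : img jo U `<=` range j by move=> _ [y _ <-]; exists y.
have imgP U y : img jo U (j y) -> U y by case=> z Uz /ji <-.
have js t : exists s, @stalk_map _ _ j x s = t.
  elim/germ_ind: t => U Ux s.
  have [g gK1 gK2] := jb _ (jr U).
  have h : opens_preim (mor_cont j) (img jo U) `<=o` U by move=> y; exact: imgP.
  have Ux' : img jo U (j x) by exists x.
  exists (germ Ux' (g (res h s))); rewrite stalk_mapE gK2; exact: germ_res.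
have ji' : injective (@stalk_map _ _ j x).
  move=> t u e; apply/eqP; rewrite -subr_eq0; apply/eqP.
  have {e} : @stalk_map _ _ j x (t - u) = 0 by rewrite rmorphB /= e subrr.
  elim/germ_ind: (t - u) => {t u} U Ux s.
  rewrite stalk_mapE -(germ0 (Ux : opens_preim (mor_cont j) U x)).
  move=> /germ_near [W [Wx WU _ H]].
  have WU' : img jo W `<=o` U by move=> _ [y Wy <-]; exact: WU.
  have Wx' : img jo W (j x) by exists x.
  rewrite -(germ_res Ux Wx' WU') -(germ0 Wx'); congr germ.
  apply: (bij_inj (jb _ (jr W))); rewrite rmorph0; apply: germ_sep => y Wy.
  have Uy : U (j y) by exact: WU'.
  rewrite -(stalk_mapE (f := j) (Wy : img jo W (j y))) (germ_res Uy) germ0.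
  by rewrite stalk_mapE (H y Uy Uy (imgP _ _ Wy)) germ0.
pose g y := projT1 (cid (js y)).
have gK : cancel g (@stalk_map _ _ j x) by move=> y; exact: (projT2 (cid (js y))).
by exists g => // t; apply: ji'; rewrite gK.
Qed.

Lemma emb_open_immersion j : open_emb j -> open_immersion j.
Proof.
case=> ji jo jb; split=> // U Ur.
have inj (V : opens Y) : V `<=` range j -> injective (mor_sec j V).
  move=> Vr s t e; apply: germ_sep => y Vy; have [x _ xy] := Vr y Vy.
  move: Vy; rewrite -xy => Vy.
  by apply: (bij_inj (jb x)); rewrite !stalk_mapE e.
have surj t : exists s, mor_sec j U s = t.
  (* [Q] says that [s] has the germs prescribed by [t] at the points of [X] over its domain.
     Injectivity makes such sections unique, so they glue. *)
  pose Q (V : opens Y) (s : sections V) := forall x (h : V (j x)) (h' : U (j x)),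
    @stalk_map _ _ j x (germ h s) = @germ X x (opens_preim (mor_cont j) U) h' t.
  have [V W WV s QV x h h'|V s u VU Qs Qu|y Uy|s sP] := @glue_prop Y U Q.
  - by rewrite (germ_res (WV _ h)).
  - apply: inj; first by move=> y /VU; exact: Ur.
    apply: germ_sep => x Vx; have Ux := VU _ Vx.
    by rewrite -!(stalk_mapE (f := j) (Vx : V (j x))) (Qs x Vx Ux) (Qu x Vx Ux).
  - have [x _ xy] := Ur y Uy; move: Uy; rewrite -xy => Ux.
    have [g _ gK] := jb x.
    have := gK (@germ X x (opens_preim (mor_cont j) U) Ux t).
    elim/germ_ind: (g _) => V Vx s; rewrite stalk_mapE => /germ_near [W [Wx WV WU H]].
    exists (opensI (opensI U V) (img jo W)); split.
    + by split=> //; exists x.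
    + by move=> z [[]].
    exists (res (fun z H => opensIr z (opensIl z H)) s) => z h h'.
    have Vz : V (j z) by case: h => -[].
    have Wz : W z by case: h => _ [z' Wz' /ji <-].
    by rewrite (germ_res Vz) stalk_mapE; exact: H.
  exists s; apply: germ_sep => x Ux; rewrite -(stalk_mapE (f := j) (Ux : U (j x))).
  have [V [h [Vx QV]]] := sP _ (Ux : U (j x)).
  by rewrite -(QV x Vx Ux) (germ_res (Ux : U (j x))).
pose g y := projT1 (cid (surj y)).
have gK : cancel g (mor_sec j U) by move=> y; exact: (projT2 (cid (surj y))).
by exists g => // t; apply: (inj U Ur); rewrite gK.
Qed.

Lemma open_emb_onto j : open_emb j -> stalk_onto j.
Proof. by case=> _ _ jb x t; case: (jb x) => g _ gK; exists (g t); rewrite gK. Qed.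

Lemma open_emb_mono (T : lrs) j (g h : mor T X) : open_emb j -> j \m g =m j \m h -> g =m h.
Proof. by move=> je; apply: mor_mono (open_emb_onto je); case: je. Qed.

Lemma open_emb_lift (T : lrs) j (f : mor T Y) : open_emb j ->
  (forall x, range j (f x)) -> exists u : mor T X, j \m u =m f.
Proof.
move=> je fr; have [ji jo jb] := je.
apply: lift_exists (open_emb_onto je) _ _ => //.
- by move=> U; exists (img jo U) => y; split=> [Uy|[z Uz /ji <-]] //; exists y.
- by move=> x; have [y _ e] := fr x; exists y.
move=> x y e U h h' s; rewrite -[RHS](rmorph0 (@stalk_map _ _ j y)).
move=> /(bij_inj (jb y)) e0.
have -> : germ h' s = 0 by move: h' => {fr}; rewrite -e => h'; rewrite (germ_irr h' h).
exact: rmorph0.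
Qed.

End OpenImmersion.

(** * Subspaces and open immersions *)

Section IdealQuotient.
Context (A : comPzRingType) (I : set A) (Ii : is_ideal I).

Let I0 : I 0. Proof. by case: Ii. Qed.
Let ID x y : I x -> I y -> I (x + y). Proof. by case: Ii => _ h _; exact: h. Qed.
Let IM x y : I y -> I (x * y). Proof. by case: Ii => _ _ h; exact: h. Qed.
Let IN x : I x -> I (- x). Proof. by rewrite -mulN1r; exact: IM. Qed.
Let IE x y : x = y -> I (x - y). Proof. by move=> ->; rewrite subrr. Qed.

Definition ideal_prering : prering.
Proof.
apply: (@PreRing A (fun x y => I (x - y)) 0 1 +%R -%R *%R).
- by move=> x; exact: IE.
- by move=> x y /IN; rewrite opprB.
- by move=> x y z xy yz; have := ID xy yz; rewrite addrA subrK.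
- by move=> x x' y y' h h'; have := ID h h'; rewrite opprD addrACA.
- by move=> x x' /IN; rewrite opprD.
- move=> x x' y y' h h'; have -> : x * y - x' * y' = y * (x - x') + x' * (y - y') by ring.
  by apply: ID; exact: IM.
all: by move=> *; apply: IE; ring.
Defined.

Definition ideal_quot : comPzRingType := quot ideal_prering.
Definition ideal_pi (a : A) : ideal_quot := @qpi ideal_prering a.

Lemma ideal_pi_zmod : zmod_morphism ideal_pi.
Proof. by move=> a b; rewrite /ideal_pi -(@qpiN ideal_prering) -(@qpiD ideal_prering). Qed.
Lemma ideal_pi_monoid : monoid_morphism ideal_pi.
Proof. by split=> // a b; rewrite /ideal_pi -(@qpiM ideal_prering). Qed.

HB.instance Definition _ :=
  GRing.isZmodMorphism.Build A ideal_quot ideal_pi ideal_pi_zmod.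
HB.instance Definition _ :=
  GRing.isMonoidMorphism.Build A ideal_quot ideal_pi ideal_pi_monoid.

Lemma ideal_pi0 a : ideal_pi a = 0 <-> I a.
Proof. by rewrite /ideal_pi -(@qpi0 ideal_prering) qpiP /= subr0. Qed.

Lemma ideal_pi_onto t : exists a, ideal_pi a = t.
Proof. by exists (@qrepr ideal_prering t); exact: qreprK. Qed.

End IdealQuotient.

Section LocalSurjection.
Context (A B : comPzRingType) (h : {rmorphism A -> B}).
Hypotheses (Al : is_local A) (h_onto : forall b, exists a, h a = b).
Hypothesis h_ker : forall a, h a = 0 -> ~ is_unit a.

Lemma local_onto_unit a : is_unit (h a) -> is_unit a.
Proof.
have [l0 lD lM] := Al.
case=> b; have [c <-] := h_onto b; rewrite -rmorphM => e.
apply: contrapT => na; have nca : ~ is_unit (c * a) by move/is_unitMr.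
have n1 : ~ is_unit (1 - c * a) by apply: h_ker; rewrite rmorphB e rmorph1 subrr.
by have := lD _ _ n1 nca; rewrite subrK; apply; exact: is_unit1.
Qed.

Lemma local_onto : is_local B.
Proof.
have [l0 lD lM] := Al; split=> [|x y|x y]; rewrite /max_ideal /=.
- by rewrite -(rmorph0 h) => /local_onto_unit.
- have [a <-] := h_onto x; have [b <-] := h_onto y => na nb.
  rewrite -rmorphD => /local_onto_unit; apply: lD => /(is_unit_morph h) //.
- by move=> ny /is_unitMr.
Qed.

End LocalSurjection.

(** * Subspaces cut out by ideals of germs *)

Section Subspace.
Context (X : lrs) (Y : X -> Prop) (J : forall x : X, set (stalk x)).
Hypothesis Ji : forall x, is_ideal (@J x).
Hypothesis J1 : forall x, Y x -> forall t, @J x t -> ~ is_unit t.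
Hypothesis J_near : forall x (U : opens X) (Ux : U x) s, Y x -> J (germ Ux s) ->
  exists W : opens X, [/\ W x, W `<=o` U &
    forall y (Uy : U y), Y y -> W y -> J (germ Uy s)].

Record subpt := SubPt { spt : X; sptP : Y spt }.

HB.instance Definition _ := gen_eqMixin subpt.
HB.instance Definition _ := gen_choiceMixin subpt.

Definition sub_open (U : set subpt) : Prop :=
  exists V : opens X, U = spt @^-1` V.

Lemma sub_openT : sub_open setT.
Proof. by exists (opensT X); apply/seteqP; split. Qed.

Lemma sub_openI : setI_closed sub_open.
Proof. by move=> _ _ [U ->] [V ->]; exists (opensI U V); apply/seteqP; split. Qed.

Lemma sub_open_bigcup (K : Type) (f : K -> set subpt) :
  (forall i, sub_open (f i)) -> sub_open (\bigcup_i f i).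
Proof.
move=> fo; pose V i := projT1 (cid (fo i)).
have VE i : f i = spt @^-1` V i by exact: (projT2 (cid (fo i))).
have oV : open (\bigcup_i (V i : set X)) by apply: bigcup_open => i _; exact: opensP.
exists (Opens oV); apply/seteqP; split=> y /= [i _].
  by rewrite VE; exists i.
by move=> h; exists i => //; rewrite VE.
Qed.

HB.instance Definition _ := isOpenTopological.Build subpt
  sub_openT sub_openI sub_open_bigcup.

Lemma spt_cont : continuous (spt : subpt -> X).
Proof. by apply/continuousP => A oA; exists (Opens oA). Qed.

Lemma spt_inj : injective spt.
Proof. by case=> x Yx [y Yy] /= e; subst y; congr SubPt; exact: Prop_irrelevance. Qed.

Lemma sub_opens_ex (U : opens subpt) : exists V : opens X, forall y, U y <-> V (spt y).
Proof. by case: (opensP U) => V e; exists V => y; rewrite e. Qed.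

Definition sub_q (x : X) : comPzRingType := ideal_quot (Ji x).

(** The structure sheaf of an arbitrary subset [Y] with the induced topology, with the quotients of
    the stalks of [X] by [J] as stalks. Open subspaces arise for [J = 0], fibres for the ideals
    generated by the maximal ideal of a point of the base. *)
Definition locally_res (U : opens subpt) (s : forall y, U y -> sub_q (spt y)) :=
  forall y, U y -> exists (W : opens X) (a : sections W), W (spt y) /\
    forall z (Uz : U z) (Wz : W (spt z)), s z Uz = ideal_pi (Ji (spt z)) (germ Wz a).

Record sub_sec (U : opens subpt) := SubSec {
  ss_val :> forall y, U y -> sub_q (spt y);
  ss_valP : locally_res ss_val }.

Section Sections.
Context (U : opens subpt).
Implicit Types s t : sub_sec U.

HB.instance Definition _ := gen_eqMixin (sub_sec U).
HB.instance Definition _ := gen_choiceMixin (sub_sec U).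

Lemma sub_secP s t : (forall y (Uy : U y), s y Uy = t y Uy) -> s = t.
Proof.
case: s t => [s sP] [t tP] /= e.
have est : s = t by apply: functional_extensionality_dep => p; apply/funext => Up; exact: e.
by subst t; congr SubSec; exact: Prop_irrelevance.
Qed.

Lemma ss_cst_subproof (W : opens X) (a : sections W) (h : forall y, U y -> W (spt y)) :
  locally_res (fun y (Uy : U y) => ideal_pi (Ji (spt y)) (germ (h y Uy) a)).
Proof. by move=> y Uy; exists W, a; split=> [|z Uz Wz]; [exact: h | congr ideal_pi; exact: germ_irr]. Qed.

Definition ss_cst W a h : sub_sec U := SubSec (@ss_cst_subproof W a h).

Lemma ss_op_subproof (op : forall A : comPzRingType, A -> A -> A) :
  (forall (A B : comPzRingType) (f : {rmorphism A -> B}) a b, f (op A a b) = op B (f a) (f b)) ->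
  forall s t, locally_res (fun y Uy => op _ (s y Uy) (t y Uy)).
Proof.
move=> opP s t y Uy; have [W [a [Wy sW]]] := ss_valP s Uy.
have [V [b [Vy tV]]] := ss_valP t Uy.
exists (opensI W V), (op _ (res opensIl a) (res opensIr b)); split=> // z Uz Iz.
have [Wz Vz] := Iz.
rewrite (sW z Uz Wz) (tV z Uz Vz) (opP _ _ (germ Iz)) /= (germ_res Wz) (germ_res Vz).
by rewrite (opP _ _ (ideal_pi _)).
Qed.

Definition ss_add s t := SubSec (ss_op_subproof (fun A B f => @rmorphD A B f) s t).
Definition ss_mul s t := SubSec (ss_op_subproof (fun A B f => @rmorphM A B f) s t).
Definition ss_opp s := SubSec (@ss_op_subproof (fun A a b => - a) (fun A B f a b => @rmorphN A B f a) s s).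
Definition ss_zero := @ss_cst (opensT X) 0 (fun _ _ => I).
Definition ss_one := @ss_cst (opensT X) 1 (fun _ _ => I).

Lemma ss_addA : associative ss_add.
Proof. by move=> s t u; apply: sub_secP => p Up /=; rewrite addrA. Qed.
Lemma ss_addC : commutative ss_add.
Proof. by move=> s t; apply: sub_secP => p Up /=; rewrite addrC. Qed.
Lemma ss_add0 : left_id ss_zero ss_add.
Proof. by move=> s; apply: sub_secP => p Up /=; rewrite germ0 rmorph0 add0r. Qed.
Lemma ss_addN : left_inverse ss_zero ss_opp ss_add.
Proof. by move=> s; apply: sub_secP => p Up /=; rewrite germ0 rmorph0 addNr. Qed.

HB.instance Definition _ :=
  GRing.isZmodule.Build (sub_sec U) ss_addA ss_addC ss_add0 ss_addN.

Lemma ss_mulA : associative ss_mul.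
Proof. by move=> s t u; apply: sub_secP => p Up /=; rewrite mulrA. Qed.
Lemma ss_mulC : commutative ss_mul.
Proof. by move=> s t; apply: sub_secP => p Up /=; rewrite mulrC. Qed.
Lemma ss_mul1 : left_id ss_one ss_mul.
Proof. by move=> s; apply: sub_secP => p Up /=; rewrite germ1 rmorph1 mul1r. Qed.
Lemma ss_mulD : left_distributive ss_mul ss_add.
Proof. by move=> s t u; apply: sub_secP => p Up /=; rewrite mulrDl. Qed.

HB.instance Definition _ :=
  GRing.Zmodule_isComPzRing.Build (sub_sec U) ss_mulA ss_mulC ss_mul1 ss_mulD.

End Sections.

Section Restriction.
Context (U V : opens subpt) (VU : opens_sub V U).

Lemma ss_res_subproof (s : sub_sec U) : locally_res (fun p (Vp : V p) => s p (VU Vp)).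
Proof.
move=> p Vp; have [W [a [Wp sW]]] := ss_valP s (VU Vp).
by exists W, a; split=> // q Vq; exact: sW.
Qed.

Definition ss_res (s : sub_sec U) : sub_sec V := SubSec (ss_res_subproof s).

Lemma ss_res_zmod : zmod_morphism ss_res.
Proof. by move=> s t; exact: sub_secP. Qed.
Lemma ss_res_monoid : monoid_morphism ss_res.
Proof. by split=> [|s t]; exact: sub_secP. Qed.

HB.instance Definition _ :=
  GRing.isZmodMorphism.Build (sub_sec U) (sub_sec V) ss_res ss_res_zmod.
HB.instance Definition _ :=
  GRing.isMonoidMorphism.Build (sub_sec U) (sub_sec V) ss_res ss_res_monoid.

End Restriction.

Definition sub_rs : ringed_space.
Proof.
apply: (@RingedSpace subpt (fun U => sub_sec U)
  (fun U V VU => [the {rmorphism sub_sec U -> sub_sec V} of ss_res VU])).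
- by move=> U h s; apply: sub_secP => p Up /=; rewrite (Prop_irrelevance (h p Up) Up).
- move=> U V W VU WV WU s; apply: sub_secP => p Wp /=.
  by rewrite (Prop_irrelevance (VU p (WV p Wp)) (WU p Wp)).
- move=> U C CU s t cov e; apply: sub_secP => p Up.
  have [V CV Vp] := cov p Up.
  have /(congr1 (fun u : sub_sec V => u p Vp)) /= := e V CV.
  by rewrite (Prop_irrelevance (CU V CV p Vp) Up).
- move=> U C CU s cov e.
  have key V W p (CV : C V) (CW : C W) (Vp : V p) (Wp : W p) : s V p Vp = s W p Wp.
    have Ip : opensI V W p by split.
    have /(congr1 (fun u : sub_sec (opensI V W) => u p Ip)) /= := e V W CV CW.
    by rewrite (Prop_irrelevance (opensIl p Ip) Vp) (Prop_irrelevance (opensIr p Ip) Wp).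
  pose c p (Up : U p) := cid2 (cov p Up).
  pose t p (Up : U p) := s (s2val (c p Up)) p (s2valP' (c p Up)).
  have tP V p (CV : C V) (Vp : V p) (Up : U p) : t p Up = s V p Vp.
    by apply: key => //; exact: (s2valP (c p Up)).
  have tF : locally_res t.
    move=> p Up; have [V CV Vp] := cov p Up.
    have [W [a [Wp sW]]] := ss_valP (s V) Vp.
    have [V' V'E] := sub_opens_ex V.
    exists (opensI V' W), (res opensIr a); split; first by split=> //; exact/V'E.
    move=> q Uq Iq; have [V'q Wq] := Iq; have Vq : V q by exact/V'E.
    by rewrite (tP V _ CV Vq) (sW q Vq Wq) (germ_res Wq).
  by exists (SubSec tF) => V CV; apply: sub_secP => p Vp /=; exact: tP.
Defined.

Definition sub_incl_sec (U : opens X) (a : sections U) : sub_sec (opens_preim spt_cont U) :=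
  ss_cst a (fun y (Uy : opens_preim spt_cont U y) => Uy).

Lemma sub_incl_sec_zmod U : zmod_morphism (@sub_incl_sec U).
Proof. by move=> a b; apply: sub_secP => y Uy /=; rewrite !rmorphB. Qed.
Lemma sub_incl_sec_monoid U : monoid_morphism (@sub_incl_sec U).
Proof. by split=> [|a b]; apply: sub_secP => y Uy /=; rewrite ?germ1 ?rmorph1 ?germM ?rmorphM. Qed.

HB.instance Definition _ U := GRing.isZmodMorphism.Build
  (sections U) (sub_sec (opens_preim spt_cont U)) (@sub_incl_sec U) (@sub_incl_sec_zmod U).
HB.instance Definition _ U := GRing.isMonoidMorphism.Build
  (sections U) (sub_sec (opens_preim spt_cont U)) (@sub_incl_sec U) (@sub_incl_sec_monoid U).

Definition sub_incl_rs : rs_mor sub_rs X.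
Proof.
apply: (@RSMor sub_rs X spt spt_cont (fun U => [the {rmorphism _ -> _} of @sub_incl_sec U])).
by move=> U V VU fVU s; apply: sub_secP => y Vy /=; rewrite (germ_res (fVU y Vy : U (spt y))).
Defined.

Lemma sub_incl_onto (y : sub_rs) t : exists s, @stalk_map _ _ sub_incl_rs y s = t.
Proof.
elim/germ_ind: t => U Uy s; have [W [a [Wy sW]]] := ss_valP s Uy.
exists (germ Wy a); rewrite stalk_mapE; apply/germP.
exists (opensI U (opens_preim spt_cont W)), opensIr, opensIl; split=> //.
by apply: sub_secP => z [Uz Wz] /=; rewrite (sW z _ Wz); congr ideal_pi; exact: germ_irr.
Qed.

(** The germ of a family vanishes when the family vanishes nearby; [J_near] spreads membership in
    [J] from one point to its neighbours. *)
Lemma sub_incl_ker (y : sub_rs) (U : opens X) (Uy : U (spt y)) s :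
  @stalk_map _ _ sub_incl_rs y (germ Uy s) = 0 <-> J (germ Uy s).
Proof.
rewrite stalk_mapE -(@germ0 sub_rs y (opens_preim spt_cont U) Uy); split.
  move=> /germP [W [h [h' [Wy]]]] /(congr1 (fun u : sub_sec W => u y Wy)) /=.
  by rewrite germ0 rmorph0 => /ideal_pi0; rewrite (germ_irr _ Uy).
case/J_near; first exact: sptP.
move=> W [Wy WU H]; apply/germP.
have h : opens_sub (opens_preim spt_cont W) (opens_preim spt_cont U) by move=> z; exact: WU.
exists (opens_preim spt_cont W), h, h; split=> //.
apply: sub_secP => z Wz /=; rewrite germ0 rmorph0; apply/ideal_pi0; apply: H => //.
exact: sptP.
Qed.

Lemma sub_incl_kerE (y : sub_rs) (t : stalk (spt y)) :
  @stalk_map _ _ sub_incl_rs y t = 0 <-> J t.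
Proof. by elim/germ_ind: t => U Uy s; exact: sub_incl_ker. Qed.

Lemma sub_incl_unit (y : sub_rs) (t : stalk (spt y)) :
  @stalk_map _ _ sub_incl_rs y t = 0 -> ~ is_unit t.
Proof. by elim/germ_ind: t => U Uy s /sub_incl_ker; apply: J1; exact: sptP. Qed.

Lemma sub_rs_local (y : sub_rs) : is_local (stalk y).
Proof.
exact: (local_onto (h := @stalk_map _ _ sub_incl_rs y) (lrsP _) (@sub_incl_onto y) (@sub_incl_unit y)).
Qed.

Definition sub_lrs : lrs := LRS sub_rs_local.

Lemma sub_incl_local (y : sub_lrs) (t : stalk (sub_incl_rs y)) :
  is_unit (@stalk_map _ _ sub_incl_rs y t) -> is_unit t.
Proof.
exact: (local_onto_unit (h := @stalk_map _ _ sub_incl_rs y) (lrsP _) (@sub_incl_onto y) (@sub_incl_unit y)).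
Qed.

Definition sub_incl : mor sub_lrs X := @Mor sub_lrs X sub_incl_rs sub_incl_local.

Lemma sub_incl_mono (T : lrs) (g h : mor T sub_lrs) : sub_incl \m g =m sub_incl \m h -> g =m h.
Proof. exact: (@mor_mono sub_lrs X sub_incl T g h spt_inj sub_incl_onto). Qed.

Lemma sub_incl_lift (T : lrs) (f : mor T X) : (forall x, Y (f x)) ->
  (forall x t, @J (f x) t -> @stalk_map _ _ f x t = 0) -> exists u : mor T sub_lrs, sub_incl \m u =m f.
Proof.
move=> fY fJ; apply: (@lift_exists sub_lrs X sub_incl T f _ sub_incl_onto) => [U'|x|x y e U h h' s].
- exact: sub_opens_ex.
- by exists (SubPt (fY x)).
- move=> /sub_incl_ker; move: h h' => /= h h'; move: h; rewrite [spt y]e => h.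
  by rewrite (germ_irr h h'); exact: fJ.
Qed.

End Subspace.

Section OpenSubspace.
Context (X : lrs) (U : opens X).

Let J (x : X) : set (stalk x) := [set 0].

Let Ji x : is_ideal (@J x).
Proof. by split=> [|t u -> ->|t u ->] //=; rewrite ?addr0 ?mulr0. Qed.

Let J1 x : U x -> forall t, @J x t -> ~ is_unit t.
Proof. by move=> _ t ->; have [] := lrsP x. Qed.

Let J_near x (V : opens X) (Vx : V x) s : U x -> J (germ Vx s) ->
  exists W : opens X, [/\ W x, opens_sub W V & forall y (Vy : V y), U y -> W y -> J (germ Vy s)].
Proof.
move=> _; rewrite /J /= -(germ0 Vx) => /germ_near [W [Wx WV _ H]].
by exists W; split=> // y Vy _ Wy; rewrite (H y Vy Vy Wy) germ0.
Qed.

Definition open_sub : lrs := sub_lrs Ji J1 J_near.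
Definition open_incl : mor open_sub X := sub_incl Ji J1 J_near.

Lemma open_incl_range : range open_incl = U.
Proof.
apply/seteqP; split=> [_ [y _ <-]|x Ux]; first exact: sptP y.
by exists (SubPt Ux).
Qed.

Lemma open_incl_emb : open_emb open_incl.
Proof.
split=> [|V|y]; first exact: spt_inj.
- have [W WE] := sub_opens_ex V.
  have -> : open_incl @` V = opensI U W.
    apply/seteqP; split=> [_ [y Vy <-]|x [Ux Wx]]; first by split; [exact: sptP y|exact/WE].
    by exists (SubPt Ux) => //; exact/WE.
  exact: opensP.
have ji : injective (@stalk_map _ _ open_incl y).
  move=> t u e; apply/eqP; rewrite -subr_eq0; apply/eqP.
  have {e} : @stalk_map _ _ open_incl y (t - u) = 0 by rewrite rmorphB /= e subrr.
  by elim/germ_ind: (t - u) => V Vy s /sub_incl_ker; apply.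
have js (t : stalk y) : {s | @stalk_map _ _ open_incl y s = t} by apply: cid; exact: sub_incl_onto.
exists (fun t => sval (js t)) => t; last exact: (svalP (js t)).
by apply: ji; exact: (svalP (js _)).
Qed.

End OpenSubspace.

Section InvertElement.
Context (A : comPzRingType) (f : A).

Let frn := (A * nat)%type.
Let eqf (u v : frn) := exists k, f ^+ k * (u.1 * f ^+ v.2) = f ^+ k * (v.1 * f ^+ u.2).
Let zerof : frn := (0, 0%N).
Let onef : frn := (1, 0%N).
Let addf (u v : frn) : frn := (u.1 * f ^+ v.2 + v.1 * f ^+ u.2, (u.2 + v.2)%N).
Let oppf (u : frn) : frn := (- u.1, u.2).
Let mulf (u v : frn) : frn := (u.1 * v.1, (u.2 + v.2)%N).

Let eqfW u v : u.1 * f ^+ v.2 = v.1 * f ^+ u.2 -> eqf u v.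
Proof. by move=> e; exists 0%N; rewrite e. Qed.

(** The ring $A_f$: a pair [(a, n)] stands for $a/f^n$, and [eqf] has an extra power of [f] because
    [f] may be a zero divisor. *)
Definition invert_prering : prering.
Proof.
apply: (@PreRing frn eqf zerof onef addf oppf mulf).
- by move=> u; apply: eqfW.
- by move=> u v [k e]; exists k.
- move=> [a m] [b n] [c r] [k /= e] [l /= e']; exists (k + l + n)%N => /=.
  rewrite !exprD; transitivity (f ^+ l * f ^+ r * (f ^+ k * (a * f ^+ n))); first by ring.
  rewrite e; transitivity (f ^+ k * f ^+ m * (f ^+ l * (b * f ^+ r))); first by ring.
  by rewrite e'; ring.
- move=> [a m] [a' m'] [b n] [b' n'] [k /= e] [l /= e']; exists (k + l)%N => /=.
  rewrite !exprD.
  transitivity (f ^+ l * f ^+ n * f ^+ n' * (f ^+ k * (a * f ^+ m')) +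
                f ^+ k * f ^+ m * f ^+ m' * (f ^+ l * (b * f ^+ n'))); first by ring.
  by rewrite e e'; ring.
- by move=> [a m] [a' m'] [k /= e]; exists k; rewrite /= !mulNr !mulrN e.
- move=> [a m] [a' m'] [b n] [b' n'] [k /= e] [l /= e']; exists (k + l)%N => /=.
  rewrite !exprD.
  transitivity ((f ^+ k * (a * f ^+ m')) * (f ^+ l * (b * f ^+ n'))); first by ring.
  by rewrite e e'; ring.
all: by move=> *; apply: eqfW => /=; rewrite ?exprD; ring.
Defined.

Lemma invert_exists : exists (B : comPzRingType) (h : {rmorphism A -> B}),
  [/\ is_unit (h f), forall x, exists a n, h f ^+ n * x = h a &
     forall a, h a = 0 -> exists n, f ^+ n * a = 0].
Proof.
pose B : comPzRingType := quot invert_prering; pose P := invert_prering.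
have [a b||h hE] := @rmorphism_of A B (fun a => @qpi P (a, 0%N)).
- rewrite -(@qpiN P) -(@qpiD P); apply/qpiP/eqfW => /=; ring.
- by split=> [|a b] //; rewrite -(@qpiM P); apply/qpiP/eqfW => /=; ring.
have hX n : h f ^+ n * @qpi P (1, n) = 1.
  rewrite -rmorphXn hE -(@qpiM P) -(@qpi1 P); apply/qpiP/eqfW => /=.
  by rewrite ?expr0 ?add0n; ring.
exists B, h; split.
- by exists (@qpi P (1, 1%N)); rewrite mulrC -[h f]expr1 hX.
- move=> x; rewrite -(qreprK x); case: (qrepr x) => a n; exists a, n.
  rewrite -rmorphXn !hE -(@qpiM P); apply/qpiP/eqfW => /=.
  by rewrite ?expr0 ?add0n; ring.
- move=> a; rewrite hE -(@qpi0 P) => /qpiP [k /= e]; exists k.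
  by move: e; rewrite expr0 mulr1 mul0r mulr0.
Qed.

End InvertElement.

Section BasicOpen.
Context (A B : comPzRingType) (f : A) (h : {rmorphism A -> B}).
Hypotheses (hu : is_unit (h f)) (hs : forall x, exists a n, h f ^+ n * x = h a).
Hypothesis hk : forall a, h a = 0 -> exists n, f ^+ n * a = 0.

Let huX n : is_unit (h f ^+ n).
Proof. by elim: n => [|n IH]; [exact: is_unit1 | rewrite exprS; exact: is_unitM]. Qed.

Let primeX (p : spec A) n : ~ p f -> ~ p (f ^+ n).
Proof. by move=> pf; elim: n => [|n IH]; [exact: prime1 | rewrite exprS; exact: primeNM]. Qed.

Let prime_unit (q : spec B) u x : is_unit u -> q (u * x) <-> q x.
Proof.
move=> uu; split; last exact: primeMl.
case: (uu) => v vu; case: (Defs.primeP q) => _ _ qP /qP [] // qu.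
by case: (@prime1 _ q); rewrite -vu; exact: primeMl.
Qed.

Lemma comap_invert_basic (q : spec B) : ~ comap h q f.
Proof. by move=> /= qf; case: hu => v vu; apply: (@prime1 _ q); rewrite -vu; exact: primeMl. Qed.

Lemma comap_invert_surj (p : spec A) : ~ p f -> exists q : spec B, comap h q = p.
Proof.
move=> pf.
(* The fractions with a numerator in [p]. By [pE] the choice of the numerator does not matter,
   because no power of [f] lies in [p]. *)
pose Q : set B := [set x | exists a n, h f ^+ n * x = h a /\ p a].
have pE a n b m x : h f ^+ n * x = h a -> h f ^+ m * x = h b -> p a -> p b.
  move=> e1 e2 pa; have : h (f ^+ n * b - f ^+ m * a) = 0.
    by rewrite rmorphB !rmorphM !rmorphXn /= -e1 -e2; ring.
  move=> /hk [k e]; have : p (f ^+ (k + n) * b).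
    have -> : f ^+ (k + n) * b = f ^+ (k + m) * a + f ^+ k * (f ^+ n * b - f ^+ m * a).
      by rewrite !exprD; ring.
    by rewrite e addr0; exact: primeMl.
  by case: (Defs.primeP p) => _ _ pP /pP [/(primeX pf)|].
have Qp : is_prime Q.
  split.
  - split=> [|x y [a [n [e pa]]] [b [m [e' pb]]]|x y [b [m [e' pb]]]].
    + by exists 0, 0%N; rewrite mulr0 rmorph0; split=> //; exact: prime0.
    + exists (f ^+ m * a + f ^+ n * b), (n + m)%N; split.
        by rewrite rmorphD !rmorphM !rmorphXn /= -e -e' exprD; ring.
      by case: (Defs.primeP p) => -[_ pD _] _ _; apply: pD; exact: primeMl.
    + have [a [n e]] := hs x; exists (a * b), (n + m)%N; split; last exact: primeMl.
      by rewrite rmorphM -e -e' exprD; ring.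
  - move=> [a [n [e pa]]]; apply: (@prime1 _ p); apply: (pE _ _ _ 0%N _ e _ pa).
    by rewrite rmorph1 mulr1.
  - move=> x y [c [k [e pc]]]; have [a [n ea]] := hs x; have [b [m eb]] := hs y.
    have : p (a * b).
      by apply: (pE _ _ _ (n + m)%N _ e _ pc); rewrite rmorphM -ea -eb exprD; ring.
    by case: (Defs.primeP p) => _ _ pP /pP [pa|pb]; [left; exists a, n | right; exists b, m].
exists (Prime Qp); apply: spec_eq => a; split=> /= [[b [n [e pb]]]|pa].
  by apply: (pE _ _ _ 0%N _ e _ pb); rewrite mul1r.
by exists a, 0%N; rewrite mul1r.
Qed.

Lemma basic_open_emb : open_emb (Spec_map h).
Proof.
split=> [q q' e|U|q].
- apply: spec_eq => x; have [a [n xa]] := hs x.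
  have eqa : q (h a) <-> q' (h a).
    by rewrite -[q (h a)]/(comap h q a) -[q' (h a)]/(comap h q' a) [comap h q]e.
  by rewrite -(prime_unit q x (huX n)) -(prime_unit q' x (huX n)) xa.
- have [E UE] := opensP U.
  (* Where [f] is invertible, an element [b] of [E] may be replaced by a numerator [c]; the factor
     [f] confines the open set to that locus. *)
  exists [set a | exists b n, E b /\ exists c, h f ^+ n * b = h c /\ a = f * c].
  apply/seteqP; split=> [_ [q Uq <-]|p [_ [b [n [Eb [c [e ->]]]]] pfc]].
    move: Uq; rewrite UE => -[b Eb qb]; have [c [n e]] := hs b.
    exists (f * c); first by exists b, n; split=> //; exists c.
    apply: primeNM; first exact: comap_invert_basic.
    by rewrite /= -e => /(prime_unit q b (huX n)).
  have pf : ~ p f by move=> ?; apply: pfc; exact: primeMr.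
  have [q qp] := comap_invert_surj pf; exists q => //; rewrite UE; exists b => //.
  move=> qb; apply: pfc; rewrite -qp; apply: primeMl => /=; rewrite -e; exact: primeMl.
have [lu ls lk] := spec_stalk_loc q.
(* Both stalks are localizations of [A] at the same prime, so the map between them is bijective. *)
have al_loc : is_loc (comap h q) (spec_germ q \o h).
  split=> [s qs|x|a].
  - exact: lu.
  - have [b [s [qsn e]]] := ls x.
    have [c [n ec]] := hs b; have [d [m ed]] := hs s.
    exists (f ^+ m * c), (f ^+ n * d); split=> /=.
      rewrite rmorphM rmorphXn /= -ed.
      by move=> /(prime_unit q _ (huX n)) /(prime_unit q _ (huX m)).
    rewrite !rmorphM !rmorphXn /= -ec -ed !rmorphM !rmorphXn /= -e.
    by move: (spec_germ q (h f)) (spec_germ q s) => F S; ring.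
  - move=> /= /lk [w qw wa]; have [b [n e]] := hs w.
    have : h (b * a) = 0 by rewrite rmorphM -e -mulrA wa mulr0.
    move=> /hk [k ek]; exists (f ^+ k * b); last by rewrite -mulrA.
    rewrite /= rmorphM rmorphXn /= -e.
    by move=> /(prime_unit q _ (huX k)) /(prime_unit q _ (huX n)).
pose sm : {rmorphism stalk (spec_map_rs h q) -> stalk (q : spec_lrs B)} :=
  @stalk_map _ _ (spec_map_rs h) q.
apply: (loc_bij (spec_stalk_loc (spec_map_rs h q)) (h := sm) al_loc) => a.
exact: (glob_spec_map h q a).
Qed.

Lemma basic_open_range : range (Spec_map h) = [set p : spec A | ~ p f].
Proof.
apply/seteqP; split=> [_ [q _ <-]|p /comap_invert_surj [q <-]].
  exact: comap_invert_basic.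
by exists q.
Qed.

End BasicOpen.

Section Schemes.

Lemma open_emb_comp (X Y Z : lrs) (g : mor Y Z) (f : mor X Y) :
  open_emb g -> open_emb f -> open_emb (g \m f).
Proof.
move=> [gi go gb] [fi fo fb]; split=> [x y /gi /fi //|U|x].
  have -> : (g \m f) @` U = g @` (Opens (fo U)).
    apply/seteqP; split=> [_ [x Ux <-]|_ [_ [x Ux <-] <-]]; last by exists x.
    by exists (f x) => //; exists x.
  exact: go.
have [k kK Kk] := bij_comp (fb x) (gb (f x)).
by exists k => t; rewrite ?stalk_map_comp; [exact: kK|exact: Kk].
Qed.

Lemma range_comp (X Y Z : lrs) (g : mor Y Z) (f : mor X Y) z :
  range (g \m f) z <-> exists2 y, range f y & g y = z.
Proof.
by split=> [[x _ <-]|[_ [x _ <-] <-]]; [exists (f x) => //; exists x | exists x].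
Qed.

Lemma scheme_affine_near (X : lrs) : is_scheme X -> forall (U : opens X) x, U x ->
  exists (A : comPzRingType) (j : mor (spec_lrs A) X),
    [/\ open_emb j, range j x & range j `<=` U].
Proof.
move=> Xs U x Ux; have [A [j [/open_immersion_emb je [p _ px]]]] := Xs x.
have [E UE] := opensP (opens_preim (mor_cont j) U).
have : opens_preim (mor_cont j) U p by rewrite /= px.
rewrite UE => -[f Ef pf].
have [B [h [hu hs hk]]] := invert_exists f.
have he := basic_open_emb hu hs hk; have hr := basic_open_range hu hs hk.
have [q _ qp] : range (Spec_map h) p by rewrite hr.
exists B, (j \m Spec_map h); split; first exact: open_emb_comp.
  by apply/range_comp; exists p => //; exists q.
move=> y /range_comp [r]; rewrite hr => rf <-.
suff : opens_preim (mor_cont j) U r by [].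
by rewrite UE; exists f.
Qed.

Lemma germ0_eq (X : ringed_space) (x y : X) (U : opens X) (h : U x) (h' : U y) s :
  x = y -> germ h s = 0 -> germ h' s = 0.
Proof. by move=> e; move: h'; rewrite -e => h'; rewrite (germ_irr h h'). Qed.

Lemma open_emb_factor (X Y Z : lrs) (i : mor Y Z) (u : mor X Y) (j : mor X Z) :
  open_emb i -> open_emb j -> i \m u =m j -> open_emb u.
Proof.
move=> [ii io ib] [ji jo jb] /mor_eqP [iup iug]; split=> [p q e|W|p].
- by apply: ji; rewrite -!iup /= e.
- have -> : u @` W = i @^-1` (j @` W).
    apply/seteqP; split=> [_ [p Wp <-]|y [p Wp]]; first by exists p => //; rewrite -iup.
    by rewrite -iup => /ii <-; exists p.
  by move/continuousP : (mor_cont i); apply; exact: jo.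
have us t : exists r, @stalk_map _ _ u p r = t.
  have [g _ gK] := jb p; rewrite -(gK t); elim/germ_ind: (g t) => V h s.
  have h' : V (i (u p)) by move: h; rewrite -iup.
  by exists (@stalk_map _ _ i (u p) (germ h' s)); rewrite -stalk_map_comp; exact: iug.
have ui : injective (@stalk_map _ _ u p).
  move=> t r e; apply/eqP; rewrite -subr_eq0; apply/eqP.
  have {e} : @stalk_map _ _ u p (t - r) = 0 by rewrite rmorphB /= e subrr.
  have [g _ gK] := ib (u p); rewrite -(gK (t - r)); elim/germ_ind: (g _) => V h s.
  rewrite -stalk_map_comp.
  have h' : V (j p) by move: h; rewrite [i (u p)]iup.
  rewrite (iug p V h h') -[X in _ = X -> _](rmorph0 (@stalk_map _ _ j p)) => /(bij_inj (jb p)).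
  by move=> /(germ0_eq h (esym (iup p))) ->; rewrite rmorph0.
pose g t := projT1 (cid (us t)).
have gK : cancel g (@stalk_map _ _ u p) by move=> t; exact: (projT2 (cid (us t))).
by exists g => // t; apply: ui; rewrite gK.
Qed.

(** Pullbacks are tested against schemes; this makes the open subspaces of [X] admissible test
    objects. *)
Lemma open_sub_scheme (X : lrs) (U : opens X) : is_scheme X -> is_scheme (open_sub U).
Proof.
move=> Xs x; have Ux : U (open_incl U x) by rewrite -open_incl_range; exists x.
have [A [j [je jx jU]]] := scheme_affine_near Xs Ux.
have ie := open_incl_emb U.
have [p|u iu] := open_emb_lift (f := j) ie.
  by rewrite open_incl_range; apply: jU; exists p.
exists A, u; split; first exact/emb_open_immersion/(open_emb_factor ie je iu).
have [p _ px] := jx; exists p => //; case: ie => ii _ _; apply: ii.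
by rewrite -px; case/mor_eqP: iu => <-.
Qed.

Lemma iso_open_emb (X Y : lrs) (f : mor X Y) (g : mor Y X) :
  g \m f =m mor_id X -> f \m g =m mor_id Y -> open_emb f.
Proof.
move=> /mor_eqP [gf gfg] /mor_eqP [fg fgg]; split=> [x y e|U|x].
- by rewrite -[x]gf -[y]gf /= e.
- have -> : f @` U = g @^-1` U.
    apply/seteqP; split=> [_ [x Ux <-]|y Uy /=]; first by rewrite /= [g (f x)]gf.
    by exists (g y) => //; rewrite [f (g y)]fg.
  by move/continuousP : (mor_cont g); apply; exact: opensP.
have fs t : exists r, @stalk_map _ _ f x r = t.
  elim/germ_ind: t => U h s; have h' : U (g (f x)) by rewrite [g (f x)]gf.
  exists (@stalk_map _ _ g (f x) (germ h' s)); rewrite -stalk_map_comp.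
  by rewrite (gfg x U h' h) stalk_mapE /= (germ_res h).
have fi : injective (@stalk_map _ _ f x).
  move=> t r e; apply/eqP; rewrite -subr_eq0; apply/eqP.
  have {e} : @stalk_map _ _ f x (t - r) = 0 by rewrite rmorphB /= e subrr.
  elim/germ_ind: (t - r) => U h s e.
  have h' : U (f (g (f x))) by rewrite [g (f x)]gf.
  have := fgg (f x) U h' h s; rewrite stalk_map_comp (stalk_mapE (f := f) h') (stalk_mapE (f := mor_id Y) h) /= (germ_res h) => <-.
  have : germ (h : opens_preim (mor_cont f) U x) (mor_sec f U s) = 0 by rewrite -stalk_mapE.
  move/(germ0_eq (h' : opens_preim (mor_cont f) U (g (f x))) (esym (gf x))) => ->.
  exact: rmorph0.
pose k t := projT1 (cid (fs t)).
have kK : cancel k (@stalk_map _ _ f x) by move=> t; exact: (projT2 (cid (fs t))).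
by exists k => // t; apply: fi; rewrite kK.
Qed.

End Schemes.

(** * Monoid algebras and charts of pullbacks *)

Section MonoidAlgebraLift.
Context (k : comNzRingType) (G : nmodType).

Definition ma_cst (c : k) : monoid_algebra k G := << c *g (0 : G)%R >>.
Definition ma_chi (g : G) : monoid_algebra k G := << 1 *g g >>.

Lemma ma_cst_zmod : zmod_morphism ma_cst.
Proof. by move=> c d; rewrite /ma_cst monalgUB. Qed.
Lemma ma_cst_monoid : monoid_morphism ma_cst.
Proof. by split=> // c d; rewrite [RHS]ma_mulUU addr0. Qed.

HB.instance Definition _ :=
  GRing.isZmodMorphism.Build k (monoid_algebra k G) ma_cst ma_cst_zmod.
HB.instance Definition _ :=
  GRing.isMonoidMorphism.Build k (monoid_algebra k G) ma_cst ma_cst_monoid.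

Lemma ma_chi0 : ma_chi 0 = 1.
Proof. by []. Qed.

Lemma ma_chiD g h : ma_chi (g + h) = ma_chi g * ma_chi h.
Proof. by rewrite [RHS]ma_mulUU mulr1. Qed.

Lemma ma_monoE c g : << c *g g >> = ma_cst c * ma_chi g :> monoid_algebra k G.
Proof. by rewrite [RHS]ma_mulUU mulr1 add0r. Qed.

Context (D : comPzRingType) (f : {rmorphism k -> D}) (m : G -> D).
Hypotheses (m0 : m 0 = 1) (mD : forall g h, m (g + h) = m g * m h).

(** Additive for any function [m], multiplicative for a monoid morphism [m]. The additive version is
    used again for derivations. *)
Definition ma_eval (x : monoid_algebra k G) : D := \sum_(g <- msupp x) f x@_g * m g.

Lemma ma_evalw (d : {fset G}) (x : monoid_algebra k G) : (msupp x `<=` d)%fset ->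
  ma_eval x = \sum_(g <- d) f x@_g * m g.
Proof.
move=> le_d; apply: big_fset_incl => // a _ /mcoeff_outdom ->.
by rewrite rmorph0 mul0r.
Qed.

Lemma ma_evalU c g : ma_eval << c *g g >> = f c * m g.
Proof. by rewrite (ma_evalw msuppU_le) big_seq_fset1 mcoeffUU. Qed.

Lemma ma_eval_zmod : zmod_morphism ma_eval.
Proof.
move=> x y; rewrite (@ma_evalw (msupp x `|` msupp y)%fset _ (msuppB_le _ _)).
rewrite (@ma_evalw (msupp x `|` msupp y)%fset x) ?fsubsetUl //.
rewrite (@ma_evalw (msupp x `|` msupp y)%fset y) ?fsubsetUr //.
by rewrite -sumrB; apply/eq_bigr=> a _; rewrite mcoeffB rmorphB mulrBl.
Qed.

HB.instance Definition _ := GRing.isZmodMorphism.Build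
  (monoid_algebra k G) D ma_eval ma_eval_zmod.

Lemma ma_eval_monoid : monoid_morphism ma_eval.
Proof.
split=> [|x y]; first by rewrite [LHS]ma_evalU rmorph1 m0 mulr1.
elim/ma_ind: x => [|x x' Hx Hx'|c a]; first by rewrite !(mul0r, raddf0).
  by rewrite mulrDl !raddfD /= mulrDl Hx Hx'.
elim/ma_ind: y => [|y y' Hy Hy'|d b]; first by rewrite !(mulr0, raddf0).
  by rewrite mulrDr !raddfD /= mulrDr Hy Hy'.
by rewrite [_ * _]ma_mulUU !ma_evalU rmorphM mD; ring.
Qed.

Lemma ma_lift : exists h : {rmorphism monoid_algebra k G -> D},
  (forall c, h (ma_cst c) = f c) /\ forall g, h (ma_chi g) = m g.
Proof.
have [h hE] := rmorphism_of ma_eval_zmod ma_eval_monoid.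
exists h; split=> [c|g]; rewrite hE ma_evalU; first by rewrite m0 mulr1.
by rewrite rmorph1 mul1r.
Qed.

Lemma ma_ext (h h' : {rmorphism monoid_algebra k G -> D}) :
  (forall c, h (ma_cst c) = h' (ma_cst c)) -> (forall g, h (ma_chi g) = h' (ma_chi g)) ->
  forall x, h x = h' x.
Proof.
move=> ec eg; elim/ma_ind => [|x y e e'|c g]; first by rewrite !rmorph0.
  by rewrite !rmorphD e e'.
by rewrite ma_monoE !rmorphM ec eg.
Qed.

End MonoidAlgebraLift.

Lemma int_rmorphism (D : comPzRingType) (f g : {rmorphism int -> D}) z : f z = g z.
Proof. by rewrite -[z]intz !rmorph_int. Qed.

Lemma ma_base_exists (C : comNzRingType) (G : nmodType) :
  exists h : {rmorphism monoid_algebra int G -> monoid_algebra C G},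
    forall g, h (ma_chi int g) = ma_chi C g.
Proof.
have [h [_ hE]] := @ma_lift int G (monoid_algebra C G)
  [the {rmorphism int -> monoid_algebra C G} of (@ma_cst C G \o intr)]
  (@ma_chi C G) (@ma_chi0 C G) (@ma_chiD C G).
by exists h.
Qed.

Definition ma_base (C : comNzRingType) (G : nmodType) := projT1 (cid (ma_base_exists C G)).

Lemma ma_base_chi (C : comNzRingType) (G : nmodType) g : ma_base C G (ma_chi int g) = ma_chi C g.
Proof. exact: (projT2 (cid (ma_base_exists C G))). Qed.

Lemma ma_base_ext (C : comNzRingType) (G : nmodType) (D : comPzRingType)
    (h : {rmorphism monoid_algebra C G -> D}) (h' : {rmorphism monoid_algebra int G -> D}) :
  (forall g, h (ma_chi C g) = h' (ma_chi int g)) -> forall x, h (ma_base C G x) = h' x.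
Proof.
move=> e x; apply: (ma_ext (h := [the {rmorphism _ -> _} of (h \o ma_base C G)])) => [z|g] /=.
  exact: (int_rmorphism [the {rmorphism int -> D} of (h \o ma_base C G \o @ma_cst int G)]
    [the {rmorphism int -> D} of (h' \o @ma_cst int G)]).
by rewrite ma_base_chi e.
Qed.

Lemma spec_int_eq (T : lrs) (f g : mor T (spec_lrs int)) : f =m g.
Proof. by apply: glob_inj => x a; exact: int_rmorphism. Qed.

Section SpecMonoidAlgebra.
Context (C : comNzRingType) (G : nmodType) (T : lrs).

(** The spectrum of [C[G]] is the product of those of [C] and [Z[G]] even among locally ringed
    spaces: at each point, the two homomorphisms to the stalk combine to one on the monoid
    algebra. *)
Lemma spec_ma_exists (t : mor T (spec_lrs C)) (p : mor T (spec_lrs (monoid_algebra int G))) :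
  exists v : mor T (spec_lrs (monoid_algebra C G)),
    spec_map (@ma_cst C G) \m v =m t /\ spec_map (ma_base C G) \m v =m p.
Proof.
pose m x g := glob p x (ma_chi int g).
have m0 x : m x 0 = 1 by rewrite /m ma_chi0; exact: (rmorph1 (glob p x)).
have mD x g h : m x (g + h) = m x g * m x h by rewrite /m ma_chiD; exact: (rmorphM (glob p x)).
pose psi x := projT1 (cid (@ma_lift C G (stalk x) (glob t x) (m x) (m0 x) (mD x))).
have psi_cst x c : psi x (ma_cst G c) = glob t x c.
  exact: (projT2 (cid (@ma_lift C G (stalk x) (glob t x) (m x) (m0 x) (mD x)))).1.
have psi_chi x g : psi x (ma_chi C g) = glob p x (ma_chi int g).
  exact: (projT2 (cid (@ma_lift C G (stalk x) (glob t x) (m x) (m0 x) (mD x)))).2.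
have psi_sec a : @locally_sec T (opensT T) (fun x _ => psi x a).
  elim/ma_ind: a => [|a b Ha Hb|c g].
  - move=> x _; exists (opensT T), 0; split=> // y Ty _; by rewrite rmorph0 germ0.
  - by move=> x Tx; have [W [s [Wx sW]]] := locally_secD Ha Hb Tx;
      exists W, s; split=> // y Wy Ty; rewrite rmorphD (sW y Wy Ty).
  move=> x Tx; have [W [s [Wx sW]]] := locally_secM (glob_sec t c) (glob_sec p (ma_chi int g)) Tx.
  by exists W, s; split=> // y Wy Ty; rewrite -(sW y Wy Ty) ma_monoE rmorphM psi_cst psi_chi.
have [v vE] := adj_exists psi_sec.
exists v; split; apply: glob_inj => x a; rewrite glob_spec_comp vE; first exact: psi_cst.
exact: (ma_base_ext (psi_chi x)).
Qed.

Lemma spec_ma_uniq (v w : mor T (spec_lrs (monoid_algebra C G))) :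
  spec_map (@ma_cst C G) \m v =m spec_map (@ma_cst C G) \m w ->
  spec_map (ma_base C G) \m v =m spec_map (ma_base C G) \m w -> v =m w.
Proof.
move=> e1 e2; apply: glob_inj => x; apply: (ma_ext (h := glob v x) (h' := glob w x)) => [c|g].
  by have := glob_eq e1 x c; rewrite !glob_spec_comp.
by have := glob_eq e2 x (ma_chi int g); rewrite !glob_spec_comp ma_base_chi.
Qed.

End SpecMonoidAlgebra.

Section ToricChart.
Context (X XZ S : lrs) (p : mor X XZ) (t : mor X S) (G : nmodType) (C : comNzRingType).
Context (j : mor (spec_lrs (monoid_algebra int G)) XZ) (i : mor (spec_lrs C) S).
Context (u : mor (spec_lrs (monoid_algebra C G)) X).
Hypotheses (je : open_emb j) (ie : open_emb i).
Hypotheses (pu : p \m u =m j \m spec_map (ma_base C G)) (tu : t \m u =m i \m spec_map (@ma_cst C G)).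
Hypothesis Xuniq : forall (U : opens X) (g h : mor (open_sub U) X),
  p \m g =m p \m h -> t \m g =m t \m h -> g =m h.

(** Let [V] be the part of [X] over both charts. Its two projections give a morphism [v] to the
    spectrum of [C[G]], inverse to [u] by uniqueness on either side. For [X], uniqueness enters on
    open subspaces, which is what [Xuniq] records. *)
Lemma toric_chart : open_emb u /\ forall x, range j (p x) -> range i (t x) -> range u x.
Proof.
have [ji jo jb] := je; have [ii io ib] := ie.
pose V := opensI (opens_preim (mor_cont p) (Opens (jo (opensT _))))
                 (opens_preim (mor_cont t) (Opens (io (opensT _)))).
pose c := open_incl V; have ce := open_incl_emb V.
have cV x : V (c x) by rewrite -open_incl_range; exists x.
have [x|p1 p1E] := open_emb_lift (f := p \m c) je.
  by have [[q _ e] _] := cV x; exists q.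
have [x|t1 t1E] := open_emb_lift (f := t \m c) ie.
  by have [_ [q _ e]] := cV x; exists q.
have [v [v1 v2]] := spec_ma_exists t1 p1.
have uv : u \m v =m c.
  apply: Xuniq; apply: (mor_eq_trans (mor_comp_assoc _ _ _)).
    apply: (mor_eq_trans (mor_eq_comp pu (mor_eq_refl v))).
    apply: (mor_eq_trans (mor_eq_sym (mor_comp_assoc _ _ _))).
    exact: (mor_eq_trans (mor_eq_comp (mor_eq_refl j) v2) p1E).
  apply: (mor_eq_trans (mor_eq_comp tu (mor_eq_refl v))).
  apply: (mor_eq_trans (mor_eq_sym (mor_comp_assoc _ _ _))).
  exact: (mor_eq_trans (mor_eq_comp (mor_eq_refl i) v1) t1E).
have uV y : V (u y).
  have [e1 _] := (mor_eqP _ _).1 pu; have [e2 _] := (mor_eqP _ _).1 tu.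
  split; [exists (spec_map (ma_base C G) y) | exists (spec_map (@ma_cst C G) y)] => //.
    exact/esym/e1.
  exact/esym/e2.
have [x|u' u'E] := open_emb_lift (f := u) ce.
  by rewrite open_incl_range; exact: uV.
have u'v : u' \m v =m mor_id _.
  apply: (open_emb_mono ce); apply: (mor_eq_trans (mor_comp_assoc _ _ _)).
  apply: (mor_eq_trans (mor_eq_comp u'E (mor_eq_refl v))).
  exact: (mor_eq_trans uv (mor_eq_sym (mor_id_comp _))).
have vu' : v \m u' =m mor_id _.
  apply: spec_ma_uniq; apply: (mor_eq_trans (mor_comp_assoc _ _ _)).
    apply: (mor_eq_trans _ (mor_eq_sym (mor_id_comp _))).
    apply: (mor_eq_trans (mor_eq_comp v1 (mor_eq_refl u'))).
    apply: (open_emb_mono ie); apply: (mor_eq_trans (mor_comp_assoc _ _ _)).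
    apply: (mor_eq_trans (mor_eq_comp t1E (mor_eq_refl u'))).
    apply: (mor_eq_trans (mor_eq_sym (mor_comp_assoc _ _ _))).
    exact: (mor_eq_trans (mor_eq_comp (mor_eq_refl t) u'E) tu).
  apply: (mor_eq_trans _ (mor_eq_sym (mor_id_comp _))).
  apply: (mor_eq_trans (mor_eq_comp v2 (mor_eq_refl u'))).
  apply: (open_emb_mono je); apply: (mor_eq_trans (mor_comp_assoc _ _ _)).
  apply: (mor_eq_trans (mor_eq_comp p1E (mor_eq_refl u'))).
  apply: (mor_eq_trans (mor_eq_sym (mor_comp_assoc _ _ _))).
  exact: (mor_eq_trans (mor_eq_comp (mor_eq_refl p) u'E) pu).
split.
  have h1 := open_emb_comp ce (iso_open_emb vu' u'v).
  have id_emb := open_immersion_emb (open_immersion_id X).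
  exact: (open_emb_factor id_emb h1 (mor_eq_trans (mor_comp_id u) (mor_eq_sym u'E))).
move=> x jx ix; have : V x by [].
rewrite -(open_incl_range V) => -[y _ <-]; exists (v y) => //.
by case/mor_eqP: uv => e _; exact: e.
Qed.

End ToricChart.

(** * Residue fields *)

Section ResidueField.
Context (A : comPzRingType) (Al : is_local A).

Definition residue : Type := ideal_quot Al.
HB.instance Definition _ := GRing.ComPzRing.on residue.

Definition residue_pi : {rmorphism A -> residue} := ideal_pi Al.

Lemma residue_pi0 a : residue_pi a = 0 <-> ~ is_unit a.
Proof. exact: ideal_pi0. Qed.

Lemma residue_neq0 : 1 != 0 :> residue.
Proof.
apply/eqP; rewrite -(rmorph1 residue_pi) => /residue_pi0; apply; exact: is_unit1.
Qed.

HB.instance Definition _ := GRing.PzSemiRing_isNonZero.Build residue residue_neq0.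

Lemma residue_inv_ex (x : residue) : exists y : residue, if x == 0 then y = 0 else y * x = 1.
Proof.
case: eqP => [_|x0]; first by exists 0.
have [a ax] := ideal_pi_onto x.
have [b ba] : is_unit a.
  by apply: contrapT => /residue_pi0 e; apply: x0; rewrite -ax.
by exists (residue_pi b); rewrite -ax -[ideal_pi _ a]/(residue_pi a) -rmorphM ba rmorph1.
Qed.

Definition residue_inv (x : residue) : residue := projT1 (cid (residue_inv_ex x)).

Lemma residue_mulVf (x : residue) : x != 0 -> residue_inv x * x = 1.
Proof. by rewrite /residue_inv; case: cid => y /=; case: eqP. Qed.

Lemma residue_inv0 : residue_inv 0 = 0.
Proof. by rewrite /residue_inv; case: cid => y /=; rewrite eqxx. Qed.

HB.instance Definition _ := GRing.ComNzRing_isField.Build residue residue_mulVf residue_inv0.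

End ResidueField.

Lemma residue_field_exists (Y : lrs) (z : Y) : exists k : residue_field z, True.
Proof.
have onto (c : residue (lrsP z)) : exists t, residue_pi (lrsP z) t = c by exact: ideal_pi_onto.
by exists (@ResidueField Y z (residue (lrsP z)) (residue_pi (lrsP z)) onto).
Qed.

(** Monoid algebras are formed over nonzero rings, while charts have rings that may be zero. The
    equality is one of structures, so that the ring of a chart can be replaced by [C']
    throughout. *)
Lemma comNzRing_of (C : comPzRingType) : 1 != 0 :> C ->
  exists C' : comNzRingType, (C' : comPzRingType) = C.
Proof.
move=> C1; pose D : comNzRingType := HB.pack C (GRing.PzSemiRing_isNonZero.Build C C1).
by case: C C1 @D => T [? ? ? ? ? ? ? ? ? ? ?] C1 D; exists D.
Qed.

Lemma mor_eq_local (T X : lrs) (g h : mor T X) :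
  (forall y, exists V : opens T, V y /\ g \m open_incl V =m h \m open_incl V) -> g =m h.
Proof.
move=> H; apply/mor_eqP.
have key y : g y = h y /\ germ_eq g h y.
  have [V [Vy /mor_eqP [e gh]]] := H y.
  have [y0 _ y0E] : range (open_incl V) y by rewrite open_incl_range.
  rewrite -y0E; split=> [|U k k' s]; first exact: e.
  have [_ _ cb] := open_incl_emb V; apply: (bij_inj (cb y0)).
  by have := gh y0 U k k' s; rewrite !stalk_map_comp.
by split=> y; case: (key y).
Qed.

Definition ma_cover (XZ : lrs) : Prop := forall x : XZ, exists (G : nmodType)
  (j : mor (spec_lrs (monoid_algebra int G)) XZ), open_emb j /\ range j x.

Section Pullback.
Context (X XZ S : scheme) (a : mor XZ (Spec int)) (b : mor S (Spec int)).
Context (p : mor X XZ) (t : mor X S).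
Hypothesis pb : is_pullback a b p t.

Lemma pullback_chart (G : nmodType) (C : comNzRingType)
    (j : mor (spec_lrs (monoid_algebra int G)) XZ) (i : mor (spec_lrs C) S) :
  open_emb j -> open_emb i ->
  exists u : mor (spec_lrs (monoid_algebra C G)) X,
    [/\ open_emb u, p \m u =m j \m spec_map (ma_base C G),
       t \m u =m i \m spec_map (@ma_cst C G) &
       forall x, range j (p x) -> range i (t x) -> range u x].
Proof.
move=> je ie; have [_ pbU] := pb.
have [u [pu tu _]] := pbU (Spec (monoid_algebra C G)) (j \m spec_map (ma_base C G))
  (i \m spec_map (@ma_cst C G)) (spec_int_eq _ _).
have Xuniq (U : opens X) (g h : mor (open_sub U) X) :
    p \m g =m p \m h -> t \m g =m t \m h -> g =m h.
  move=> e1 e2.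
  have [v [_ _ vU]] := pbU (Scheme (open_sub_scheme (U := U) (@schemeP X))) (p \m h) (t \m h) (spec_int_eq _ _).
  apply: (mor_eq_trans (vU g e1 e2)); apply: mor_eq_sym; apply: vU; exact: mor_eq_refl.
have [ue ur] := toric_chart je ie pu tu Xuniq.
by exists u.
Qed.

Hypothesis XZc : ma_cover XZ.

(** This extends uniqueness to test spaces that are not known to be schemes, as is the case for the
    fibre before its charts are found. Locally on [T] both morphisms go through one chart, and
    [spec_ma_uniq] holds for all locally ringed spaces. *)
Lemma pullback_mono (T : lrs) (g h : mor T X) :
  p \m g =m p \m h -> t \m g =m t \m h -> g =m h.
Proof.
move=> e1 e2; apply: mor_eq_local => y.
have [G [j [je jy]]] := XZc (p (g y)).
have [C0 [i0 [/open_immersion_emb ie0 iy0]]] := schemeP (t (g y)).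
have [C CE] : exists C : comNzRingType, (C : comPzRingType) = C0.
  apply: comNzRing_of; case: iy0 => q _ _; apply/eqP => e; apply: (@prime1 _ q).
  by rewrite e; exact: prime0.
subst C0.
have [u [ue pu tu ur]] := pullback_chart je ie0.
have [ui uo _] := ue.
pose V := opens_preim (mor_cont g) (Opens (uo (opensT _))).
exists V; split.
  by have [q _ qE] := ur _ jy iy0; exists q.
have c_pts (y0 : open_sub V) : V (open_incl V y0) by rewrite -open_incl_range; exists y0.
have [e1p _] := (mor_eqP _ _).1 e1; have [e2p _] := (mor_eqP _ _).1 e2.
have [pup _] := (mor_eqP _ _).1 pu; have [tup _] := (mor_eqP _ _).1 tu.
have [y0|g' g'E] := open_emb_lift (f := g \m open_incl V) ue.
  by have [q _ qE] := c_pts y0; exists q.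
have [y0|h' h'E] := open_emb_lift (f := h \m open_incl V) ue.
  have [q _ qE] := c_pts y0; apply: ur.
    rewrite /= -[p (h _)]e1p /= -qE [p (u q)]pup.
    by exists (spec_map (ma_base C G) q).
  rewrite /= -[t (h _)]e2p /= -qE [t (u q)]tup.
  by exists (spec_map (@ma_cst C G) q).
have step (Z : lrs) (D : comPzRingType) (k : mor (spec_lrs D) Z) (f : mor X Z)
    (w : mor (spec_lrs (monoid_algebra C G)) (spec_lrs D)) :
    open_emb k -> f \m u =m k \m w -> f \m g =m f \m h -> w \m g' =m w \m h'.
  move=> ke fu fgh; apply: (open_emb_mono ke).
  have aux (l : mor T X) (l' : mor (open_sub V) (spec_lrs (monoid_algebra C G))) :
      u \m l' =m l \m open_incl V -> k \m (w \m l') =m (f \m l) \m open_incl V.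
    move=> lE; apply: (mor_eq_trans (mor_comp_assoc _ _ _)).
    apply: (mor_eq_trans (mor_eq_comp (mor_eq_sym fu) (mor_eq_refl l'))).
    apply: (mor_eq_trans (mor_eq_sym (mor_comp_assoc _ _ _))).
    exact: (mor_eq_trans (mor_eq_comp (mor_eq_refl f) lE) (mor_comp_assoc _ _ _)).
  apply: (mor_eq_trans (aux g g' g'E)); apply: mor_eq_sym.
  exact: (mor_eq_trans (aux h h' h'E) (mor_eq_comp (mor_eq_sym fgh) (mor_eq_refl _))).
apply: (mor_eq_trans (mor_eq_sym g'E)); apply: (mor_eq_trans _ h'E).
apply: mor_eq_comp; first exact: mor_eq_refl.
by apply: spec_ma_uniq; [exact: (step _ _ _ _ _ ie0 tu e2) | exact: (step _ _ _ _ _ je pu e1)].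
Qed.

End Pullback.

(** * Fibres *)

Lemma kappa_proj_nonunit (Y : lrs) (z : Y) (k : residue_field z) (t : stalk z) :
  kappa_proj k t = 0 -> ~ is_unit t.
Proof.
move=> e [u ut]; have := rmorph1 (kappa_proj k).
by rewrite -ut rmorphM /= e mulr0 => /eqP; rewrite eq_sym oner_eq0.
Qed.

Lemma stalk_map_point (Y : lrs) (z : Y) (k : residue_field z) (x : spec_lrs k)
    (U : opens Y) (h : U z) s :
  @stalk_map _ _ (point_mor k) x (@germ Y (point_mor k x) U h s) =
    spec_germ x (kappa_proj k (germ h s)).
Proof.
rewrite (stalk_mapE (f := point_mor k) (h : U (point_mor k x))) /=.
rewrite -(spec_germE (h : opens_preim (@pt_cont Y z k) U x)).
congr germ; apply: spec_secP => r Ur /=.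
by rewrite (germ_irr (Ur : U z) h).
Qed.

Section Fibre.
Context (X S : lrs) (t : mor X S) (z : S) (k : residue_field z).

Let Y (x : X) : Prop := t x = z.

(** The extension to the stalk at [x] of the maximal ideal at [t x], as an intersection of ideals.
    It refers to [t x] and not to [z], so that no germ has to be transported along [t x = z]. *)
Let J (x : X) : set (stalk x) := [set r | forall K : set (stalk x), is_ideal K ->
  (forall m, ~ is_unit m -> K (@stalk_map _ _ t x m)) -> K r].

Let Ji x : is_ideal (@J x).
Proof.
split=> [K [] //|r s Jr Js K Ki HK|r s Js K Ki HK].
  by case: (Ki) => _ KD _; apply: KD; [exact: Jr | exact: Js].
by case: (Ki) => _ _ KM; apply: KM; exact: Js.
Qed.

Let J1 x : Y x -> forall r, @J x r -> ~ is_unit r.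
Proof. by move=> _ r Jr; apply: (Jr _ (lrsP x)) => m nm /mor_local. Qed.

Lemma germ_unit_eq (x y : S) (U : opens S) (h : U x) (h' : U y) s :
  x = y -> is_unit (germ h s) -> is_unit (germ h' s).
Proof. by move=> e; move: h'; rewrite -e => h'; rewrite (germ_irr h h'). Qed.

Let J_near x (U : opens X) (Ux : U x) s : Y x -> J (germ Ux s) ->
  exists W : opens X, [/\ W x, opens_sub W U &
    forall y (Uy : U y), Y y -> W y -> J (germ Uy s)].
Proof.
move=> Yx Js.
(* The germs that lie in [J] along the fibre near [x] form an ideal containing the image of the
   maximal ideal, hence containing [J]. *)
pose K : set (stalk x) := [set r | exists (W : opens X) (Wx : W x) (u : sections W),
  germ Wx u = r /\ forall y (Wy : W y), Y y -> J (germ Wy u)].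
have [||W [Wx [u [e H]]]] := Js K.
- split=> [|r r' [W [Wx [u [<- H]]]] [V [Vx [v [<- H']]]]|].
  + by exists (opensT X), I, 0; split=> [|y Ty _]; rewrite germ0 //; case: (Ji y).
  + have Ix : opensI W V x by split.
    exists (opensI W V), Ix, (res opensIl u + res opensIr v).
    split=> [|y Iy Yy]; rewrite rmorphD /=.
      by rewrite (germ_res Wx) (germ_res Vx).
    have [Wy Vy] := Iy; rewrite (germ_res Wy) (germ_res Vy); case: (Ji y) => _ JD _.
    by apply: JD; [exact: H | exact: H'].
  + move=> r r'; elim/germ_ind: r => V Vx v [W [Wx [u [<- H]]]].
    have Ix : opensI V W x by split.
    exists (opensI V W), Ix, (res opensIl v * res opensIr u).
    split=> [|y Iy Yy]; rewrite rmorphM /=.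
      by rewrite (germ_res Wx) (germ_res Vx).
    have [Vy Wy] := Iy; rewrite (germ_res Wy) (germ_res Vy); case: (Ji y) => _ _ JM.
    by apply: JM; exact: H.
- elim/germ_ind => V Vx v nu.
  exists (opens_preim (mor_cont t) V), Vx, (mor_sec t V v).
  split=> [|y Vy Yy]; first by rewrite stalk_mapE.
  rewrite -(stalk_mapE (f := t) (Vy : V (t y))) => K' _; apply.
  by move=> uu; exact/nu/(germ_unit_eq Vx (etrans Yy (esym Yx)) uu).
move: e => /germ_near [W' [W'x W'W W'U e]].
exists W'; split=> // y Uy Yy W'y; rewrite -(e y (W'W _ W'y) Uy W'y); exact: H.
Qed.

Definition fibre : lrs := sub_lrs Ji J1 J_near.
Definition fibre_incl : mor fibre X := sub_incl Ji J1 J_near.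

Lemma fibre_pt y : t (fibre_incl y) = z.
Proof. exact: sptP y. Qed.

(** The graph of the homomorphism from the residue field to the stalk: lift [c] to a germ at [z] and
    pull it back. By [rel0] the lift does not matter. *)
Let rel y (c : k) (r : stalk y) := exists (U : opens S) (h : U z) (h' : U (t (fibre_incl y))) s,
  kappa_proj k (germ h s) = c /\ @stalk_map _ _ (t \m fibre_incl) y (germ h' s) = r.

Let rel_ex y c : exists r, @rel y c r.
Proof.
have [] := kappa_surj (r := k) c; elim/germ_ind => U h s e.
have h' : U (t (fibre_incl y)) by rewrite fibre_pt.
by exists (@stalk_map _ _ (t \m fibre_incl) y (germ h' s)), U, h, h', s.
Qed.

Let rel2 (op : forall A : comPzRingType, A -> A -> A) :
  (forall (A B : comPzRingType) (f : {rmorphism A -> B}) a b, f (op A a b) = op B (f a) (f b)) ->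
  forall y c c' r r', @rel y c r -> @rel y c' r' -> @rel y (op _ c c') (op _ r r').
Proof.
move=> opP y c c' r r' [U [h [h' [s [<- <-]]]]] [V [l [l' [u [<- <-]]]]].
have Ix : opensI U V z by split.
have Ix' : opensI U V (t (fibre_incl y)) by split.
exists (opensI U V), Ix, Ix', (op _ (res opensIl s) (res opensIr u)).
have E : germ Ix (op _ (res opensIl s) (res opensIr u)) = op _ (germ h s) (germ l u).
  by rewrite (opP _ _ (germ Ix)) /= (germ_res h) (germ_res l).
have E' : germ Ix' (op _ (res opensIl s) (res opensIr u)) = op _ (germ h' s) (germ l' u).
  by rewrite (opP _ _ (germ Ix')) /= (germ_res h') (germ_res l').
by rewrite E E' (opP _ _ (kappa_proj k)) (opP _ _ (@stalk_map _ _ (t \m fibre_incl) y)).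
Qed.

Let rel0 y (U : opens S) (h : U z) (h' : U (t (fibre_incl y))) s :
  kappa_proj k (germ h s) = 0 -> @stalk_map _ _ (t \m fibre_incl) y (germ h' s) = 0.
Proof.
move=> /kappa_proj_nonunit nu; rewrite stalk_map_comp.
apply: (@sub_incl_kerE X Y J Ji J_near y (@stalk_map _ _ t (fibre_incl y) (germ h' s))).2 => K _.
by apply => uu; exact/nu/(germ_unit_eq h (fibre_pt y) uu).
Qed.

Let rel_uniq y c r r' : @rel y c r -> @rel y c r' -> r = r'.
Proof.
move=> H1 H2; apply/eqP; rewrite -subr_eq0; apply/eqP.
have := @rel2 (fun A a b => a - b) (fun A B f a b => rmorphB f a b) _ _ _ _ _ H1 H2.
by rewrite subrr => -[U [h [h' [s [/(rel0 h') + <-]]]]].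
Qed.

Let psi_ex y : exists h : {rmorphism k -> stalk y}, forall c, rel c (h c).
Proof.
apply: rmorphism_of_rel (@rel_ex y) (@rel_uniq y) _ _ _.
- by exists (opensT S), I, I, 1; rewrite !germ1 !rmorph1.
- by move=> *; apply: (@rel2 (fun A a b => a - b)) => // *; rewrite rmorphB.
- by move=> *; apply: (@rel2 (fun A => @GRing.mul A)) => // *; rewrite rmorphM.
Qed.

Let psi y := projT1 (cid (psi_ex y)).
Let psiP y c : rel c (psi y c). Proof. exact: (projT2 (cid (psi_ex y))). Qed.

Let psi_sec c : @locally_sec fibre (opensT fibre) (fun y _ => psi y c).
Proof.
move=> y _; have [U [h [h' [s [e _]]]]] := psiP y c.
exists (opens_preim (mor_cont (t \m fibre_incl)) U), (mor_sec (t \m fibre_incl) U s).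
split=> // x Ux _; apply: rel_uniq (psiP x c) _.
by exists U, h, Ux, s; split=> //; exact: stalk_mapE.
Qed.

(** Lifts exist because [a] kills the extended maximal ideal: a non-unit at [z] vanishes in [k],
    through which [t \m a] factors. *)
Lemma fibre_univ : exists q : mor fibre (spec_lrs k),
  t \m fibre_incl =m point_mor k \m q /\
  forall (T : lrs) (a : mor T X) (b : mor T (spec_lrs k)), t \m a =m point_mor k \m b ->
    exists u : mor T fibre, fibre_incl \m u =m a /\ q \m u =m b.
Proof.
have [q qE] := adj_exists psi_sec.
have qP y (U : opens S) (h : U z) (h' : U (t (fibre_incl y))) s :
    @stalk_map _ _ (t \m fibre_incl) y (germ h' s) = glob q y (kappa_proj k (germ h s)).
  by rewrite qE; apply: rel_uniq (psiP y _); exists U, h, h', s.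
exists q; split.
  apply/mor_eqP; split=> [y|y U h h' s]; first exact: fibre_pt.
  by rewrite (qP y U (h' : U z)) stalk_map_comp (stalk_map_point (q y) (h' : U z)).
move=> T a b tab; have [tabp tabg] := (mor_eqP _ _).1 tab.
have key x (U : opens S) (h : U z) (h' : U (t (a x))) s :
    @stalk_map _ _ (t \m a) x (germ h' s) = glob b x (kappa_proj k (germ h s)).
  by rewrite (tabg x U h' (h : U ((point_mor k \m b) x))) stalk_map_comp (stalk_map_point (b x) h).
have [x|x r Jr|u uE] := @sub_incl_lift X Y J Ji J1 J_near T a.
- exact: tabp.
- apply: (Jr [set r | @stalk_map _ _ a x r = 0]).
    split=> /= [|c d ec ed|c d ed]; first by rewrite rmorph0.
      by rewrite rmorphD /= ec ed addr0.
    by rewrite rmorphM /= ed mulr0.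
  elim/germ_ind => U h' s nu; rewrite /= -stalk_map_comp.
  have h : U z by move: (h'); rewrite [t (a x)]tabp.
  rewrite (key x U h); have -> : kappa_proj k (germ h s) = 0.
    apply: contrapT => /eqP /kappa_proj_unit uu; apply: nu.
    exact: (@germ_unit_eq z (t (a x)) U h h' s (esym (tabp x)) uu).
  exact: (rmorph0 (glob b x)).
exists u; split=> //; apply: glob_inj => x c.
have [U [h [_ [s [<- _]]]]] := psiP (u x) c.
have h1 : U (t (fibre_incl (u x))) by rewrite fibre_pt.
have h2 : U (t (a x)) by rewrite [t (a x)]tabp.
rewrite -(key x U h h2) glob_comp -(qP (u x) U h h1) -stalk_map_comp.
have e2 := mor_eq_trans (mor_eq_sym (mor_comp_assoc t fibre_incl u)) (mor_eq_comp (mor_eq_refl t) uE).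
by have [_ e3] := (mor_eqP _ _).1 e2; exact: e3.
Qed.

Lemma fibre_incl_mono (T : lrs) (g h : mor T fibre) :
  fibre_incl \m g =m fibre_incl \m h -> g =m h.
Proof. exact: sub_incl_mono. Qed.

End Fibre.

Lemma mor_comp_id_open (X : lrs) : open_emb (mor_id X).
Proof. exact: open_immersion_emb (open_immersion_id X). Qed.

Lemma mor_eq_compl (X Y Z : lrs) (g : mor Y Z) (f f' : mor X Y) : f =m f' -> g \m f =m g \m f'.
Proof. by move=> e; apply: mor_eq_comp => //; exact: mor_eq_refl. Qed.

Lemma mor_eq_compr (X Y Z : lrs) (g g' : mor Y Z) (f : mor X Y) : g =m g' -> g \m f =m g' \m f.
Proof. by move=> e; apply: mor_eq_comp => //; exact: mor_eq_refl. Qed.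

Lemma mor_comp_eqA (X Y Z T : lrs) (h : mor Z T) (g : mor Y Z) (f : mor X Y) (k : mor X Z) :
  g \m f =m k -> (h \m g) \m f =m h \m k.
Proof.
by move=> e; apply: mor_eq_trans (mor_eq_sym (mor_comp_assoc _ _ _)) (mor_eq_compl _ e).
Qed.

Lemma glob_id (A : comPzRingType) (x : spec_lrs A) a : glob (mor_id _) x a = spec_germ x a.
Proof. rewrite /glob /spec_germ (stalk_mapE (f := mor_id _)) /=; exact: germ_res. Qed.

Section FibreScheme.
Context (X XZ S : scheme) (a : mor XZ (Spec int)) (b : mor S (Spec int)).
Context (p : mor X XZ) (t : mor X S).
Hypotheses (pb : is_pullback a b p t) (XZc : ma_cover XZ).

Section Chart.
Context (z : S) (k : residue_field z).

(** This is [toric_chart] over the residue field, with the identity as chart of the base. The charts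
    obtained here are what makes the fibre a scheme. *)
Lemma fibre_chart (q : mor (fibre t z) (spec_lrs k)) :
  t \m fibre_incl t z =m point_mor k \m q ->
  (forall (T : lrs) (c : mor T X) (d : mor T (spec_lrs k)), t \m c =m point_mor k \m d ->
    exists u : mor T (fibre t z), fibre_incl t z \m u =m c /\ q \m u =m d) ->
  forall (G : nmodType) (j : mor (spec_lrs (monoid_algebra int G)) XZ), open_emb j ->
  exists u : mor (spec_lrs (monoid_algebra k G)) (fibre t z),
    open_emb u /\ forall x, range j (p (fibre_incl t z x)) -> range u x.
Proof.
move=> qc univ G j je; have [_ pbU] := pb.
have [w [pw tw _]] := pbU (Spec (monoid_algebra k G)) (j \m spec_map (ma_base k G))
  (point_mor k \m spec_map (@ma_cst k G)) (spec_int_eq _ _).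
have [u [iu qu]] := univ _ w (spec_map (@ma_cst k G)) tw.
have pu : (p \m fibre_incl t z) \m u =m j \m spec_map (ma_base k G).
  exact: mor_eq_trans (mor_comp_eqA p iu) pw.
have qu' : q \m u =m mor_id _ \m spec_map (@ma_cst k G).
  exact: mor_eq_trans qu (mor_eq_sym (mor_comp_id _)).
have uniq (U : opens (fibre t z)) (g h : mor (open_sub U) (fibre t z)) :
    (p \m fibre_incl t z) \m g =m (p \m fibre_incl t z) \m h -> q \m g =m q \m h -> g =m h.
  move=> e1 e2; apply: fibre_incl_mono; apply: (pullback_mono pb XZc).
    apply: (mor_eq_trans (mor_comp_assoc _ _ _)); apply: (mor_eq_trans e1).
    exact: mor_eq_sym (mor_comp_assoc _ _ _).
  have aux (l : mor (open_sub U) (fibre t z)) :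
      t \m (fibre_incl t z \m l) =m point_mor k \m (q \m l).
    apply: (mor_eq_trans (mor_comp_assoc _ _ _)); apply: (mor_eq_trans (mor_eq_compr _ qc)).
    exact: mor_comp_eqA (mor_eq_refl _).
  apply: (mor_eq_trans (aux g)); apply: (mor_eq_trans (mor_eq_compl _ e2)).
  exact: mor_eq_sym (aux h).
have [ue ur] := toric_chart je (mor_comp_id_open _) pu qu' uniq.
by exists u; split=> // x jx; apply: ur => //; exists (q x).
Qed.

End Chart.

Lemma mor_R_fibre_chart n : mor_R n t -> forall (z : S) (k : residue_field z) (G : nmodType)
    (j : mor (spec_lrs (monoid_algebra int G)) XZ), open_emb j ->
  exists (W : scheme) (u : mor (spec_lrs (monoid_algebra k G)) W), open_emb u /\ scheme_R n W.
Proof.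
move=> [_ tR] z k G j je; have [q [qc univ]] := fibre_univ t k.
have Fs : is_scheme (fibre t z).
  move=> x; have [H [l [le lx]]] := XZc (p (fibre_incl t z x)).
  have [u [ue ur]] := fibre_chart qc univ le.
  exists (monoid_algebra k H), u; split; first exact: emb_open_immersion.
  exact: ur.
have [u [ue _]] := fibre_chart qc univ je.
pose F := Scheme Fs; exists F, u; split=> //.
(* The extension of degree 1: with it the fibre is its own base change, and the condition on base
   changes becomes one on the fibre. *)
pose K : fieldExtType k := [the fieldExtType k of (k^o : Type)].
have [x y||r rE] := @rmorphism_of K k (fun x => x); [by [] | by split|].
have rK : spec_map r \m spec_map (in_alg K) =m mor_id _.
  apply: glob_inj => x c; rewrite glob_spec_comp glob_spec_map.
  by rewrite rE /= /GRing.scale /= mulr1 glob_id.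
have Kr : spec_map (in_alg K) \m spec_map r =m mor_id _.
  apply: glob_inj => x c; rewrite glob_spec_comp glob_spec_map.
  by rewrite /= rE /GRing.scale /= mulr1 glob_id.
apply: (tR z k K F (fibre_incl t z) q F (mor_id F) (spec_map r \m q)).
  split=> // T c d /univ [v [v1 v2]]; exists v; split=> // w w1 w2.
  by apply: fibre_incl_mono; exact: mor_eq_trans w1 (mor_eq_sym v1).
split=> [|T c d cd].
  apply: (mor_eq_trans (mor_id_comp _)); apply: mor_eq_sym.
  apply: (mor_eq_trans (mor_comp_assoc _ _ _)).
  exact: mor_eq_trans (mor_eq_compr _ Kr) (mor_comp_id _).
exists c; split; first exact: mor_comp_id.
  apply: (mor_eq_trans (mor_comp_eqA _ cd)); apply: (mor_eq_trans (mor_comp_assoc _ _ _)).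
  exact: mor_eq_trans (mor_eq_compr _ rK) (mor_comp_id _).
by move=> v vc _; exact: mor_eq_trans (mor_eq_sym (mor_comp_id _)) vc.
Qed.

(** Pasting of the squares for [X], for its fibre and for the extension of the residue field: [W] is
    the toric scheme over [K]. *)
Lemma base_change_pullback (z : S) (kz : residue_field z) (K : fieldExtType kz)
    (F : scheme) (pF : mor F X) (qF : mor F (Spec kz))
    (W : scheme) (p' : mor W F) (q' : mor W (Spec K)) :
  is_pullback t (point_mor kz) pF qF -> is_pullback qF (Spec_map (in_alg K)) p' q' ->
  is_pullback a (Spec_map (intr : int -> K)) (p \m (pF \m p')) q'.
Proof.
move=> [cF uF] [cW uW]; have [_ pbU] := pb; split=> [|T c d _]; first exact: spec_int_eq.
have [x [x1 x2 x3]] := pbU T c (point_mor kz \m (Spec_map (in_alg K) \m d)) (spec_int_eq _ _).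
have [y [y1 y2 y3]] := uF T x (Spec_map (in_alg K) \m d) x2.
have [w [w1 w2 w3]] := uW T y d y2.
exists w; split=> //.
  apply: (mor_eq_trans (mor_comp_eqA _ (mor_comp_eqA _ w1))).
  exact: mor_eq_trans (mor_eq_compl _ y1) x1.
move=> v v1 v2; apply: w3 => //; apply: y3; last first.
  apply: (mor_eq_trans (mor_comp_assoc _ _ _)); apply: (mor_eq_trans (mor_eq_compr _ cW)).
  exact: mor_comp_eqA.
apply: x3; first by apply: (mor_eq_trans (mor_comp_assoc _ _ _)); apply: mor_eq_trans (mor_eq_sym (mor_comp_assoc _ _ _)) _;
  apply: (mor_eq_trans _ v1); apply: (mor_eq_trans _ (mor_comp_assoc _ _ _)); apply: mor_eq_compl; exact: mor_comp_assoc.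
apply: (mor_eq_trans (mor_comp_assoc _ _ _)); apply: (mor_eq_trans (mor_eq_compr _ cF)).
apply: (mor_comp_eqA _); apply: (mor_eq_trans (mor_comp_assoc _ _ _)).
apply: (mor_eq_trans (mor_eq_compr _ cW)); exact: mor_comp_eqA.
Qed.

End FibreScheme.

(** * Noetherian rings, dimension and regularity *)

(** Carries the local algebra of the ring of a chart over to the stalks of [W]. *)
Lemma chart_stalk_loc (A : comPzRingType) (W : lrs) (u : mor (spec_lrs A) W) : open_emb u ->
  forall P : spec_lrs A, exists be : {rmorphism A -> stalk (u P)},
    is_loc P be /\ forall a, @stalk_map _ _ u P (be a) = spec_germ P a.
Proof.
move=> [_ _ ub] P; have [g [gK Kg]] := rmorphism_inv (ub P).
exists [the {rmorphism A -> stalk (u P)} of (g \o spec_germ P)]; split=> [|a]; last exact: Kg.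
by apply: (is_loc_comp (spec_stalk_loc P) (h := g)); exists (@stalk_map _ _ u P).
Qed.

Section Ideals.
Context (A : comPzRingType).
Implicit Types (I : set A) (s : seq A).

Lemma ideal_gen_ideal s : is_ideal (ideal_gen s).
Proof.
split=> [|x y [c ->] [d ->]|x y [c ->]].
- by exists (fun=> 0); rewrite big1 // => i _; rewrite mul0r.
- by exists (fun i => c i + d i); rewrite -big_split; apply: eq_bigr => i _; rewrite mulrDl.
- by exists (fun i => x * c i); rewrite mulr_sumr; apply: eq_bigr => i _; rewrite mulrA.
Qed.

Lemma ideal_sum I (J : Type) (r : seq J) (P : pred J) (f : J -> A) : is_ideal I ->
  (forall i, P i -> I (f i)) -> I (\sum_(i <- r | P i) f i).
Proof. by move=> [I0 ID _] If; apply: big_ind. Qed.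

Lemma ideal_gen_mem s x : x \in s -> ideal_gen s x.
Proof.
move=> xs; have xi : (index x s < size s)%N by rewrite index_mem.
exists (fun i => (i == Ordinal xi)%:R); rewrite (bigD1 (Ordinal xi)) //= eqxx mul1r nth_index //.
by rewrite big1 ?addr0 // => i /negbTE ->; rewrite mul0r.
Qed.

Lemma ideal_gen_sub I s : is_ideal I -> (forall x, x \in s -> I x) -> ideal_gen s `<=` I.
Proof.
move=> Ii Is x [c ->]; apply: ideal_sum => // i _.
by case: Ii => _ _ IM; apply/IM/Is/mem_nth.
Qed.

Lemma ideal_gen_mono s s' : {subset s <= s'} -> ideal_gen s `<=` ideal_gen s'.
Proof.
by move=> ss; apply: ideal_gen_sub (ideal_gen_ideal _) _ => x /ss; exact: ideal_gen_mem.
Qed.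

Lemma ideal_genE I s : is_ideal I -> (forall x, x \in s -> I x) -> I `<=` ideal_gen s ->
  I = ideal_gen s.
Proof. by move=> Ii Is sI; apply/seteqP; split=> //; exact: ideal_gen_sub. Qed.

Lemma idealN I x : is_ideal I -> I x -> I (- x).
Proof. by move=> [_ _ IM] Ix; rewrite -mulN1r; exact: IM. Qed.

Lemma idealB I x y : is_ideal I -> I x -> I y -> I (x - y).
Proof. by move=> Ii Ix Iy; case: (Ii) => _ ID _; apply: ID => //; exact: idealN. Qed.

End Ideals.

Lemma noetherian_fractions (A B : comPzRingType) (h : {rmorphism A -> B}) :
  (forall b, exists a s, is_unit (h s) /\ h s * b = h a) -> noetherian A -> noetherian B.
Proof.
move=> hf An I Ii; case: (Ii) => I0 ID IM.
have Ji : is_ideal [set a | I (h a)].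
  by split=> [|x y|x y] /=; rewrite ?rmorph0 ?rmorphD ?rmorphM //; [exact: ID | exact: IM].
have [s Js] := An _ Ji; exists (map h s); apply: ideal_genE => // [x /mapP [a as_ ->]|b Ib].
  by rewrite -[I _]/([set a | I (h a)] a) Js; exact: ideal_gen_mem.
have [a [t [[v vt] e]]] := hf b.
have : ideal_gen s a by rewrite -Js /= -e; exact: IM.
case=> c ac; have -> : b = v * h a by rewrite -e mulrA vt mul1r.
case: (ideal_gen_ideal (map h s)) => _ _ GM; apply: GM; rewrite ac rmorph_sum.
apply: ideal_sum (ideal_gen_ideal _) _ => i _; rewrite rmorphM.
by case: (ideal_gen_ideal (map h s)) => _ _ GM; apply/GM/ideal_gen_mem/map_f/mem_nth.
Qed.

Lemma noetherian_field (K : fieldType) : noetherian K.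
Proof.
move=> I Ii; case: (Ii) => I0 ID IM.
have [[x Ix x0]|H] := pselect (exists2 x, I x & x != 0).
  exists [:: x]; apply: ideal_genE => // [y|y Iy]; first by rewrite inE => /eqP ->.
  case: (ideal_gen_ideal [:: x]) => _ _ GM.
  by rewrite -[y](mulfVK x0); apply/GM/ideal_gen_mem; rewrite inE.
exists [::]; apply: ideal_genE => // y Iy; case: (ideal_gen_ideal ([::] : seq K)) => G0 _ _.
by have -> : y = 0; [apply/eqP/negPn/negP => y0; apply: H; exists y | exact: G0].
Qed.

Section HilbertBasis.
Context (A : comNzRingType) (An : noetherian A) (I : set {poly A}) (Ii : is_ideal I).

Lemma hilbert_basis : exists s, I = ideal_gen s.
Proof.
apply: contrapT => H.
(* The classical sequence: each new element has least size among those of [I] not yet generated. The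
   statement is conditional so that [next] is total. *)
have next_ex (s : seq {poly A}) : exists f : {poly A}, (forall g, g \in s -> I g) ->
    [/\ I f, ~ ideal_gen s f & forall g, I g -> ~ ideal_gen s g -> (size f <= size g)%N].
  have [Is|] := pselect (forall g, g \in s -> I g); last by exists 0.
  have [f0 [If0 sf0]] : exists f, I f /\ ~ ideal_gen s f.
    apply: contrapT => H'; apply: H; exists s; apply: ideal_genE => // f If.
    by apply: contrapT => sf; apply: H'; exists f.
  pose P n := `[< exists f, [/\ I f, ~ ideal_gen s f & size f = n] >].
  have exP : exists n, P n by exists (size f0); apply/asboolP; exists f0.
  case: (ex_minnP exP) => n /asboolP [f [If sf fn]] nmin.
  exists f => _; split=> // g Ig sg; rewrite fn; apply: nmin; apply/asboolP.
  by exists g.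
pose next s := projT1 (cid (next_ex s)).
pose fix seqs k := if k is k'.+1 then rcons (seqs k') (next (seqs k')) else [::].
have nextP s : (forall g, g \in s -> I g) -> _ := projT2 (cid (next_ex s)).
have seqsI k g : g \in seqs k -> I g.
  elim: k g => //= k IH g; rewrite mem_rcons inE => /orP [/eqP ->|/IH //].
  by case: (nextP _ IH).
have seqs_mono k l : (k <= l)%N -> {subset seqs k <= seqs l}.
  move=> kl; rewrite -(subnK kl); elim: (l - k)%N => //= m IH x /IH.
  by rewrite mem_rcons inE => ->; rewrite orbT.
pose lc k := map lead_coef (seqs k).
have lc_mono k l : (k <= l)%N -> ideal_gen (lc k) `<=` ideal_gen (lc l).
  move=> kl; apply: ideal_gen_mono => x /mapP [f fk ->].
  by apply: map_f; exact: seqs_mono fk.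
pose J := [set a | exists k, ideal_gen (lc k) a].
have Ji : is_ideal J.
  split=> [|x y [k kx] [l ly]|x y [k ky]].
  - by exists 0%N; case: (ideal_gen_ideal (lc 0%N)).
  - exists (maxn k l); case: (ideal_gen_ideal (lc (maxn k l))) => _ GD _.
    by apply: GD; [exact: (lc_mono k _ (leq_maxl _ _)) | exact: (lc_mono l _ (leq_maxr _ _))].
  - by exists k; case: (ideal_gen_ideal (lc k)) => _ _ GM; exact: GM.
have [s Js] := An Ji.
have [m sm] : exists m, forall x, x \in s -> ideal_gen (lc m) x.
  have : forall x, x \in s -> J x by move=> x xs; rewrite Js; exact: ideal_gen_mem.
  elim: (s) => [|x s' IH] Hs; first by exists 0%N.
  have [x'|m Hm] := IH; first by move=> x's; apply: Hs; rewrite inE x's orbT.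
  have [k kx] := Hs x (mem_head _ _).
  exists (maxn k m) => y; rewrite inE => /orP [/eqP ->|/Hm].
    exact: (lc_mono k _ (leq_maxl _ _)).
  exact: (lc_mono m _ (leq_maxr _ _)).
pose f := next (seqs m); have [If sf fmin] : [/\ I f, ~ ideal_gen (seqs m) f &
    forall g, I g -> ~ ideal_gen (seqs m) g -> (size f <= size g)%N] := nextP _ (@seqsI m).
have : ideal_gen (lc m) (lead_coef f).
  have : J (lead_coef f).
    by exists m.+1; apply: ideal_gen_mem; rewrite /lc /= map_rcons mem_rcons mem_head.
  rewrite Js; apply: ideal_gen_sub => //; exact: ideal_gen_ideal.
have f0 : f != 0 by apply/eqP => e; apply: sf; rewrite e; case: (ideal_gen_ideal (seqs m)).
(* The leading term of [f] is to be cancelled by an element of the ideal generated so far. The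
   coefficients available at the top degree of [f] form an ideal [Kd], which contains all earlier
   leading coefficients. *)
pose Kd := [set a | exists h, [/\ ideal_gen (seqs m) h, (size h <= size f)%N & h`_(size f).-1 = a]].
have Kdi : is_ideal Kd.
  have [G0 GD GM] := ideal_gen_ideal (seqs m).
  split=> [|x y [h [h1 h2 <-]] [h' [h1' h2' <-]]|x y [h [h1 h2 <-]]].
  - by exists 0; rewrite size_poly0 coef0.
  - exists (h + h'); split; [exact: GD | | by rewrite coefD].
    by rewrite (leq_trans (size_polyD _ _)) // geq_max h2.
  - exists (x%:P * h); split; [exact: GM | | by rewrite coefCM].
    by rewrite mul_polyC (leq_trans (size_scale_leq _ _)).
have Kdl x : x \in lc m -> Kd x.
  move=> /mapP [g gm ->].
  have gf : (size g <= size f)%N.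
    have : exists2 l, (l < m)%N & g = next (seqs l).
      elim: (m) gm => //= l IH; rewrite mem_rcons inE => /orP [/eqP ->|/IH [l' ll ->]].
        by exists l.
      by exists l' => //; exact: ltnW.
    case=> l lm ->; have [_ _ nmin] := nextP _ (@seqsI l); apply: nmin => //.
    by move=> e; apply: sf; apply: ideal_gen_mono e; apply: seqs_mono; exact: ltnW.
  have [G0 GD GM] := ideal_gen_ideal (seqs m).
  exists ('X^(size f - size g) * g); split.
  - exact/GM/ideal_gen_mem.
  - by rewrite (leq_trans (size_polyMleq _ _)) // size_polyXn addSn /= subnK.
  - have [->|g0] := eqVneq g 0; first by rewrite mulr0 lead_coef0 coef0.
    move: (g0) gf; rewrite lead_coefE -size_poly_gt0 => gs gf.
    have e : ((size f).-1 = (size f - size g) + (size g).-1)%N.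
      by rewrite -subn1 -[(size g).-1]subn1 addnBA // subnK.
    by rewrite coefXnM e ltnNge leq_addr /= addKn.
move=> /(ideal_gen_sub Kdi Kdl) [h [h1 h2 h3]].
have Ih : I h by apply: (ideal_gen_sub Ii) h1 => g; exact: seqsI.
have /(fmin _ (idealB Ii If Ih)) : ~ ideal_gen (seqs m) (f - h).
  move=> e; apply: sf; rewrite -[f](subrK h); case: (ideal_gen_ideal (seqs m)) => _ GD _.
  exact: GD.
rewrite leqNgt => /negP; apply.
have lt : (size (f - h)%R <= (size f).-1)%N.
  apply/leq_sizeP => i; rewrite leq_eqVlt => /orP [/eqP <-|hi].
    by rewrite coefB h3 subrr.
  have {}hi : (size f <= i)%N := leq_trans (leqSpred _) hi.
  by rewrite coefB !nth_default ?subrr // (leq_trans h2).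
by rewrite (leq_ltn_trans lt) // prednK // size_poly_gt0.
Qed.

End HilbertBasis.

Lemma poly_lift (A : comNzRingType) (D : comPzRingType) (h : {rmorphism A -> D}) (z : D) :
  exists g : {rmorphism {poly A} -> D}, (forall c, g c%:P = h c) /\ g 'X = z.
Proof.
(* The target may be the zero ring; then every map into it is a homomorphism. *)
have [e|/eqP D1] := eqVneq (1 : D) 0.
  have all0 (x : D) : x = 0 by rewrite -[x]mulr1 e mulr0.
  have [x y||g _] := @rmorphism_of {poly A} D (fun=> 0); rewrite ?subr0 //.
    by split=> [|x y]; rewrite ?mulr0 ?e.
  by exists g; split=> [c|]; rewrite [LHS]all0 [RHS]all0.
have [D' DE] : exists D' : comNzRingType, (D' : comPzRingType) = D.
  by apply: comNzRing_of; exact/eqP.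
subst D; have cz : commr_rmorph h z by move=> x; exact: mulrC.
by exists (horner_morph cz); split=> [c|]; [exact: horner_morphC | exact: horner_morphX].
Qed.

(** * Polynomial rings, algebraic independence and chains of primes *)

Section IteratedPolynomials.
Context (K : fieldType).

(** Iterated polynomials in one variable over a domain, because Hilbert's theorem, algebraic
    independence and [regular_prime] are all treated by adding one variable. *)
Fixpoint ipoly (n : nat) : idomainType :=
  if n is m.+1 then {poly (ipoly m)} else K.

Fixpoint ipolyC (n : nat) : {rmorphism K -> ipoly n} :=
  if n is m.+1 then [the {rmorphism K -> {poly (ipoly m)}} of polyC \o ipolyC m] else idfun.

Lemma noetherian_ipoly n : noetherian (ipoly n).
Proof.
elim: n => [|n IH]; first exact: noetherian_field.
move=> I Ii; exact: (hilbert_basis IH Ii).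
Qed.

Section Eval.
Context (D : comPzRingType) (f : {rmorphism K -> D}) (z : nat -> D).

Fixpoint ieval (n : nat) : {rmorphism ipoly n -> D} :=
  if n is m.+1 then projT1 (cid (poly_lift (ieval m) (z m))) else f.

Lemma ievalC n (c : ipoly n) : ieval n.+1 c%:P = ieval n c.
Proof. by rewrite /=; case: cid => g []. Qed.

Lemma ievalX n : ieval n.+1 ('X : {poly ipoly n}) = z n.
Proof. by rewrite /=; case: cid => g []. Qed.

Lemma ievalS n (q : {poly ipoly n}) :
  ieval n.+1 q = \sum_(i < size q) ieval n q`_i * z n ^+ i.
Proof.
rewrite -{1}[q]coefK poly_def rmorph_sum; apply: eq_bigr => i _.
by rewrite -mul_polyC rmorphM rmorphXn /= -/(ieval n.+1) ievalC ievalX.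
Qed.

Lemma ieval_const n c : ieval n (ipolyC n c) = f c.
Proof. by elim: n => //= n IH; rewrite -/(ieval n.+1) ievalC. Qed.

End Eval.

Lemma eq_ieval (D : comPzRingType) (f f' : {rmorphism K -> D}) (z z' : nat -> D) n :
  f =1 f' -> (forall i, (i < n)%N -> z i = z' i) -> forall q, ieval f z n q = ieval f' z' n q.
Proof.
move=> ff'; elim: n => [|n IH] zz' q; first exact: ff'.
rewrite !ievalS; apply: eq_bigr => i _; rewrite IH ?zz' // => j jn.
by apply: zz'; exact: ltnW.
Qed.

Lemma ieval_morph (D D' : comPzRingType) (f : {rmorphism K -> D}) (f' : {rmorphism K -> D'})
    (h : {rmorphism D -> D'}) (z : nat -> D) n : (forall c, h (f c) = f' c) ->
  forall q, ieval f' (h \o z) n q = h (ieval f z n q).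
Proof.
move=> hf; elim: n => [|n IH] q; first exact/esym/hf.
rewrite !ievalS rmorph_sum; apply: eq_bigr => i _.
by rewrite IH rmorphM rmorphXn.
Qed.

Section Dimension.
Context (D : comPzRingType) (f : {rmorphism K -> D}).

(** The first [e] values of [y] are algebraically independent in the quotient by [p]; for [e = 0]
    this says that [p] contains no nonzero constant. *)
Definition alg_indep_mod (p : set D) (e : nat) (y : nat -> D) : Prop :=
  forall q, p (ieval f y e q) -> q = 0.

(** A bound on the transcendence degree that makes sense for any [K]-algebra, be it a domain or
    not. *)
Definition trdeg_le (n : nat) : Prop := forall (z : nat -> D) N, (n < N)%N ->
  exists2 q, q != 0 & ieval f z N q = 0.

(* The lowest monomial of [q] in the lexicographic order forces the constant
   term to lie in the largest prime. *)
Lemma chain_indep (e m : nat) (z : nat -> D) (r : nat -> spec D) :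
  alg_indep_mod (r 0%N) e z ->
  (forall i, (i < m)%N -> forall x, r i.+1 x -> r i x) ->
  (forall i, (i < m)%N -> r i (z (i + e)%N) /\ ~ r i.+1 (z (i + e)%N)) ->
  forall l, (l <= m)%N -> alg_indep_mod (r l) (l + e) z.
Proof.
move=> r0 rS rz; elim=> [|l IH] lm //.
rewrite addSn => q rq; apply/eqP/negPn/negP => q0.
have [rl rl'] := rz l lm.
have [k [q' q'0 qE]] := multiplicity_XsubC (q : {poly ipoly (l + e)}) 0.
have q'0' : q'`_0 != 0 by move: q'0; rewrite q0 /= rootE horner_coef0.
have rq' : r l.+1 (ieval f z (l + e).+1 q').
  move: rq; rewrite qE rmorphM rmorphXn /= -/(ieval f z (l + e).+1) subr0 ievalX.
  case: (Defs.primeP (r l.+1)) => _ _ rP /rP [//|].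
  by elim: k {qE} => [/(@prime1 _ (r l.+1))|k IHk] //; rewrite exprS => /rP [].
have /factor_theorem [g gE] : root (q' - (q'`_0)%:P) 0 by rewrite rootE !hornerE horner_coef0 subrr.
have : r l (ieval f z (l + e) q'`_0).
  have := rS l lm _ rq'; have -> : q' = (q' - (q'`_0)%:P) + (q'`_0)%:P by rewrite subrK.
  rewrite coefD coefB coefC eqxx subrr add0r.
  rewrite gE rmorphD rmorphM /= -/(ieval f z (l + e).+1) subr0 ievalX ievalC => h.
  set c := ieval f z (l + e) _; set a := ieval f z (l + e).+1 g in h.
  have -> : c = (a * z (l + e)%N + c) - a * z (l + e)%N by rewrite addrAC subrr add0r.
  by case: (Defs.primeP (r l)) => ri _ _; apply: idealB => //; exact: primeMl.
by move=> /(IH (ltnW lm)) /eqP; rewrite (negbTE q'0').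
Qed.

(** An element chosen from each step of the chain, together with [y], gives [m + e] independent
    elements by [chain_indep]. *)
Lemma chain_bound (n e m : nat) (y : nat -> D) (p : nat -> set D) :
  trdeg_le n -> (forall i, (i <= m)%N -> is_prime (p i)) ->
  (forall i, (i < m)%N -> p i `<` p i.+1) -> alg_indep_mod (p m) e y -> (m + e <= n)%N.
Proof.
move=> tn pP pS pm; rewrite leqNgt; apply/negP => nme.
have x_ex i : exists x, (i < m)%N -> p i.+1 x /\ ~ p i x.
  have [im|] := boolP (i < m)%N; last by exists 0.
  have [_ /existsNP [x /not_implyP h]] := pS i im.
  by exists x.
pose x i := projT1 (cid (x_ex i)).
have xP i : (i < m)%N -> p i.+1 (x i) /\ ~ p i (x i) := projT2 (cid (x_ex i)).
(* The order matters: first [y], then the elements of the steps from the top of the chain down,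
   since [chain_indep] starts at the largest prime. *)
pose z i := if (i < e)%N then y i else x (m - (i - e).+1)%N.
pose r i : spec D := Prime (pP (m - i)%N (leq_subr _ _)).
have h0 : alg_indep_mod (r 0%N) e z.
  move=> q; rewrite /= subn0 => rq; apply: pm; move: rq.
  by rewrite (@eq_ieval _ f f z y) // => i ie; rewrite /z ie.
have mS i : (i < m)%N -> (m - i = (m - i.+1).+1)%N by move=> im; rewrite subnSK.
have lt i : (i < m)%N -> (m - i.+1 < m)%N by move=> im; rewrite -mS // leq_subr.
have h1 i : (i < m)%N -> forall a, r i.+1 a -> r i a.
  by move=> im a /=; rewrite (mS i im); have [+ _] := pS _ (lt i im); apply.
have h2 i : (i < m)%N -> r i (z (i + e)%N) /\ ~ r i.+1 (z (i + e)%N).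
  move=> im; rewrite /z ltnNge leq_addl /= addnK (mS i im); exact: xP (lt i im).
have [q q0 qE] := tn z (m + e)%N nme.
move/eqP: q0; apply; apply: (chain_indep h0 h1 h2 (leqnn m)).
by rewrite qE; exact: prime0.
Qed.

(** A certificate that the local ring at [p] is regular of dimension [d]. The chain [c] shows that
    the dimension is at least [d]; the [e] independent elements bound it by [n - e] through
    [chain_bound], if the transcendence degree is at most [n]; and [s] consists of [d] generators of
    [p] up to factors outside [p]. *)
Definition regular_prime (n : nat) (p : spec D) : Prop :=
  exists d e (y : nat -> D) (c : nat -> spec D) (s : d.-tuple D),
    [/\ (d + e = n)%N, alg_indep_mod p e y,
       c d = p /\ (forall i, (i < d)%N -> c i `<` c i.+1),
       (forall x, x \in s -> p x) &
       forall x, p x -> exists2 w, ~ p w & ideal_gen s (w * x)].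

End Dimension.
End IteratedPolynomials.

Section PolynomialStep.
Context (K : fieldType) (A : idomainType) (f : {rmorphism K -> A}).

Let polyC' : {rmorphism A -> {poly A}} := polyC.

Lemma ext_prime_subproof (q : spec A) : is_prime [set g : {poly A} | forall i, q g`_i].
Proof.
have [[q0 qD qM] q1 qP] := Defs.primeP q; split=> /=.
- split=> [i|g h qg qh i|g h qh i] /=; first by rewrite coef0.
  + by rewrite coefD; exact: qD.
  + rewrite coefM; apply: ideal_sum => [|j _]; first by case: (Defs.primeP q).
    exact: qM.
- by move=> /(_ 0%N); rewrite coef1.
- move=> g h gh; apply: contrapT => /not_orP [/existsNP [i0 gi0] /existsNP [j0 hj0]].
  (* As in Gauss' lemma: if [i] and [j] are the lowest indices of coefficients outside [q], then the
     coefficient of the product at [i + j] is outside [q]. *)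
  have exg : exists i, `[< ~ q g`_i >] by exists i0; exact/asboolP.
  have exh : exists j, `[< ~ q h`_j >] by exists j0; exact/asboolP.
  case: (ex_minnP exg) => i /asboolP gi imin; case: (ex_minnP exh) => j /asboolP hj jmin.
  have qg k : (k < i)%N -> q g`_k.
    by move=> ki; apply: contrapT => /asboolP /imin; rewrite leqNgt ki.
  have qh k : (k < j)%N -> q h`_k.
    by move=> kj; apply: contrapT => /asboolP /jmin; rewrite leqNgt kj.
  have ii : (i < (i + j).+1)%N by rewrite ltnS leq_addr.
  have := gh (i + j)%N; rewrite coefM (bigD1 (Ordinal ii)) //= addKn.
  set rest := \sum_(_ | _) _ => hs.
  have qr : q rest.
    apply: ideal_sum => [|k]; first by case: (Defs.primeP q).
    rewrite -val_eqE /= neq_ltn => /orP [ki|ik].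
      by apply: primeMr; exact: qg.
    apply: primeMl; apply: qh.
    by rewrite ltn_subLR; [rewrite ltn_add2r | rewrite -ltnS].
  have /qP [] // : q (g`_i * h`_j).
  have -> : g`_i * h`_j = g`_i * h`_j + rest - rest by rewrite addrK.
  by apply: idealB => //; case: (Defs.primeP q).
Qed.

Definition ext_prime (q : spec A) : spec {poly A} := Prime (ext_prime_subproof q).

Lemma ext_prime_sub (q : spec A) (I : set {poly A}) : is_ideal I ->
  (forall a, q a -> I a%:P) -> forall g, ext_prime q g -> I g.
Proof.
move=> Ii qI g qg; rewrite -[g]coefK poly_def; apply: ideal_sum => // i _.
rewrite -mul_polyC mulrC; case: (Ii) => _ _ IM; exact/IM/qI/qg.
Qed.

Lemma ext_prime_lt (q q' : spec A) : q `<` q' -> ext_prime q `<` ext_prime q'.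
Proof.
move=> [qq' /existsNP [a /not_implyP [q'a qa]]]; split; first by move=> g qg i; exact/qq'/qg.
move=> /(_ a%:P) /= h; apply: qa.
have {h} := h _ 0%N; rewrite coefC eqxx; apply=> i.
by rewrite coefC; case: eqP => // _; exact: prime0.
Qed.

Lemma prime_prod (q : spec A) (J : Type) (r : seq J) (P : pred J) (w : J -> A) :
  (forall i, P i -> ~ q (w i)) -> ~ q (\prod_(i <- r | P i) w i).
Proof.
by move=> h; apply: (big_ind (fun x => ~ q x)) => //; [exact: prime1 | move=> *; exact: primeNM].
Qed.

Lemma ext_prime_gen (q : spec A) (s : seq A) :
  (forall y, q y -> exists2 w, ~ q w & ideal_gen s (w * y)) ->
  forall g, ext_prime q g -> exists2 w, ~ q w & ideal_gen (map polyC' s) (w%:P * g).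
Proof.
move=> H g qg.
have w_ex i : exists w, ~ q w /\ ideal_gen s (w * g`_i) by have [w ? ?] := H _ (qg i); exists w.
pose w i := projT1 (cid (w_ex i)).
have wP i : ~ q (w i) /\ ideal_gen s (w i * g`_i) := projT2 (cid (w_ex i)).
exists (\prod_(i < size g) w i); first by apply: prime_prod => i _; case: (wP i).
have [G0 GD GM] := ideal_gen_ideal (map polyC' s).
have Ji : is_ideal [set a | ideal_gen (map polyC' s) a%:P].
  split=> [|a b|a b] /=; rewrite ?polyC0 ?polyCD ?polyCM //; [exact: GD | exact: GM].
have sJ : forall x, x \in s -> [set a | ideal_gen (map polyC' s) a%:P] x.
  by move=> x xs; apply/ideal_gen_mem/map_f.
rewrite -[X in _ * X]coefK poly_def mulr_sumr; apply: ideal_sum (ideal_gen_ideal _) _ => i _.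
rewrite -mul_polyC mulrA mulrC -polyCM; apply: GM; apply: (ideal_gen_sub Ji sJ).
rewrite (bigD1 i) //= -mulrA mulrCA; case: (ideal_gen_ideal s) => _ _; apply.
rewrite mulrC; case: (wP i) => _ wi; by rewrite mulrC.
Qed.

(** If [p] is the extension of its contraction [q], the variable is one more element independent
    modulo [p], and the rest of the certificate is extended. Otherwise one more generator [h] is
    needed, and the extension of [q] is one more step below [p]. Either way [d + e] grows by one. *)
Lemma regular_prime_poly n (p : spec {poly A}) :
  regular_prime f n (comap polyC' p) ->
  regular_prime [the {rmorphism K -> {poly A}} of polyC' \o f] n.+1 p.
Proof.
set q := comap polyC' p => -[d [e [y [c [s [de yq [cd cS] sq qs]]]]]].
have pi : is_ideal p by case: (Defs.primeP p).
have ext_p g : ext_prime q g -> p g by apply: ext_prime_sub.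
have ievP g : ieval [the {rmorphism K -> {poly A}} of polyC' \o f] (polyC' \o y) e g =
    (ieval f y e g)%:P by exact: ieval_morph.
have [pq|/existsNP [g0 /not_implyP [pg0 qg0]]] := pselect (forall g, p g -> ext_prime q g).
  pose y' i := if (i < e)%N then (y i)%:P else 'X.
  exists d, e.+1, y', (fun i => ext_prime (c i)), (map_tuple polyC' s); split.
  - by rewrite addnS de.
  - move=> g /pq; rewrite ievalS /y' ltnn => qg; apply/polyP => i; rewrite coef0.
    have [ig|ig] := ltnP i (size (g : {poly _})); last by rewrite nth_default.
    apply: yq; move: (qg i); rewrite coef_sum (bigD1 (Ordinal ig)) //= big1 => [|j].
      rewrite addr0 (eq_ieval (f' := [the {rmorphism K -> {poly A}} of polyC' \o f]) (z' := polyC' \o y)) //.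
        by rewrite ievP coefCM coefXn eqxx mulr1.
      by move=> k ke; rewrite /y' ke.
    rewrite -val_eqE /= => ji.
    rewrite (eq_ieval (f' := [the {rmorphism K -> {poly A}} of polyC' \o f]) (z' := polyC' \o y)) //.
      by rewrite ievP coefCM coefXn eq_sym (negbTE ji) mulr0.
    by move=> k ke; rewrite /y' ke.
  - split; first by apply: spec_eq => g; rewrite cd; split; [exact: ext_p | exact: pq].
    by move=> i /cS; exact: ext_prime_lt.
  - by move=> x /mapP [a /sq qa ->].
  - by move=> x /pq /(ext_prime_gen qs) [w qw h]; exists w%:P.
pose P k := `[< exists g : {poly A}, [/\ p g, ~ ext_prime q g & size g = k] >].
have exP : exists k, P k by exists (size g0); apply/asboolP; exists g0.
case: (ex_minnP exP) => k /asboolP [h [ph qh hk]] hmin.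
have small g : p g -> (size g < size h)%N -> ext_prime q g.
  move=> pg gh; apply: contrapT => qg; have : P (size g) by apply/asboolP; exists g.
  by move/hmin; rewrite -hk leqNgt gh.
have h0 : h != 0 by apply/eqP => e0; apply: qh; rewrite e0; exact: prime0.
(* If the leading coefficient were in [q], removing the leading term would leave a smaller element
   of [p] outside the extension of [q]. *)
have ql : ~ q (lead_coef h).
  move=> ql; apply: qh.
  have pl : p (lead_coef h *: 'X^((size h).-1)) by rewrite -mul_polyC; exact: primeMr.
  have : ext_prime q (h - lead_coef h *: 'X^((size h).-1)).
    apply: small; first exact: idealB.
    have lt : (size (h - lead_coef h *: 'X^((size h).-1))%R <= (size h).-1)%N.
      apply/leq_sizeP => i; rewrite leq_eqVlt => /orP [/eqP <-|hi].
        by rewrite coefB coefZ coefXn eqxx mulr1 lead_coefE subrr.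
      rewrite coefB coefZ coefXn (gtn_eqF hi) mulr0 subr0 nth_default //.
      exact: leq_trans (leqSpred _) hi.
    by rewrite (leq_ltn_trans lt) // prednK // size_poly_gt0.
  move=> qd i; have := qd i; rewrite coefB coefZ coefXn => qi.
  rewrite -[h`_i](subrK (lead_coef h * (i == (size h).-1)%:R)).
  by case: (Defs.primeP q) => -[_ qD _] _ _; apply: qD => //; exact: primeMr.
pose c' i := if (i <= d)%N then ext_prime (c i) else p.
exists d.+1, e, (polyC' \o y), c', [tuple of h :: map_tuple polyC' s]; split.
- by rewrite addSn de.
- by move=> g; rewrite ievP; exact: yq.
- rewrite /c' ltnn; split=> // i; rewrite ltnS => id_; rewrite id_.
  have [id|di] := ltnP i d; first exact/ext_prime_lt/cS.
  have -> : i = d by apply/eqP; rewrite eqn_leq id_ di.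
  by rewrite cd; split; [exact: ext_p | move=> /(_ h ph)].
- by move=> x; rewrite inE => /orP [/eqP -> //|/mapP [a /sq qa ->]].
(* Pseudo-division by [h]: the factor [l] is a power of the leading coefficient, hence outside [q],
   and the remainder is too small to lie outside the extension of [q]. *)
move=> x px; have E := Pdiv.Idomain.divp_eq x h.
set l := lead_coef h ^+ _ in E.
have qlk : ~ q l.
  rewrite /l; elim: (scalp _ _) => [|m IH]; first by rewrite expr0; exact: prime1.
  by rewrite exprS; exact: primeNM.
have /(ext_prime_gen qs) [w qw hw] : ext_prime q (x %% h).
  apply: small; last by rewrite ltn_modp.
  have -> : x %% h = l *: x - x %/ h * h by rewrite E addrAC subrr add0r.
  by apply: idealB => //; [rewrite -mul_polyC; exact: primeMl | exact: primeMl].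
exists (w * l)%:P; first exact: (primeNM qw qlk : ~ q _).
have [G0 GD GM] := ideal_gen_ideal [tuple of h :: map_tuple polyC' s].
rewrite polyCM -mulrA mul_polyC [l%:P * x]mul_polyC E -mul_polyC mulrDr; apply: GD.
  by rewrite mulrA; apply/GM/ideal_gen_mem; rewrite mem_head.
by apply: ideal_gen_mono hw => z zs; rewrite inE zs orbT.
Qed.

End PolynomialStep.

Lemma regular_prime_ipoly (K : fieldType) n (p : spec (ipoly K n)) : regular_prime (ipolyC K n) n p.
Proof.
elim: n p => [|n IH] p; last exact: regular_prime_poly (IH _).
have p0 x : p x -> x = 0.
  move=> px; apply/eqP/negPn/negP => x0; apply: (@prime1 _ p).
  by rewrite -(mulVf x0); exact: primeMl.
exists 0%N, 0%N, (fun=> 0), (fun=> p), [tuple]; split=> // x /p0 ->.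
exists 1; first exact: prime1.
by rewrite mulr0; case: (ideal_gen_ideal ([tuple] : 0.-tuple (ipoly K 0))).
Qed.

(** * Dimension and regularity of localizations *)

Section LocalizedDimension.
Context (D : comPzRingType) (p : spec D) (B : comPzRingType) (al : {rmorphism D -> B}).
Hypothesis alP : is_loc p al.

Lemma loc_nonunit x : ~ is_unit x <-> exists a s, [/\ ~ p s, al s * x = al a & p a].
Proof.
have [alu als alk] := alP; split=> [nx|[a [s [ps e pa]]] ux].
  have [a [s [ps e]]] := als x; exists a, s; split=> //.
  apply: contrapT => pa; apply: nx; apply: (is_unitMr (x := al s)); rewrite e; exact: alu.
by have := is_unitM (alu s ps) ux; rewrite e => /(loc_unitP alP).
Qed.

Lemma loc_is_local : is_local B.
Proof.
have [p0 pD pM] : is_ideal p by case: (Defs.primeP p).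
split=> [|x y /loc_nonunit [a [s [ps e pa]]] /loc_nonunit [b [t [pt e' pb]]]|x y ny].
- apply/loc_nonunit; exists 0, 1; rewrite mulr0 rmorph0; split=> //; exact: prime1.
- apply/loc_nonunit; exists (t * a + s * b), (s * t); split; first exact: primeNM.
    by rewrite rmorphD !rmorphM -e -e'; ring.
  by apply: pD; exact: pM.
- by move=> /is_unitMr.
Qed.

Lemma loc_noetherian : noetherian D -> noetherian B.
Proof.
apply: (noetherian_fractions (h := al)) => b; have [alu als _] := alP.
by have [a [s [ps e]]] := als b; exists a, s; split=> //; exact: alu.
Qed.

Definition loc_ideal (c : set D) : set B := [set x | exists a s, [/\ ~ p s, al s * x = al a & c a]].

Lemma loc_idealE (c : spec D) a : c `<=` p -> loc_ideal c (al a) <-> c a.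
Proof.
have [alu als alk] := alP; move=> cp; split=> [[b [s [ps e cb]]]|ca]; last first.
  by exists a, 1; rewrite rmorph1 mul1r; split=> //; exact: prime1.
have : al (s * a - b) = 0 by rewrite rmorphB rmorphM e subrr.
move=> /alk [w pw e']; have cw : c (w * s * a).
  have -> : w * s * a = w * (s * a - b) + w * b by ring.
  by rewrite e' add0r; exact: primeMl.
by case: (Defs.primeP c) => _ _ cP; have [/cP [] /cp //|] := cP _ _ cw.
Qed.

Lemma loc_ideal_prime (c : spec D) : c `<=` p -> is_prime (loc_ideal c).
Proof.
have [alu als alk] := alP; move=> cp; have [[c0 cD cM] c1 cP] := Defs.primeP c; split.
- split=> [|x y [a [s [ps e pa]]] [b [t [pt e' pb]]]|x y [b [t [pt e' pb]]]].
  + by exists 0, 1; rewrite mulr0 rmorph0; split=> //; exact: prime1.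
  + exists (t * a + s * b), (s * t); split; first exact: primeNM.
      by rewrite rmorphD !rmorphM -e -e'; ring.
    by apply: cD; exact: cM.
  + have [a [s [ps e]]] := als x; exists (a * b), (s * t); split; first exact: primeNM.
      by rewrite !rmorphM -e -e'; ring.
    exact: cM.
- by rewrite -(rmorph1 al) loc_idealE.
- move=> x y [a [s [ps e pa]]].
  have [b [t [pt eb]]] := als x; have [b' [t' [pt' eb']]] := als y.
  have : loc_ideal c (al (b * b')).
    exists (t * t' * a), s; split=> //; last exact: cM.
    by rewrite !rmorphM -eb -eb' -e; ring.
  by rewrite loc_idealE // => /cP [cb|cb']; [left; exists b, t | right; exists b', t'].
Qed.

Lemma loc_contract_sub (q : set B) : is_prime q -> [set a | q (al a)] `<=` p.
Proof.
move=> qp a /= qa; apply: contrapT => pa; have [alu _ _] := alP.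
have [v va] := alu a pa; case: (qp) => -[_ _ qM] q1 _; apply: q1; rewrite -va; exact: qM.
Qed.

(** Contraction along [al] keeps inclusions strict and lands inside [p], so [y] stays independent
    modulo the largest contracted prime. *)
Lemma loc_chain_bound (K : fieldType) (f : {rmorphism K -> D}) n e (y : nat -> D) :
  trdeg_le f n -> alg_indep_mod f p e y -> forall m, prime_chain B m -> (m + e <= n)%N.
Proof.
move=> tn ye m [q [qP qS]]; have [alu als alk] := alP.
apply: (chain_bound (p := fun i => [set a | q i (al a)]) tn).
- by move=> i im; exact: (comap_prime al (Prime (qP i im))).
- move=> i im; have [sub /existsNP [x /not_implyP [qx nqx]]] := qS i im.
  split=> [a|/(_ _)]; first exact: sub.
  have [a [s [ps e']]] := als x; move=> /(_ a) h; apply: nqx.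
  have qa : q i (al a).
    by apply: h; rewrite /= -e'; case: (qP _ im) => -[_ _ qM] _ _; exact: qM.
  have [v vs] := alu s ps; have -> : x = v * al a by rewrite -e' mulrA vs mul1r.
  by case: (qP _ (ltnW im)) => -[_ _ qM] _ _; exact: qM.
- move=> g /(loc_contract_sub (qP m (leqnn m))); exact: ye.
Qed.

Lemma loc_dim_le (K : fieldType) (f : {rmorphism K -> D}) n : trdeg_le f n -> dim_le B n.
Proof.
move=> tn m mB; rewrite -[m]addn0; apply: (loc_chain_bound tn (y := fun=> 0)) mB.
move=> g /= pg; apply/eqP/negPn/negP => g0; apply: (@prime1 _ p).
by rewrite -(rmorph1 f) -(mulVf g0) rmorphM; exact: primeMl.
Qed.

Lemma loc_regular (K : fieldType) (f : {rmorphism K -> D}) n :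
  noetherian D -> trdeg_le f n -> regular_prime f n p -> regular_local B.
Proof.
move=> Dn tn [d [e [y [c [s [de ye [cd cS] sp ps]]]]]].
have [alu als alk] := alP.
split; [exact: loc_is_local | exact: loc_noetherian | exists d, (map_tuple al s)].
have c_mono i k : (i + k <= d)%N -> c i `<=` c (i + k)%N.
  elim: k => [|k IH]; first by rewrite addn0 => _ x.
  rewrite addnS => ikd; have [sub _] := cS _ ikd.
  by move=> x cx; apply: sub; exact: (IH (ltnW ikd)).
have cp i : (i <= d)%N -> c i `<=` p.
  by move=> id; have := @c_mono i (d - i)%N; rewrite subnKC // cd; apply.
split; first split.
- exists (fun i => loc_ideal (c i)); split=> i id; first exact/loc_ideal_prime/cp.
  have [sub /existsNP [x /not_implyP [cx ncx]]] := cS i id.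
  split=> [b [a [t [pt e' ca]]]|]; first by exists a, t; split=> //; exact: sub.
  move=> /(_ (al x) ((loc_idealE x (cp _ id)).2 cx)).
  by move=> /(loc_idealE x (cp _ (ltnW id))).
- move=> m mB; have := loc_chain_bound tn ye mB.
  by rewrite -de leq_add2r.
apply: ideal_genE; first exact: loc_is_local.
  move=> x /mapP [a /sp pa ->]; by rewrite /max_ideal /= (loc_unitP alP).
move=> x /loc_nonunit [a [t [pt e' pa]]]; have [w pw [g ge]] := ps a pa.
have [v vt] := alu _ (primeNM pw pt).
have -> : x = v * al (w * a) by rewrite rmorphM -e' mulrA -[LHS]mul1r -vt rmorphM; ring.
have [_ GD GM] := ideal_gen_ideal (map_tuple al s).
apply: (GM); rewrite ge rmorph_sum; apply: ideal_sum (ideal_gen_ideal _) _ => i _.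
by rewrite rmorphM; apply/GM/ideal_gen_mem/map_f/mem_nth.
Qed.

End LocalizedDimension.

(** * Transcendence degree of monoid algebras *)

Lemma left_kernel_ex (K : fieldType) (T C : finType) (M : T -> C -> K) : (#|C| < #|T|)%N ->
  exists c : T -> K, (exists t, c t != 0) /\ forall k, \sum_t c t * M t k = 0.
Proof.
move=> CT; pose A : 'M[K]_(#|T|, #|C|) := \matrix_(i, j) M (enum_val i) (enum_val j).
have k0 : kermx A != 0.
  by rewrite -mxrank_eq0 mxrank_ker -lt0n subn_gt0 (leq_ltn_trans (rank_leq_col _)).
pose v := nz_row (kermx A).
have vA : v *m A = 0 by apply/sub_kermxP; exact: nz_row_sub.
exists (fun t => v 0 (enum_rank t)); split.
  have /rV0Pn [i vi] : v != 0 by rewrite nz_row_eq0.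
  by exists (enum_val i); rewrite enum_valK.
move=> k; have /matrixP /(_ 0 (enum_rank k)) := vA; rewrite !mxE => e.
rewrite -[RHS]e (reindex _ (onW_bij _ (enum_val_bij T))) /=.
by apply: eq_bigr => i _; rewrite enum_valK mxE enum_rankK.
Qed.

Section Monomials.
Context (K : fieldType) (A : comPzRingType) (f : {rmorphism K -> A}) (z : nat -> A) (D : nat).

Fixpoint expo (N : nat) : finType := if N is M.+1 then ('I_D * expo M)%type else unit.

Fixpoint monom (N : nat) : expo N -> A :=
  if N is M.+1 then fun t => monom t.2 * z M ^+ t.1 else fun=> 1.

Lemma card_expo N : #|expo N| = (D ^ N)%N.
Proof. by elim: N => [|N IH]; [rewrite card_unit | rewrite card_prod card_ord IH expnS]. Qed.

Lemma ipoly_of_coef N (c : expo N -> K) : exists q : ipoly K N,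
  (q = 0 -> forall t, c t = 0) /\ ieval f z N q = \sum_t f (c t) * monom t.
Proof.
elim: N c => [|N IH] c.
  exists (c tt); split=> [h []|]; first exact: h.
  by rewrite (bigD1 tt) //= big1 ?addr0 ?mulr1 // => -[].
pose q i := projT1 (cid (IH (fun t => c (i, t)))).
have [q0 qE] : (forall i, q i = 0 -> forall t, c (i, t) = 0) /\
    forall i, ieval f z N (q i) = \sum_t f (c (i, t)) * monom t.
  by split=> i; case: (projT2 (cid (IH (fun t => c (i, t))))).
exists (\sum_i (q i)%:P * 'X^i); split.
  move=> e [i t]; apply: q0; have /polyP /(_ i) := e; rewrite coef0 coef_sum => h.
  rewrite -[RHS]h (bigD1 i) //= coefCM coefXn eqxx mulr1 big1 ?addr0 // => j ji.
  by rewrite coefCM coefXn eq_sym (negbTE (ji : val j != val i)) mulr0.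
transitivity (\sum_(i < D) \sum_(t : expo N) f (c (i, t)) * (monom t * z N ^+ i)); last first.
  by rewrite pair_bigA; apply: eq_bigr => -[i t] _.
rewrite rmorph_sum; apply: eq_bigr => i _; rewrite rmorphM rmorphXn /= -/(ieval f z N.+1) ievalC ievalX qE.
by rewrite mulr_suml; apply: eq_bigr => t _; rewrite mulrA.
Qed.

End Monomials.

Lemma ma_coefC (k : comNzRingType) (G : nmodType) c (f : monoid_algebra k G) g : (ma_cst G c * f)@_g = c * f@_g.
Proof.
elim/ma_ind: f => [|f h ef eh|d a]; first by rewrite mulr0 !mcoeff0 mulr0.
  by rewrite mulrDr !mcoeffD ef eh mulrDr.
by rewrite [_ * _]ma_mulUU add0r !mcoeffU mulrnAr.
Qed.

Section MonoidAlgebraDegree.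
Context (K : fieldType) (G : nmodType) (n : nat) (coo : G -> 'I_n -> int).
Hypothesis coo0 : forall k, coo 0 k = 0.
Hypothesis cooD : forall g h k, coo (g + h) k = coo g k + coo h k.
Hypothesis coo_inj : forall g h, coo g =1 coo h -> g = h.

Local Notation KG := (monoid_algebra K G).

Definition in_box (m : nat) (f : KG) : Prop :=
  forall g, f@_g != 0 -> forall k, (`|coo g k| <= m)%N.

Lemma in_box_sum m (J : Type) (r : seq J) (P : pred J) (F : J -> KG) :
  (forall j, P j -> in_box m (F j)) -> in_box m (\sum_(j <- r | P j) F j).
Proof.
move=> H; apply: big_ind => // [g|f h bf bh g]; first by rewrite mcoeff0 eqxx.
rewrite mcoeffD; have [->|fg] := eqVneq f@_g 0; first by rewrite add0r; exact: bh.
by move=> _; exact: bf.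
Qed.

Lemma in_boxM m m' f h : in_box m f -> in_box m' h -> in_box (m + m') (f * h).
Proof.
move=> bf bh; rewrite [f * h]/(ma_mul f h) /ma_mul big_seq; apply: in_box_sum => a af.
rewrite big_seq; apply: in_box_sum => b bg g; rewrite mcoeffU.
case: (a + b =P g) => [<- _ k|_]; last by rewrite mulr0n eqxx.
have := bf a; have := bh b; rewrite -!mcoeff_neq0 in af bg.
move=> /(_ bg k) + /(_ af k); rewrite cooD; lia.
Qed.

Lemma in_box1 : in_box 0 (1 : KG).
Proof.
move=> g; rewrite [1]/(<< 1 *g (0 : G)%R >> : KG) mcoeffU.
by case: (_ =P g) => [<- _ k|_]; [rewrite coo0 | rewrite mulr0n eqxx].
Qed.

Lemma in_boxX m f j : in_box m f -> in_box (j * m) (f ^+ j).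
Proof.
move=> bf; elim: j => [|j IH]; first by rewrite expr0; exact: in_box1.
by rewrite exprS mulSn; exact: in_boxM.
Qed.

Lemma in_box_le m m' f : (m <= m')%N -> in_box m f -> in_box m' f.
Proof. by move=> mm' bf g fg k; exact: leq_trans (bf g fg k) mm'. Qed.

Lemma in_box_ex f : exists m, in_box m f.
Proof.
exists (\max_(g <- msupp f) \max_k `|coo g k|)%N => g fg k.
rewrite mcoeff_neq0 in fg.
apply: (@leq_trans (\max_k0 `|coo g k0|)%N); first exact: (leq_bigmax (F := fun k => `|coo g k|%N)).
exact: (@leq_bigmax_seq _ _ xpredT (fun g => (\max_k `|coo g k|)%N)).
Qed.

Lemma in_box_monom (z : nat -> KG) b D N (t : expo D N) :
  (forall i, (i < N)%N -> in_box b (z i)) -> in_box (N * (D * b)) (monom z t).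
Proof.
elim: N t => [|N IH] t zb /=.
  by rewrite mul0n; exact: in_box1.
case: t => i t /=; rewrite mulSn addnC; apply: in_boxM.
  by apply: IH => j jN; apply: zb; exact: ltnW.
apply: (in_box_le (m := (i * b)%N)); first by rewrite leq_mul2r (ltnW (ltn_ord i)) orbT.
exact/in_boxX/zb.
Qed.

(** A count: there are $D^N$ monomials in [N] elements with exponents below [D], while their
    supports lie in a box whose number of lattice points grows like $D^n$. For large [D] a linear
    relation between the monomials is forced. *)
Lemma ma_trdeg_le : trdeg_le (@ma_cst K G) n.
Proof.
move=> z N nN.
have [b zb] : exists b, forall i, (i < N)%N -> in_box b (z i).
  elim: (N) => [|N' [b IH]]; first by exists 0%N.
  have [b' zb'] := in_box_ex (z N').
  exists (maxn b b') => i; rewrite ltnS leq_eqVlt => /orP [/eqP ->|/IH].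
    by apply: in_box_le zb'; exact: leq_maxr.
  by apply: in_box_le; exact: leq_maxl.
(* All monomials lie in the box of radius [L]. The choice of [B] gives $2L + 1 \le BD$, and that of
   [D] gives $(BD)^n < D^{n+1} \le D^N$. *)
pose B := (2 * N * b).+1; pose D := (B ^ n).+1; pose L := (N * (D * b))%N.
pose C : finType := {ffun 'I_n -> 'I_(2 * L).+1}.
pose code (g : G) : C := [ffun k => inord `|(coo g k + L%:Z)%R|%N].
have code_inj g h : (forall k, (`|coo g k| <= L)%N) -> (forall k, (`|coo h k| <= L)%N) ->
    code g = code h -> g = h.
  move=> gL hL e; apply: coo_inj => k; have /ffunP /(_ k) := e; rewrite !ffunE.
  move=> /(congr1 val) /=; have := gL k; have := hL k => h1 h2; rewrite !inordK; lia.
(* A code that belongs to no element is decoded as 0, so that there is one linear condition for each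
   code. *)
pose dec (c : C) : G := match pselect (exists g, (forall k, (`|coo g k| <= L)%N) /\ code g = c) with
  left h => projT1 (cid h) | _ => 0 end.
have codeK g : (forall k, (`|coo g k| <= L)%N) -> dec (code g) = g.
  move=> gL; rewrite /dec; case: pselect => [h|]; last by case; exists g.
  by case: (projT2 (cid h)) => h1 h2; apply: code_inj.
have CT : (#|C| < #|expo D N|)%N.
  rewrite card_ffun !card_ord card_expo.
  have LB : ((2 * L).+1 <= B * D)%N.
    have -> : (2 * L = 2 * N * b * D)%N by rewrite /L; ring.
    by rewrite ltn_pmul2r.
  apply: (@leq_ltn_trans ((B * D) ^ n)%N).
    by case: (n) => [//|n']; rewrite leq_exp2r.
  rewrite expnMn; apply: (@leq_trans (D ^ n.+1)%N); last by rewrite leq_pexp2l.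
  by rewrite expnS ltn_pmul2r ?expn_gt0.
have [c [[t0 ct0] cM]] := left_kernel_ex (fun t k => (monom z t)@_(dec k)) CT.
have [q [q0 qE]] := ipoly_of_coef (@ma_cst K G) z c.
exists q; first by apply/eqP => /q0 e; move: ct0; rewrite e eqxx.
rewrite qE; apply/malgP => g; rewrite mcoeff0 raddf_sum /=.
have [gL|/existsNP [k gk]] := pselect (forall k, (`|coo g k| <= L)%N).
  by rewrite -[RHS](cM (code g)); apply: eq_bigr => t _; rewrite ma_coefC codeK.
rewrite big1 // => t _; rewrite ma_coefC.
have [->|/(in_box_monom zb) h] := eqVneq (monom z t)@_g 0; first by rewrite mulr0.
by case: gk; exact: h.
Qed.

End MonoidAlgebraDegree.

(** * Flatness *)

Section SquareZero.
Context (A : comNzRingType) (N : lmodType A).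

Definition sqz : Type := (A * N)%type.
HB.instance Definition _ := GRing.Zmodule.on sqz.

Definition sqz_one : sqz := (1, 0).
Definition sqz_mul (x y : sqz) : sqz := (x.1 * y.1, x.1 *: y.2 + y.1 *: x.2).

Lemma sqz_mulA : associative sqz_mul.
Proof.
move=> [a n] [b m] [c l]; congr (_, _) => /=; first exact: mulrA.
by rewrite !scalerDr !scalerA addrA (mulrC c a) (mulrC c b).
Qed.
Lemma sqz_mulC : commutative sqz_mul.
Proof. by move=> [a n] [b m]; congr (_, _) => /=; [exact: mulrC | exact: addrC]. Qed.
Lemma sqz_mul1 : left_id sqz_one sqz_mul.
Proof. by move=> [a n]; congr (_, _) => /=; rewrite ?mul1r ?scale1r ?scaler0 ?addr0. Qed.
Lemma sqz_mulD : left_distributive sqz_mul +%R.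
Proof.
move=> [a n] [b m] [c l]; congr (_, _) => /=; first exact: mulrDl.
by rewrite scalerDl scalerDr addrACA.
Qed.
Lemma sqz_one_neq0 : sqz_one != 0.
Proof. by apply/eqP => /(congr1 fst) /eqP; rewrite oner_eq0. Qed.

HB.instance Definition _ := GRing.Zmodule_isComNzRing.Build sqz
  sqz_mulA sqz_mulC sqz_mul1 sqz_mulD sqz_one_neq0.

Definition sqz_fst (x : sqz) : A := x.1.
Definition sqz_inl (a : A) : sqz := (a, 0).

Lemma sqz_fst_zmod : zmod_morphism sqz_fst. Proof. by []. Qed.
Lemma sqz_fst_monoid : monoid_morphism sqz_fst. Proof. by []. Qed.
Lemma sqz_inl_zmod : zmod_morphism sqz_inl.
Proof. by move=> a b; congr (_, _); rewrite subrr. Qed.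
Lemma sqz_inl_monoid : monoid_morphism sqz_inl.
Proof. by split=> // a b; congr (_, _); rewrite /= !scaler0 addr0. Qed.

HB.instance Definition _ := GRing.isZmodMorphism.Build sqz A sqz_fst sqz_fst_zmod.
HB.instance Definition _ := GRing.isMonoidMorphism.Build sqz A sqz_fst sqz_fst_monoid.
HB.instance Definition _ := GRing.isZmodMorphism.Build A sqz sqz_inl sqz_inl_zmod.
HB.instance Definition _ := GRing.isMonoidMorphism.Build A sqz sqz_inl sqz_inl_monoid.

End SquareZero.

Lemma loc_exists (A : comPzRingType) (p : spec A) :
  exists (L : comPzRingType) (al : {rmorphism A -> L}), is_loc p al.
Proof.
by exists (stalk (p : spec_lrs A)), [the {rmorphism A -> stalk (p : spec_lrs A)} of spec_germ p];
  exact: spec_stalk_loc.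
Qed.

Section Flatness.
Context (A : comNzRingType) (B : comPzRingType) (C : comNzRingType) (G : nmodType).
Context (q : spec C) (al : {rmorphism C -> A}) (P : spec (monoid_algebra C G)).
Context (be : {rmorphism monoid_algebra C G -> B}) (phi : {rmorphism A -> B}).
Hypotheses (alP : is_loc q al) (beP : is_loc P be).
Hypothesis phial : forall c, phi (al c) = be (ma_cst G c).

Let chi g : B := be (ma_chi C g).
Let chi0 : chi 0 = 1. Proof. by rewrite /chi ma_chi0 rmorph1. Qed.
Let chiD g h : chi (g + h) = chi g * chi h. Proof. by rewrite /chi ma_chiD rmorphM. Qed.

Lemma common_denominator (T : eqType) (t : seq T) (b : T -> B) : exists s, ~ P s /\
  exists f : T -> monoid_algebra C G, forall x, x \in t -> be s * b x = be (f x).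
Proof.
have [beu bes bek] := beP.
elim: t => [|x t [s [ps [f fE]]]]; first by exists 1; split; [exact: prime1 | exists (fun=> 0)].
have [a [r [pr e]]] := bes (b x).
exists (r * s); split; first exact: primeNM.
exists (fun y => if y == x then s * a else r * f y) => y; rewrite inE.
case: eqP => [-> _|_ /= yt]; first by rewrite !rmorphM -e; ring.
by rewrite !rmorphM -fE // mulrA.
Qed.

Lemma msupp_union (k : comNzRingType) (T : eqType) (t : seq T) (u : T -> monoid_algebra k G) :
  exists d : {fset G}, forall x, x \in t -> (msupp (u x) `<=` d)%fset.
Proof.
elim: t => [|x t [d dP]]; first by exists fset0.
exists (msupp (u x) `|` d)%fset => y; rewrite inE => /orP [/eqP ->|/dP yd].
  exact: fsubsetUl.
by apply: fsubset_trans yd _; exact: fsubsetUr.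
Qed.

(* The tensor product with B of a module N' is realised inside the localization
   of the monoid algebra over the square-zero extension of A by N'. *)
Lemma tensor_zero_relations (N' : lmodType A) (T : eqType) (t : seq T) (n : T -> N') (b : T -> B) :
  (forall (Q : zmodType) (be' : N' -> B -> Q), balanced phi be' -> \sum_(x <- t) be' (n x) (b x) = 0) ->
  exists v (d : {fset G}) (a : T -> G -> A),
    (forall x, x \in t -> b x = v * \sum_(g <- d) phi (a x g) * chi g) /\
    forall g, \sum_(x <- t) a x g *: n x = 0.
Proof.
move=> tz; pose E : comNzRingType := sqz N'; pose EG := monoid_algebra E G.
have [beu bes bek] := beP.
pose fE : {rmorphism E -> B} := [the {rmorphism E -> B} of phi \o @sqz_fst A N'].
have [rho [rho_cst rho_chi]] := @ma_lift E G B fE chi chi0 chiD.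
have rhoE x : rho x = ma_eval fE chi x.
  elim/ma_ind: x => [|x y ex ey|c g]; first by rewrite !raddf0.
    by rewrite !raddfD /= ex ey.
  by rewrite ma_evalU ma_monoE rmorphM rho_cst rho_chi.
have Bl := loc_is_local beP.
(* [rho] forgets the component in [N']. The ring [L] below inverts everything that [rho] sends to a
   unit, so that [B] maps to it by [th]. *)
have PE : is_prime [set x | ~ is_unit (rho x)].
  have [l0 lD lM] := Bl; split=> /=.
  - split=> [|x y|x y] /=; [by rewrite rmorph0 | by rewrite rmorphD; exact: lD |].
    by rewrite rmorphM; exact: lM.
  - by rewrite rmorph1; apply; exact: is_unit1.
  - move=> x y /= h; apply: contrapT => /not_orP [/contrapT ux /contrapT uy].
    by apply: h; rewrite rmorphM; exact: is_unitM.
have [L [io ioP]] := loc_exists (Prime PE); have [iou ios iok] := ioP.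
have [sg [sg_cst sg_chi]] := @ma_lift C G EG
  [the {rmorphism C -> EG} of @ma_cst E G \o (@sqz_inl A N' \o al)]
  (@ma_chi E G) (@ma_chi0 E G) (@ma_chiD E G).
have rho_sg x : rho (sg x) = be x.
  apply: (ma_ext (h := [the {rmorphism monoid_algebra C G -> B} of rho \o sg])) => [c|g] /=.
    by rewrite sg_cst /= rho_cst /= phial.
  by rewrite sg_chi rho_chi.
have [s Ps|th thE] := loc_univ beP (psi := [the {rmorphism monoid_algebra C G -> L} of io \o sg]).
  by apply: iou => /=; rewrite rho_sg => nu; exact/nu/beu.
have th_phi a : th (phi a) = io (ma_cst G (sqz_inl N' a)).
  apply: (loc_ext alP (h := [the {rmorphism A -> L} of th \o phi])
    (h' := [the {rmorphism A -> L} of io \o (@ma_cst E G \o @sqz_inl A N')])) => c /=.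
  by rewrite phial thE /= sg_cst.
pose inr (m : N') : E := (0, m).
(* Multiplication in [L]: the square-zero element given by [m] times the image of [x]. *)
have bal : balanced phi (fun (m : N') x => io (ma_cst G (inr m)) * th x).
  split=> [m m' x|m x x'|a m x].
  - rewrite -mulrDl -rmorphD -[ma_cst G (inr m) + _]rmorphD /=.
    by congr (io (ma_cst G _) * _); congr (_, _); rewrite addr0.
  - by rewrite rmorphD mulrDr.
  - rewrite rmorphM th_phi mulrA -rmorphM -[ma_cst G (inr m) * _]rmorphM /=.
    congr (io (ma_cst G _) * _); congr (_, _); rewrite /= ?mul0r //.
    by rewrite scale0r add0r.
have := tz _ _ bal => {tz bal} tz.
have [s [Ps [f fE']]] := common_denominator t b.
have : io (\sum_(x <- t) ma_cst G (inr (n x)) * sg (f x)) = 0.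
  rewrite rmorph_sum -[RHS](mulr0 (io (sg s))) -[X in _ = _ * X]tz mulr_sumr.
  rewrite !big_seq; apply: eq_bigr => x xt.
  have := congr1 th (fE' x xt); rewrite rmorphM !thE /= => e.
  by rewrite rmorphM -e; ring.
(* Vanishing in [L] becomes an equation in the monoid algebra after multiplication by some [w] with
   [rho w] a unit. Its coefficients, read in the component [N'], are the relations. *)
move=> /iok [w /= /contrapT wu]; rewrite mulr_sumr => w0.
pose u x : EG := w * sg (f x).
have [d dP] := msupp_union t u.
have [v vE] : is_unit (rho w * be s) by apply: is_unitM => //; exact: beu.
exists v, d, (fun x g => sqz_fst (u x)@_g); split=> [x xt|g].
  have -> : \sum_(g <- d) phi (sqz_fst (u x)@_g) * chi g = rho (u x).
    by rewrite rhoE (ma_evalw _ _ (dP x xt)).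
  by rewrite /u rmorphM rho_sg -fE' // mulrA mulrA -(mulrA v) vE mul1r.
have := congr1 (fun z : EG => (z@_g).2) w0; rewrite mcoeff0 /= => e.
rewrite -[RHS]e raddf_sum /= (big_morph snd (fun x y : E => erefl) erefl).
apply: eq_bigr => x _; rewrite mulrCA ma_coefC /=.
by rewrite scale0r add0r.
Qed.

(** The equational criterion: the relations between the images in [N'] hold already in [N] since [i]
    is injective, and they make every balanced map vanish on [t]. *)
Lemma flat_localized : flat phi.
Proof.
move=> N N' i i_inj t tz Q b [bDl bDr bZ].
have [Q' b' bal|v [d [a [aE a0]]]] :=
    @tensor_zero_relations N' _ t (fun x => i x.1) (fun x => x.2).
  by have := tz Q' b' bal; rewrite big_map.
have b0 m : b 0 m = 0 by apply: (@addrI _ (b 0 m)); rewrite -bDl !addr0.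
have b0r m : b m 0 = 0 by apply: (@addrI _ (b m 0)); rewrite -bDr !addr0.
have an g : \sum_(x <- t) a x g *: x.1 = 0.
  by apply: i_inj; rewrite raddf0 raddf_sum -[RHS](a0 g); apply: eq_bigr => x _; exact: linearZ_LR.
transitivity (\sum_(x <- t) \sum_(g <- d) b (a x g *: x.1) (v * chi g)).
  rewrite !big_seq; apply: eq_bigr => x xt; rewrite {1}(aE x xt) mulr_sumr.
  rewrite (big_morph (b x.1) (bDr x.1) (b0r x.1)).
  by apply: eq_bigr => g _; rewrite bZ mulrCA.
rewrite exchange_big big1 // => g _.
by rewrite -(big_morph (b^~ (v * chi g)) (fun m m' => bDl m m' _) (b0 _)) an b0.
Qed.

End Flatness.

(** * Lattices and regular cones *)

Section ZBasis.
Context (R : realType) (V : vectType R) (N : set V).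

Lemma Zbasis_mem e : Zbasis N e -> forall i, (i < size e)%N -> N e`_i.
Proof.
move=> [-> _] i ie; exists (fun j => (j == Ordinal ie)%:R).
rewrite (bigD1 (Ordinal ie)) //= eqxx mulr1z big1 ?addr0 // => j /negbTE ->.
by rewrite mulr0z.
Qed.

Lemma Zbasis_size_le e e' : Zbasis N e -> Zbasis N e' -> (size e' <= size e)%N.
Proof.
move=> eZ e'Z; have eM := Zbasis_mem eZ; have e'M := Zbasis_mem e'Z.
have [NE _] := eZ; have [NE' e'0] := e'Z.
have P_ex (j : 'I_(size e')) : exists c : 'I_(size e) -> int, e'`_j = \sum_(i < size e) e`_i *~ c i.
  by have := e'M j (ltn_ord j); rewrite {1}NE.
have Q_ex (i : 'I_(size e)) : exists c : 'I_(size e') -> int, e`_i = \sum_(k < size e') e'`_k *~ c k.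
  by have := eM i (ltn_ord i); rewrite {1}NE'.
pose P j := projT1 (cid (P_ex j)); pose Q i := projT1 (cid (Q_ex i)).
have PE (j : 'I_(size e')) : e'`_j = \sum_(i < size e) e`_i *~ P j i := projT2 (cid (P_ex j)).
have QE (i : 'I_(size e)) : e`_i = \sum_(k < size e') e'`_k *~ Q i k := projT2 (cid (Q_ex i)).
apply: (@mulmx1_min _ _ _ (\matrix_(j, i) P j i) (\matrix_(i, k) Q i k)).
apply/matrixP => j k; rewrite !mxE; apply/eqP; rewrite -subr_eq0; apply/eqP.
under eq_bigr do rewrite !mxE.
apply: (e'0 (fun k : 'I_(size e') => \sum_(i < size e) P j i * Q i k - (j == k)%:R)).
under eq_bigr do rewrite mulrzBr.
rewrite sumrB [X in _ - X](bigD1 j) //= eqxx mulr1z [X in _ - (_ + X)]big1 => [|l].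
  rewrite addr0 PE; apply/eqP; rewrite subr_eq0; apply/eqP.
  under eq_bigr do rewrite mulrz_sumr.
  rewrite exchange_big; apply: eq_bigr => i _; rewrite [in RHS]QE mulrz_suml.
  by apply: eq_bigr => l _; rewrite -mulrzA mulrC.
by rewrite eq_sym => /negbTE ->; rewrite mulr0z.
Qed.

Lemma Zbasis_basis e : Zstructure N -> Zbasis N e -> basis_of {:V} e.
Proof.
move=> [_ _ NV [e0 e0Z e0s]] eZ; rewrite basisEdim -e0s Zbasis_size_le // andbT.
apply/subvP => v _; have : setT v by [].
rewrite -NV => -[s [c [sN ->]]]; rewrite big_seq; apply: memv_suml => a /sN.
have [NE _] := eZ; rewrite NE => -[d ->]; apply/memvZ/memv_suml => i _.
by rewrite -scaler_int; apply/memvZ/memv_span/mem_nth.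
Qed.

End ZBasis.

Section Lattice.
Context (R : realType) (V : vectType R) (N : set V) (n : nat) (e : n.-tuple V).
Hypotheses (eZ : Zbasis N e) (eb : basis_of {:V} e).

Let N_e (i : 'I_n) : N e`_i.
Proof. by apply: (Zbasis_mem eZ); rewrite size_tuple. Qed.

Definition dualf (i : 'I_n) : 'Hom(V, R^o) := linfun (coord e i : V -> R^o).

Lemma dualfE i x : dualf i x = coord e i x. Proof. by rewrite lfunE. Qed.

Lemma coord_sum x : x = \sum_i coord e i x *: e`_i.
Proof. by apply: (coord_basis eb); exact: memvf. Qed.

Lemma N_coord x : N x <-> forall i, coord e i x \is a Num.int.
Proof.
split=> [|xi].
  have [-> _] := eZ; case=> c ->; rewrite size_tuple in c * => i.
  rewrite linear_sum rpred_sum // => j _ /=.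
  by rewrite -scaler_int linearZ /= coord_free ?(basis_free eb) // rpredM ?intr_int // natr_int.
have [-> _] := eZ; rewrite [x]coord_sum; move: (N_e); rewrite size_tuple => _.
exists (fun i => Num.floor (coord e i x)); apply: eq_bigr => i _.
by rewrite -scaler_int; have := xi i; rewrite intrEfloor => /eqP ->.
Qed.

Section DualMonoidCoordinates.
Context (sigma : set V).
Local Notation G := (dual_monoid N sigma).

Lemma dual_coneP (u : 'Hom(V, R^o)) : u \in dual_cone N sigma <->
  (forall i : 'I_n, u e`_i \is a Num.int) /\ (forall x, sigma x -> 0 <= u x).
Proof.
rewrite unfold_in; split=> [/asboolP [uN us]|[ue us]]; first by split=> // i; exact: uN.
apply/asboolP; split=> // x /N_coord xi; rewrite [x]coord_sum linear_sum rpred_sum // => i _.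
by rewrite linearZ /= rpredM.
Qed.

Definition dm_coo (g : G) (i : 'I_n) : int := Num.floor (dm_val g e`_i : R).

Lemma dm_cooE (g : G) (i : 'I_n) : (dm_coo g i)%:~R = dm_val g e`_i :> R.
Proof.
by have [gi _] := (dual_coneP _).1 (dm_valP g); have := gi i; rewrite intrEfloor => /eqP.
Qed.

Lemma dm_coo0 i : dm_coo 0 i = 0.
Proof. by apply/eqP; rewrite -(eqr_int R) dm_cooE /= lfunE. Qed.

Lemma dm_cooD g h i : dm_coo (g + h) i = dm_coo g i + dm_coo h i.
Proof. by apply: (@intr_inj R); rewrite rmorphD /= !dm_cooE /= lfunE. Qed.

Lemma dm_coo_inj g h : dm_coo g =1 dm_coo h -> g = h.
Proof.
move=> gh; apply: val_inj; apply/lfunP => x; rewrite [x]coord_sum !linear_sum.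
by apply: eq_bigr => i _; rewrite !linearZ /= -!dm_cooE gh.
Qed.

Lemma dm_trdeg_le (K : fieldType) : trdeg_le (@ma_cst K G) n.
Proof. exact: (ma_trdeg_le dm_coo0 dm_cooD dm_coo_inj). Qed.

Definition int_functional (w : 'I_n -> int) : 'Hom(V, R^o) := \sum_i (w i)%:~R *: dualf i.

Lemma int_functionalE w x : int_functional w x = \sum_i (w i)%:~R * coord e i x.
Proof. by rewrite sum_lfunE; apply: eq_bigr => i _; rewrite lfunE /= dualfE. Qed.

Lemma int_functional_basis w (i : 'I_n) : int_functional w e`_i = (w i)%:~R.
Proof.
rewrite int_functionalE (bigD1 i) //= big1 => [|j ji].
  by rewrite coord_free ?(basis_free eb) // eqxx mulr1 addr0.
by rewrite coord_free ?(basis_free eb) // eq_sym (negbTE ji) mulr0.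
Qed.

Lemma dm_exists w : (forall x, sigma x -> 0 <= int_functional w x) ->
  exists g : G, forall i, dm_coo g i = w i.
Proof.
move=> ws; have wd : int_functional w \in dual_cone N sigma.
  by apply/dual_coneP; split=> // i; rewrite int_functional_basis intr_int.
by exists (DualMonoid wd) => i; apply: (@intr_inj R); rewrite dm_cooE /= int_functional_basis.
Qed.

Lemma dm_valE (g : G) x : dm_val g x = \sum_i (dm_coo g i)%:~R * coord e i x.
Proof.
rewrite {1}[x]coord_sum linear_sum; apply: eq_bigr => i _.
by rewrite linearZ /= -dm_cooE mulrC.
Qed.

End DualMonoidCoordinates.
End Lattice.

Lemma ma_coef_chi (k : comNzRingType) (G : nmodType) (f : monoid_algebra k G) a g :
  (f * ma_chi k a)@_g = \sum_(b <- msupp f) f@_b *+ (b + a == g).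
Proof.
have -> : f * ma_chi k a = \sum_(b <- msupp f) << f@_b *g b + a >>.
  rewrite [_ * _](ma_mulw (fsubset_refl _) msuppU_le); apply: eq_bigr => b _.
  by rewrite big_seq_fset1 mcoeffUU mulr1.
by rewrite raddf_sum; apply: eq_bigr => b _; rewrite /= mcoeffU.
Qed.

(** * Monoid algebras of regular cones *)

Section RegularMonoid.
Context (G : nmodType) (n : nat) (coo : G -> 'I_n -> int).
Hypothesis coo0 : forall k, coo 0 k = 0.
Hypothesis cooD : forall g h k, coo (g + h) k = coo g k + coo h k.
Hypothesis coo_inj : forall g h, coo g =1 coo h -> g = h.
Context (A : 'I_n -> Prop).
Hypothesis coo_ge0 : forall g i, A i -> 0 <= coo g i.
Hypothesis regular_gen_ex : forall w : 'I_n -> int, (forall i, A i -> 0 <= w i) ->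
  exists g, forall i, coo g i = w i.

Lemma delta_ge0 (i j : 'I_n) : A j -> 0 <= ((j == i)%:R : int).
Proof. by rewrite ler0n. Qed.

(** The unit vectors: the hypotheses identify [G] with the vectors of $\mathbb{Z}^n$ whose
    coordinates in [A] are nonnegative. *)
Definition regular_gen (i : 'I_n) : G := projT1 (cid (regular_gen_ex (@delta_ge0 i))).

Lemma coo_gen i j : coo (regular_gen i) j = (j == i)%:R.
Proof. exact: (projT2 (cid (regular_gen_ex (@delta_ge0 i)))). Qed.

Context (K : fieldType).
Local Notation KG := (monoid_algebra K G).

Definition gen_monom (i : nat) : KG :=
  if insub i is Some j then ma_chi K (regular_gen j) else 1.

Lemma gen_monomE (i : 'I_n) : gen_monom i = ma_chi K (regular_gen i).
Proof. by rewrite /gen_monom valK. Qed.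

Lemma ma_chiX (g : G) m : ma_chi K g ^+ m = ma_chi K (g *+ m).
Proof.
elim: m => [|m IH]; first by rewrite expr0 mulr0n ma_chi0.
by rewrite exprS mulrS ma_chiD IH.
Qed.

Lemma coo_mulrn (g : G) m i : coo (g *+ m) i = coo g i *+ m.
Proof.
elim: m => [|m IH]; first by rewrite mulr0n coo0.
by rewrite !mulrS cooD IH.
Qed.

Lemma coef_chi_add (f : KG) a g : (f * ma_chi K a)@_(g + a) = f@_g.
Proof.
have addI b : b + a = g + a -> b = g.
  move=> h; apply: coo_inj => i; have := congr1 (coo^~ i) h.
  by rewrite !cooD; exact: addIr.
rewrite ma_coef_chi; have [gf|gf] := boolP (g \in msupp f); last first.
  rewrite big_seq big1 ?mcoeff_outdom // => b bf.
  by case: eqP => // /addI bg; rewrite bg (negbTE gf) in bf.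
rewrite (big_fsetD1 g) //= eqxx mulr1n big_seq big1 ?addr0 // => b.
rewrite in_fsetD1 => /andP [bg _].
have [/addI ba|_] := eqVneq (b + a) (g + a); last by rewrite mulr0n.
by rewrite ba eqxx in bg.
Qed.

Lemma coef_chi_neq0 (f : KG) a g : (f * ma_chi K a)@_g != 0 ->
  exists2 b, b + a = g & f@_b != 0.
Proof.
move=> h; apply: contrapT => H; move/eqP: h; apply; rewrite ma_coef_chi big_seq big1 // => b bf.
case: eqP => // ba; case: H; exists b => //; by rewrite mcoeff_neq0.
Qed.

Lemma coef_sum_gen (k : 'I_n) m (F : nat -> KG) i h :
  (forall j g, (F j)@_g != 0 -> coo g k = 0) -> coo h k = 0 -> (i < m)%N ->
  (\sum_(j < m) F j * ma_chi K (regular_gen k *+ j))@_(h + regular_gen k *+ i) = (F i)@_h.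
Proof.
move=> F0 hk im; rewrite raddf_sum (bigD1 (Ordinal im)) //=.
rewrite (coef_chi_add (F i) _ h) big1 => [|j ji]; first exact: addr0.
apply/eqP/negPn/negP => /coef_chi_neq0 [b be Fb]; case/negP: ji; rewrite -val_eqE.
have := congr1 (coo^~ k) be; rewrite /= !cooD !coo_mulrn coo_gen eqxx (F0 _ _ Fb) hk.
by rewrite !add0r => /eqP; rewrite eqr_nat.
Qed.

(** Induction on the number of variables, together with the claim that polynomials in the first [k]
    variables have images supported where the later coordinates vanish. So terms with different
    powers of the next variable have disjoint supports. *)
Lemma regular_ieval_inj : forall q : ipoly K n, ieval (@ma_cst K G) gen_monom n q = 0 -> q = 0.
Proof.
suff H k : (k <= n)%N -> forall q : ipoly K k,
    (forall g, (ieval (@ma_cst K G) gen_monom k q)@_g != 0 ->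
       forall j : 'I_n, (k <= j)%N -> coo g j = 0) /\
    (ieval (@ma_cst K G) gen_monom k q = 0 -> q = 0) by move=> q; case: (H n (leqnn n) q).
elim: k => [|k IH] kn q.
  split=> [g|]; rewrite [ieval _ _ _ _]/(ma_cst G q).
    rewrite mcoeffU; case: (0 =P g) => [<- _ j _|_]; last by rewrite mulr0n eqxx.
    exact: coo0.
  by move=> /malgP /(_ 0); rewrite mcoeffUU mcoeff0.
pose kk := Ordinal kn; pose u := regular_gen kk.
have {}IH := IH (ltnW kn).
pose F i := ieval (@ma_cst K G) gen_monom k (q : {poly _})`_i.
have qE : ieval (@ma_cst K G) gen_monom k.+1 q = \sum_(i < size (q : {poly _})) F i * ma_chi K (u *+ i).
  by rewrite ievalS; apply: eq_bigr => i _; rewrite (gen_monomE kk) ma_chiX.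
have F0 i g : (F i)@_g != 0 -> coo g kk = 0 by move=> Fg; apply: ((IH _).1 _ Fg).
split=> [g|q0].
  rewrite qE raddf_sum /= => h j kj.
  have [i hi] : exists i : 'I_(size (q : {poly _})), (F i * ma_chi K (u *+ i))@_g != 0.
    by apply: contrapT => H; move/eqP: h; apply; apply: big1 => i _;
      apply/eqP/negPn/negP => hi; apply: H; exists i.
  have [b <- Fb] := coef_chi_neq0 hi.
  rewrite cooD coo_mulrn coo_gen ((IH _).1 _ Fb j (ltnW kj)).
  by rewrite -val_eqE /= (gtn_eqF kj) mul0rn.
apply/polyP => i; rewrite coef0; have [iq|iq] := ltnP i (size (q : {poly _})); last by rewrite nth_default.
apply: (IH _).2; apply/malgP => h; rewrite mcoeff0; apply/eqP/negPn/negP => Fh.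
have hk : coo h kk = 0 by exact: F0 Fh.
have := coef_sum_gen F0 hk iq; rewrite -qE q0 mcoeff0 => e0.
by move/eqP: Fh; apply; exact: (esym e0).
Qed.

Local Notation psi := (ieval (@ma_cst K G) gen_monom n).

Lemma ieval_cst_range c : exists a, psi a = ma_cst G c.
Proof. by exists (ipolyC K n c); rewrite ieval_const. Qed.

Lemma ieval_gen_range k (i : 'I_n) : (i < k)%N -> exists a, ieval (@ma_cst K G) gen_monom k a = ma_chi K (regular_gen i).
Proof.
elim: k => // k IH; rewrite ltnS leq_eqVlt => /orP [/eqP ik|/IH [a aE]].
  by exists 'X; rewrite ievalX -ik gen_monomE.
by exists (a : ipoly K k)%:P; rewrite ievalC.
Qed.

Lemma ieval_pos_range (g : G) : (forall i, 0 <= coo g i) -> exists a, psi a = ma_chi K g.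
Proof.
move=> g0.
have -> : ma_chi K g = \prod_(i < n) ma_chi K (regular_gen i) ^+ `|coo g i|%N.
  have gE : g = \sum_(i < n) regular_gen i *+ `|coo g i|%N.
    apply: coo_inj => j.
    have -> : coo (\sum_(i < n) regular_gen i *+ `|coo g i|%N) j = \sum_(i < n) coo (regular_gen i *+ `|coo g i|%N) j.
      by apply: (big_morph (coo^~ j)) => [x y|]; rewrite ?cooD ?coo0.
    rewrite (bigD1 j) //= coo_mulrn coo_gen eqxx big1 => [|i ij].
      by rewrite addr0 pmulrn intz gez0_abs.
    by rewrite coo_mulrn coo_gen eq_sym (negbTE ij) mul0rn.
  rewrite {1}gE (big_morph (@ma_chi K G) (@ma_chiD K G) (@ma_chi0 K G)).
  by apply: eq_bigr => i _; rewrite ma_chiX.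
apply: (big_ind (fun x => exists a, psi a = x)) => [|x y [a ax] [b by_]|i _].
- by exists 1; rewrite rmorph1.
- by exists (a * b); rewrite rmorphM ax by_.
have [a ax] := ieval_gen_range (ltn_ord i).
by exists (a ^+ `|coo g i|%N); rewrite rmorphXn /= ax.
Qed.

(** A monomial whose coordinates in [A] vanish is a unit, and multiplication by a suitable one makes
    all coordinates nonnegative: [K[G]] is the polynomial ring with some variables inverted. *)
Lemma regular_fractions (b : KG) : exists a s, is_unit (psi s) /\ psi s * b = psi a.
Proof.
elim/ma_ind: b => [|x y [a [s [su ae]]] [b [t [tu be]]]|c g].
- by exists 0, 1; rewrite !rmorph1 rmorph0 mulr0; split=> //; exact: is_unit1.
- exists (t * a + s * b), (s * t); rewrite rmorphM; split; first exact: is_unitM.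
  by rewrite rmorphD !rmorphM -ae -be; ring.
have [h hE] : exists h : G, forall i : 'I_n, coo h i = (`[< ~ A i >] * `|coo g i|)%:Z.
  by apply: regular_gen_ex => i Ai.
have [h' h'E] : exists h : G, forall i : 'I_n, coo h i = - (`[< ~ A i >] * `|coo g i|)%:Z.
  by apply: regular_gen_ex => i Ai; rewrite asboolF // mul0n oppr0.
have [s sE] : exists a, psi a = ma_chi K h by apply: ieval_pos_range => i; rewrite hE.
have [a aE] : exists a, psi a = ma_chi K (h + g).
  apply: ieval_pos_range => i; rewrite cooD hE.
  have [Ai|nA] := pselect (A i).
    by rewrite asboolF ?mul0n ?add0r; [exact: coo_ge0 | exact].
  rewrite asboolT // mul1n; lia.
have [d dE] := ieval_cst_range c.
exists (d * a), s; split.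
  rewrite sE; exists (ma_chi K h'); rewrite -ma_chiD -(ma_chi0 K); congr ma_chi.
  by apply: coo_inj => i; rewrite cooD hE h'E coo0 addNr.
by rewrite rmorphM dE aE sE ma_chiD ma_monoE; ring.
Qed.

Lemma regular_noetherian : noetherian KG.
Proof. exact: noetherian_fractions regular_fractions (@noetherian_ipoly K n). Qed.

Lemma regular_cone_local (P : spec KG) (B : comPzRingType) (be : {rmorphism KG -> B}) :
  is_loc P be -> regular_local B.
Proof.
move=> [beu bes bek].
have psP u : is_unit (psi u) -> ~ P (psi u).
  by move=> [v vu] Pu; apply: (@prime1 _ P); rewrite -vu; exact: primeMl.
have loc : is_loc (comap psi P) [the {rmorphism ipoly K n -> B} of be \o psi].
  split=> [s Ps|x|a /= /bek [w Pw wa]].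
  - exact: beu.
  - have [b [r [Pr e1]]] := bes x.
    have [a1 [s1 [u1 e2]]] := regular_fractions b.
    have [a2 [s2 [u2 e3]]] := regular_fractions r.
    exists (s2 * a1), (s1 * a2); split=> /=.
      by rewrite rmorphM -e3; apply: primeNM; [|apply: primeNM]; first 1 [exact: psP|exact: psP].
    rewrite !rmorphM /= -e2 -e3 !rmorphM /= -e1; ring.
  - have [a1 [s1 [u1 e2]]] := regular_fractions w.
    exists a1; first by rewrite /= -e2; apply: primeNM => //; exact: psP.
    by apply: regular_ieval_inj; rewrite rmorphM -e2 -mulrA wa mulr0.
(* The bound for the monoid algebra passes to the polynomial ring embedded in it. *)
have tr : trdeg_le (ipolyC K n) n.
  move=> z M nM; have [q q0 qE] := ma_trdeg_le coo0 cooD coo_inj (psi \o z) nM.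
  exists q => //; apply: regular_ieval_inj; rewrite -qE; apply/esym/ieval_morph => c.
  exact: ieval_const.
exact: (loc_regular loc (@noetherian_ipoly K n) tr (regular_prime_ipoly _)).
Qed.

End RegularMonoid.

Section RegularCone.
Context (R : realType) (V : vectType R) (N : set V) (n : nat) (e : n.-tuple V).
Hypotheses (eZ : Zbasis N e) (eb : basis_of {:V} e).
Context (A : set V) (Ae : A `<=` [set` e]).
Local Notation G := (dual_monoid N (cone A)).
Local Notation coo := (@dm_coo R V N n e (cone A)).

Lemma cone_coord x : cone A x -> forall i : 'I_n,
  0 <= coord e i x /\ (~ A e`_i -> coord e i x = 0).
Proof.
move=> [s [c [sA ->]]] i; rewrite linear_sum; split=> [|nA].
  rewrite big_seq sumr_ge0 // => a /sA [Aa ca]; rewrite linearZ /= mulr_ge0 //.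
  have /= /tnthP [j ->] := Ae Aa.
  by rewrite (tnth_nth 0) coord_free ?(basis_free eb) // ler0n.
rewrite big_seq big1 // => a /sA [Aa _]; rewrite linearZ /=.
have /= /tnthP [j aj] := Ae Aa; rewrite aj (tnth_nth 0) coord_free ?(basis_free eb) //.
case: eqP => [ji|_]; last by rewrite mulr0.
by case: nA; rewrite -ji -tnth_nth -aj.
Qed.

Lemma cone_mem i : A i -> cone A i.
Proof.
move=> Ai; exists [:: i], (fun=> 1); split; last by rewrite big_seq1 scale1r.
by move=> a; rewrite inE => /eqP ->.
Qed.

Lemma regular_gen_ex (w : 'I_n -> int) : (forall i : 'I_n, A e`_i -> 0 <= w i) ->
  exists g : G, forall i, coo g i = w i.
Proof.
move=> w0; apply: (dm_exists eZ eb) => x /cone_coord xA; rewrite int_functionalE.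
apply: sumr_ge0 => i _; have [xi xi'] := xA i.
have [/w0 wi|/xi' ->] := pselect (A e`_i); last by rewrite mulr0.
by rewrite mulr_ge0 // ler0z.
Qed.

Lemma coo_ge0 (g : G) (i : 'I_n) : A e`_i -> 0 <= coo g i.
Proof.
move=> /cone_mem Ai; rewrite -(ler0z R) (dm_cooE eZ eb).
by have [_] := (dual_coneP eZ eb _ _).1 (dm_valP g); apply.
Qed.

End RegularCone.

(** * Irreducible elements and cotangent spaces *)

Section Farkas.
Context (F : realFieldType) (n : nat).

Definition dot (u x : 'rV[F]_n) : F := \sum_i u 0 i * x 0 i.

Lemma dotDl u v x : dot (u + v) x = dot u x + dot v x.
Proof. by rewrite -big_split; apply: eq_bigr => i _; rewrite mxE mulrDl. Qed.
Lemma dotZl c u x : dot (c *: u) x = c * dot u x.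
Proof. by rewrite mulr_sumr; apply: eq_bigr => i _; rewrite mxE mulrA. Qed.
Lemma dotDr u x y : dot u (x + y) = dot u x + dot u y.
Proof. by rewrite -big_split; apply: eq_bigr => i _; rewrite mxE mulrDr. Qed.
Lemma dotZr c u x : dot u (c *: x) = c * dot u x.
Proof. by rewrite mulr_sumr; apply: eq_bigr => i _; rewrite mxE mulrCA. Qed.

(* If [b] takes a negative value on the cone cut out by the first [m] functionals,
   at a point [x], project along [x] onto the kernel of the last one. *)
Lemma farkas m (a : nat -> 'rV[F]_n) b :
  (forall x, (forall j, (j < m)%N -> 0 <= dot (a j) x) -> 0 <= dot b x) ->
  exists c : nat -> F, (forall j, 0 <= c j) /\ b = \sum_(j < m) c j *: a j.
Proof.
elim: m a b => [|m IH] a b H.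
  exists (fun=> 0); split=> //; rewrite big_ord0.
  (* Without functionals the cone is the whole space; testing [b] at [- b] gives [b = 0]. *)
  have := H (- b) (fun _ => ltac:(by [])); rewrite -scaleN1r dotZr mulN1r oppr_ge0.
  have bb i : 0 <= b 0 i * b 0 i by rewrite -expr2 sqr_ge0.
  rewrite le_eqVlt ltNge sumr_ge0 // orbF psumr_eq0 // => /allP b0.
  apply/rowP => i; rewrite mxE; apply/eqP.
  by have := b0 i (mem_index_enum i); rewrite mulf_eq0 orbb.
have [|/existsNP [x0 /not_implyP [x0a /negP]]] :=
    pselect (forall x, (forall j, (j < m)%N -> 0 <= dot (a j) x) -> 0 <= dot b x).
  move=> /IH [c [c0 bE]]; exists (fun j => if (j < m)%N then c j else 0).
  split=> [j|]; first by case: ifP.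
  rewrite big_ord_recr /= ltnn scale0r addr0 bE.
  by apply: eq_bigr => j _; rewrite ltn_ord.
rewrite -ltNge => x0b.
have x0am : dot (a m) x0 < 0.
  rewrite ltNge; apply/negP => am; move: x0b; rewrite ltNge => /negP; apply; apply: H => j.
  by rewrite ltnS leq_eqVlt => /orP [/eqP ->|/x0a].
pose x := (- dot (a m) x0)^-1 *: x0.
have xm : dot (a m) x = -1 by rewrite dotZr invrN mulNr mulVf // lt_eqF.
have ip : 0 < (- dot (a m) x0)^-1 by rewrite invr_gt0 oppr_gt0.
have xa j : (j < m)%N -> 0 <= dot (a j) x by move=> /x0a h; rewrite dotZr mulr_ge0 // ltW.
have xb : dot b x <= 0 by rewrite dotZr mulr_ge0_le0 // ltW.
pose a' j := a j + dot (a j) x *: a m.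
have [y ya|c [c0 bE]] := IH a' (b + dot b x *: a m).
  pose y' := y + dot (a m) y *: x.
  have E u : dot (u + dot u x *: a m) y = dot u y'.
    by rewrite /y'; move: (x) => x1; rewrite dotDl dotZl dotDr dotZr [dot u x1 * _]mulrC.
  rewrite E; apply: H => j; rewrite ltnS leq_eqVlt => /orP [/eqP ->|/ya].
    by rewrite dotDr dotZr xm mulrN1 subrr.
  by rewrite E.
exists (fun j => if (j < m)%N then c j else \sum_(i < m) c i * dot (a i) x - dot b x).
split=> [j|].
  case: ifP => // _; rewrite subr_ge0 (le_trans xb) // sumr_ge0 // => i _.
  by rewrite mulr_ge0 // xa.
rewrite big_ord_recr /= ltnn scalerBl addrA -[LHS](addrK (dot b x *: a m)) bE; congr (_ - _).
rewrite scaler_suml -big_split; apply: eq_bigr => j _ /=.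
by rewrite ltn_ord scalerDr scalerA.
Qed.

End Farkas.

(** A rational point of the cone becomes integral after clearing denominators, so integral test
    vectors suffice. *)
Lemma int_farkas n m (a : 'I_m -> 'I_n -> int) (b : 'I_n -> int) :
  (forall w : 'I_n -> int, (forall j, 0 <= \sum_i w i * a j i) -> 0 <= \sum_i w i * b i) ->
  exists q : 'I_m -> rat, (forall j, 0 <= q j) /\ forall i, (b i)%:~R = \sum_j q j * (a j i)%:~R.
Proof.
move=> H.
pose ra (j : nat) : 'rV[rat]_n := if insub j is Some k then \row_i (a k i)%:~R else 0.
have raE (j : 'I_m) : ra j = \row_i (a j i)%:~R by rewrite /ra valK.
pose rb : 'rV[rat]_n := \row_i (b i)%:~R.
have [x xa|c [c0 bE]] := @farkas rat n m ra rb.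
  pose D : int := \prod_i denq (x 0 i).
  have D0 : 0 < D by apply: prodr_gt0 => i _; exact: denq_gt0.
  pose w i : int := numq (x 0 i) * \prod_(k | k != i) denq (x 0 k).
  have wE i : (w i)%:~R = D%:~R * x 0 i :> rat.
    rewrite /D (bigD1 i) //= !rmorphM /= mulrAC; congr (_ * _).
    by rewrite mulrC -[X in _ = X * _]divq_num_den mulfVK // intr_eq0 denq_neq0.
  have dotE (u : 'I_n -> int) : D%:~R * dot (\row_i (u i)%:~R) x = (\sum_i w i * u i)%:~R.
    rewrite rmorph_sum mulr_sumr; apply: eq_bigr => i _.
    by rewrite mxE rmorphM /= wE mulrCA mulrC.
  have Dp : 0 < D%:~R :> rat by rewrite ltr0z.
  rewrite -(pmulr_rge0 _ Dp) dotE ler0z; apply: H => j.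
  by rewrite -(ler0z rat) -dotE -raE pmulr_rge0 // xa.
exists (fun j => c j); split=> // i.
have /rowP /(_ i) := bE; rewrite mxE summxE => ->.
by apply: eq_bigr => j _; rewrite raE !mxE.
Qed.

Lemma loc_common_denominator (D : comPzRingType) (p : spec D) (B : comPzRingType)
    (al : {rmorphism D -> B}) (T : finType) (b : T -> B) : is_loc p al ->
  exists s (f : T -> D), ~ p s /\ forall x, al s * b x = al (f x).
Proof.
move=> [alu als alk].
suff [s [f [ps fE]]] : exists s (f : T -> D), ~ p s /\ forall x, x \in enum T -> al s * b x = al (f x).
  by exists s, f; split=> // x; apply: fE; rewrite mem_enum.
elim: (enum T) => [|x t [s [f [ps fE]]]]; first by exists 1, (fun=> 0); split=> //; exact: prime1.
have [a [r [pr e]]] := als (b x).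
exists (r * s), (fun y => if y == x then s * a else r * f y); split; first exact: primeNM.
move=> y; rewrite inE; case: eqP => [-> _|_ /= yt]; first by rewrite !rmorphM -e; ring.
by rewrite !rmorphM -fE // mulrA.
Qed.

(* The derivations factor through the cotangent space of the local ring. *)
Lemma cotangent_bound (K : fieldType) (D : comPzRingType) (p : spec D) (B : comPzRingType)
    (al : {rmorphism D -> B}) (ev : {rmorphism D -> K}) (n : nat)
    (J : finType) (y : J -> D) (der : J -> D -> K) :
  is_loc p al -> (forall x, p x <-> ev x = 0) -> regular_local B -> dim_le B n ->
  (forall j, {morph der j : x y / x + y}) ->
  (forall j x y, der j (x * y) = ev x * der j y + ev y * der j x) ->
  (forall i, ev (y i) = 0) -> (forall i j, der j (y i) = (i == j)%:R) -> (#|J| <= n)%N.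
Proof.
move=> alP pE [Bl Bn [d [s [[dB _] ms]]]] Bd derD derM yev yder.
apply: leq_trans (Bd d dB); have [alu als alk] := alP.
have der0 j : der j 0 = 0 by apply: (@addrI _ (der j 0)); rewrite -derD !addr0.
have derS j (I : Type) (r : seq I) (f : I -> D) : der j (\sum_(i <- r) f i) = \sum_(i <- r) der j (f i).
  by apply: big_morph => //; exact: derD.
have s_ex (k : 'I_d) : exists a t, [/\ ~ p t, al t * s`_k = al a & p a].
  apply/(loc_nonunit alP); rewrite -[~ _]/(max_ideal _) ms.
  by apply: ideal_gen_mem; rewrite mem_nth // size_tuple.
pose a k := projT1 (cid (s_ex k)).
have a_ex (k : 'I_d) : exists t, [/\ ~ p t, al t * s`_k = al (a k) & p (a k)] := projT2 (cid (s_ex k)).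
(* In the local ring [y i] is a combination of the generators of the maximal ideal; clearing
   denominators brings the relation back to [D]. *)
have key i : exists w (g : 'I_d -> D), ~ p w /\ w * y i = \sum_k g k * a k.
  have : ideal_gen s (al (y i)).
    by rewrite -ms /max_ideal /= (loc_unitP alP); apply; apply/pE.
  case=> c0 yE; rewrite size_tuple in c0 yE.
  have c_ex (k : 'I_d) : exists c, c * al (a k) = c0 k * s`_k.
    have [t [pt e _]] := a_ex k; have [v vt] := alu t pt.
    by exists (c0 k * v); rewrite -e -mulrA (mulrA v) vt mul1r.
  pose c k := projT1 (cid (c_ex k)).
  have cE (k : 'I_d) : c k * al (a k) = c0 k * s`_k := projT2 (cid (c_ex k)).
  have [r [g [pr gE]]] := loc_common_denominator c alP.
  have : al (r * y i - \sum_k g k * a k) = 0.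
    rewrite rmorphB rmorphM yE rmorph_sum mulr_sumr -sumrB big1 // => k _.
    by rewrite rmorphM -gE -mulrA cE subrr.
  move=> /alk [w pw e]; exists (w * r), (fun k => w * g k); split; first exact: primeNM.
  move/eqP: e; rewrite mulrBr subr_eq0 mulrA => /eqP ->.
  by rewrite mulr_sumr; apply: eq_bigr => k _; rewrite mulrA.
pose w i := projT1 (cid (key i)).
have w_ex i : exists g : 'I_d -> D, ~ p (w i) /\ w i * y i = \sum_k g k * a k := projT2 (cid (key i)).
pose g i := projT1 (cid (w_ex i)).
have gP i : ~ p (w i) /\ w i * y i = \sum_k g i k * a k := projT2 (cid (w_ex i)).
have aev k : ev (a k) = 0 by have [t [_ _ /pE]] := a_ex k.
have rel i j : ev (w i) * (i == j)%:R = \sum_k ev (g i k) * der j (a k).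
  have [_ /(congr1 (der j))] := gP i; rewrite derM yev mul0r addr0 yder derS => ->.
  by apply: eq_bigr => k _; rewrite derM aev mul0r addr0.
(* As the derivations are dual to the [y i], the identity matrix of size [#|J|] factors through
   dimension [d]. *)
apply: (@mulmx1_min _ _ _ (\matrix_(i < #|J|, k < d) ((ev (w (enum_val i)))^-1 * ev (g (enum_val i) k)))
  (\matrix_(k < d, j < #|J|) der (enum_val j) (a k))).
apply/matrixP => i j; rewrite !mxE.
under eq_bigr do rewrite !mxE -mulrA.
rewrite -mulr_sumr -rel mulrA mulVf ?mul1r; first by rewrite (inj_eq enum_val_inj).
by apply/eqP => /pE; case: (gP (enum_val i)).
Qed.

(** In Smith normal form the kernel is spanned by the coordinate vectors at the zero rows of the
    diagonal matrix; so it has a basis that is part of a basis of $\mathbb{Z}^n$. *)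
Lemma int_kernel_basis n m (A : 'M[int]_(n, m)) : exists (I0 : {set 'I_n}) (L Li : 'M[int]_n),
  [/\ Li *m L = 1%:M, forall i, i \in I0 -> row i Li *m A = 0 &
      forall w : 'rV_n, w *m A = 0 -> w = \sum_(i in I0) (w *m L) 0 i *: row i Li].
Proof.
have [L Lu [Q Qu [d _ AE]]] := int_Smith_normal_form A.
set D := \matrix_(i, j) _ in AE.
exists [set i | row i D == 0]%SET, L, (invmx L); split; first exact: mulVmx.
  move=> i; rewrite inE => /eqP Di.
  by rewrite -row_mul AE -mulmxA mulKmx // row_mul Di mul0mx.
move=> w; rewrite AE !mulmxA => /(canRL (mulmxK Qu)); rewrite mul0mx => wD.
rewrite -[LHS](mulmxK Lu) [LHS]mulmx_sum_row; apply/esym/big_rmcond => i.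
rewrite inE => /rV0Pn [j]; rewrite !mxE.
have [ij dj|_] := eqVneq (i : nat) j; last by rewrite mulr0n eqxx.
have /rowP /(_ j) := wD; rewrite !mxE (bigD1 i) //= big1 => [|k ki]; last first.
  by rewrite [D _ _]mxE -ij val_eqE (negPf ki) mulr0n mulr0.
rewrite addr0 [D _ _]mxE -ij eqxx mulr1n => /eqP; rewrite mulf_eq0 (negPf dj) orbF mxE.
by move=> /eqP ->; rewrite scale0r.
Qed.

(** * The distinguished point of an affine toric scheme *)

Section IrregularMonoid.
Context (G : nmodType) (n m : nat) (A : 'M[int]_(n, m)) (cv : G -> 'rV[int]_n).
Hypothesis cv0 : cv 0 = 0.
Hypothesis cvD : forall g h, cv (g + h) = cv g + cv h.
Hypothesis cv_inj : injective cv.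
Hypothesis cv_ge0 : forall g j, 0 <= (cv g *m A) 0 j.
Hypothesis cv_ex : forall w : 'rV_n, (forall j, 0 <= (w *m A) 0 j) -> exists g, cv g = w.

(** The columns of [A] stand for generators of the cone, so this is the vector of values of [g] on
    them; it vanishes exactly when [g] is a unit of [G]. *)
Definition vals g := cv g *m A.
Definition unitb g := vals g == 0.
Definition irred w := ~~ unitb w /\ forall g h, w = g + h -> unitb g \/ unitb h.

Lemma vals0 : vals 0 = 0. Proof. by rewrite /vals cv0 mul0mx. Qed.
Lemma vals_ge0 g j : 0 <= vals g 0 j. Proof. exact: cv_ge0. Qed.
Lemma valsD g h : vals (g + h) = vals g + vals h.
Proof. by rewrite /vals cvD mulmxDl. Qed.

Lemma unitbD g h : unitb (g + h) = unitb g && unitb h.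
Proof.
apply/eqP/andP => [|[/eqP gu /eqP hu]]; last by rewrite valsD gu hu addr0.
rewrite valsD => gh; have e j : vals g 0 j = 0 /\ vals h 0 j = 0.
  have /rowP /(_ j) := gh; rewrite mxE [RHS]mxE => /eqP.
  by rewrite paddr_eq0 ?vals_ge0 // => /andP [/eqP -> /eqP ->].
by split; apply/eqP/rowP => j; rewrite [RHS]mxE; have [] := e j.
Qed.

(** Elements with equal values differ by a unit, so a decomposition of the values lifts to one of
    [w] itself. *)
Lemma irred_vals_add w g h : irred w -> vals w = vals (g + h) -> unitb g \/ unitb h.
Proof.
move=> [_ wi] e; have [u uE] : exists u, cv u = cv w - cv (g + h).
  by apply: cv_ex => j; rewrite mulmxBl -/(vals _) e subrr mxE.
have wE : w = g + (h + u).
  by apply: cv_inj; rewrite addrA cvD uE [RHS]addrC subrK.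
by have [|] := wi _ _ wE; [left | rewrite unitbD => /andP []; right].
Qed.

Definition weight g : nat := (\sum_j absz (vals g (0 : 'I_1)%R j))%N.

Lemma weightD g h : weight (g + h) = (weight g + weight h)%N.
Proof.
rewrite /weight -big_split; apply: eq_bigr => j _; rewrite valsD mxE /=.
by apply/eqP; rewrite -eqz_nat PoszD !gez0_abs ?addr_ge0 // ?vals_ge0.
Qed.

Lemma weight_gt0 g : ~~ unitb g -> (0 < weight g)%N.
Proof.
by move=> /rV0Pn [j gj]; rewrite /weight (bigD1 j) //= addn_gt0 lt0n absz_eq0 gj.
Qed.

(** Up to units every element is a sum of irreducibles, by induction on [weight], which is additive
    and positive off the units. *)
Lemma vals_comb k (ws : 'I_k -> G) :
  (forall w, irred w -> exists l, vals w = vals (ws l)) ->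
  forall g, exists c : 'I_k -> nat, vals g = \sum_l vals (ws l) *+ c l.
Proof.
move=> wsP g; have [s] := ubnP (weight g).
elim: s g => // s IH g; rewrite ltnS => gs.
have [/eqP gu|gu] := boolP (unitb g).
  by exists (fun=> 0%N); rewrite gu big1.
have [/wsP [l ->]|gi] := pselect (irred g).
  exists (fun i => (i == l) : nat); rewrite (bigD1 l) //= eqxx mulr1n big1 ?addr0 // => i /negbTE ->.
  exact: mulr0n.
have [g1 [g2 [gE g1u g2u]]] : exists g1 g2, [/\ g = g1 + g2, ~~ unitb g1 & ~~ unitb g2].
  apply: contrapT => H; apply: gi; split=> // g1 g2 gE.
  by apply: contrapT => /not_orP [/negP g1u /negP g2u]; apply: H; exists g1, g2.
have [|c1 c1E] := IH g1; first by move: gs (weight_gt0 g2u); rewrite gE weightD; lia.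
have [|c2 c2E] := IH g2; first by move: gs (weight_gt0 g1u); rewrite gE weightD; lia.
exists (fun l => c1 l + c2 l)%N; rewrite gE valsD c1E c2E -big_split.
by apply: eq_bigr => l _; rewrite mulrnDr.
Qed.

Context (K : fieldType).
Local Notation KG := (monoid_algebra K G).
(** Multiplicative because a sum is a unit only if both summands are ([unitbD]). *)
Definition unit_ind g : K := (unitb g)%:R.

Lemma unit_ind0 : unit_ind 0 = 1.
Proof. by rewrite /unit_ind /unitb vals0 eqxx. Qed.
Lemma unit_indD g h : unit_ind (g + h) = unit_ind g * unit_ind h.
Proof. by rewrite /unit_ind unitbD -natrM mulnb. Qed.

(* Evaluation at the distinguished point of the affine toric scheme. *)
Definition unit_eval := projT1 (cid (ma_lift [the {rmorphism K -> K} of idfun] unit_ind0 unit_indD)).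
Lemma unit_evalP : (forall c, unit_eval (ma_cst G c) = c) /\
  (forall g, unit_eval (ma_chi K g) = unit_ind g).
Proof. exact: (projT2 (cid (ma_lift [the {rmorphism K -> K} of idfun] unit_ind0 unit_indD))). Qed.

Lemma unit_evalU c g : unit_eval << c *g g >> = c * unit_ind g.
Proof. by rewrite ma_monoE rmorphM; have [-> ->] := unit_evalP. Qed.

Lemma unit_eval_prime : is_prime [set x | unit_eval x = 0].
Proof.
split=> [|/=|x y /= /eqP].
- split=> [|x y /= x0 y0|x y /= y0] /=; first exact: rmorph0.
    by rewrite rmorphD /= x0 y0 addr0.
  by rewrite rmorphM /= y0 mulr0.
- by rewrite rmorph1; apply/eqP/oner_neq0.
by rewrite rmorphM mulf_eq0 => /orP [] /eqP; [left|right].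
Qed.
Definition unit_point : spec KG := Prime unit_eval_prime.

(** The linear extension of [d]. By [derM] it is a derivation at the distinguished point if [d]
    satisfies the Leibniz rule on monomials. *)
Definition der (d : G -> K) (x : KG) : K := ma_eval [the {rmorphism K -> K} of idfun] d x.

Lemma derD d : {morph der d : x y / x + y}.
Proof. by move=> x y; rewrite /der raddfD. Qed.
Lemma der_0 d : der d 0 = 0.
Proof. by rewrite /der raddf0. Qed.
Lemma derU d c g : der d << c *g g >> = c * d g.
Proof. exact: ma_evalU. Qed.

Lemma derM d : (forall g h, d (g + h) = unit_ind g * d h + unit_ind h * d g) ->
  forall x y, der d (x * y) = unit_eval x * der d y + unit_eval y * der d x.
Proof.
move=> dM x y; elim/ma_ind: x => [|x x' Hx Hx'|c a].
- by rewrite mul0r der_0 rmorph0 mul0r mulr0 addr0.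
- by rewrite mulrDl !derD Hx Hx' rmorphD /=; ring.
elim/ma_ind: y => [|y y' Hy Hy'|c' b].
- by rewrite mulr0 der_0 rmorph0 mul0r mulr0 addr0.
- by rewrite mulrDr !derD Hy Hy' rmorphD /=; ring.
by rewrite [_ * _]ma_mulUU !derU !unit_evalU dM /=; ring.
Qed.

Lemma derB d : {morph der d : x y / x - y}.
Proof. by move=> x y; rewrite /der raddfB. Qed.
Lemma der_chi d g : der d (ma_chi K g) = d g.
Proof. by rewrite derU mul1r. Qed.

Context (B : comPzRingType) (be : {rmorphism KG -> B}).
Hypotheses (beP : is_loc unit_point be) (Breg : regular_local B) (Bdim : dim_le B n).
Context (I0 : {set 'I_n}) (L Li : 'M[int]_n).
Hypotheses (LiL : Li *m L = 1%:M) (LiA : forall i, i \in I0 -> row i Li *m A = 0).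
Hypothesis kerA : forall w : 'rV_n, w *m A = 0 -> w = \sum_(i in I0) (w *m L) 0 i *: row i Li.

Lemma unit_gen_ex (i : {i | i \in I0}) : exists g, cv g = row (val i) Li.
Proof. by apply: cv_ex => j; rewrite LiA ?mxE //; exact: (valP i). Qed.

(* The unit directions and the irreducible classes are independent in the
   cotangent space at the distinguished point. *)
Lemma irred_bound k (ws : 'I_k -> G) : (forall l, irred (ws l)) ->
  (forall l l', vals (ws l) = vals (ws l') -> l = l') -> (#|I0| + k <= n)%N.
Proof.
move=> wsi ws_inj.
pose u i := projT1 (cid (unit_gen_ex i)).
have uE i : cv (u i) = row (val i) Li := projT2 (cid (unit_gen_ex i)).
have uu i : unitb (u i) by rewrite /unitb /vals uE LiA //; exact: (valP i).
have wsu l : unitb (ws l) = false by have [/negbTE] := wsi l.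
(* Coordinates in the lattice of units, extended by 0, and indicators of irreducible classes. The
   latter satisfy the Leibniz rule because a sum that lies in an irreducible class has a unit as
   summand. *)
pose d (j : {i | i \in I0} + 'I_k) g : K := match j with
  | inl i => if unitb g then ((cv g *m L) 0 (val i))%:~R else 0
  | inr l => (vals g == vals (ws l))%:R end.
have dM j g h : d j (g + h) = unit_ind g * d j h + unit_ind h * d j g.
  case: j => [i|l]; rewrite /d /unit_ind.
    rewrite unitbD; case: (unitb g) (unitb h) => [] [] /=; rewrite ?mul1r ?mul0r ?addr0 ?mulr0 ?addr0 //.
    by rewrite cvD mulmxDl mxE rmorphD addrC.
  have [/eqP gu|gu] := boolP (unitb g); have [/eqP hu|hu] := boolP (unitb h).
  - rewrite valsD gu hu addr0 !mul1r.
    by rewrite eq_sym [_ == 0]wsu addr0.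
  - by rewrite valsD gu add0r mul1r mul0r addr0.
  - by rewrite valsD hu addr0 mul0r mul1r add0r.
  rewrite !mul0r addr0; case: eqP => // /esym /(irred_vals_add (wsi l)).
  by rewrite (negbTE gu) (negbTE hu) => -[].
(* The character of a unit takes the value 1 at the point; subtracting 1, the character of 0, puts
   it into the maximal ideal. *)
pose y j := match j with inl i => ma_chi K (u i) - ma_chi K 0 | inr l => ma_chi K (ws l) end.
have ev0 : unit_ind 0 = 1 by exact: unit_ind0.
have -> : (#|I0| + k)%N = #|{: {i | i \in I0} + 'I_k}| by rewrite card_sum card_sig card_ord.
apply: (cotangent_bound (ev := unit_eval) (y := y) (der := fun j => der (d j)) beP _ Breg Bdim).
- by [].
- by move=> j; exact: derD.
- by move=> j; apply: derM; exact: dM.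
- have [_ evE] := unit_evalP.
  by case=> [i|l]; rewrite /y ?rmorphB /= !evE /unit_ind ?uu ?wsu // /unitb vals0 eqxx subrr.
case=> [i|l] [i'|l'] /=; rewrite ?derB !der_chi /d.
- rewrite uu /unitb vals0 eqxx cv0 mul0mx uE -row_mul LiL !mxE subr0.
  by rewrite (inj_eq val_inj) (inj_eq inl_inj); case: eqP.
- have /eqP -> := uu i; rewrite vals0.
  by rewrite eq_sym [_ == 0]wsu subrr.
- by rewrite wsu.
rewrite (inj_eq inr_inj); congr (_%:R); congr nat_of_bool.
by apply/eqP/eqP => [/ws_inj|->].
Qed.

(** By [irred_bound] there are at most [n] pairwise inequivalent irreducibles, so a largest family
    exists; it meets every class, as otherwise it could be enlarged. *)
Lemma irred_family : exists k (ws : 'I_k -> G), [/\ (#|I0| + k <= n)%N,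
  forall l, irred (ws l) & forall w, irred w -> exists l, vals w = vals (ws l)].
Proof.
pose Q k := exists ws : 'I_k -> G, (forall l, irred (ws l)) /\
  forall l l', vals (ws l) = vals (ws l') -> l = l'.
have Q0 : exists k, `[< Q k >].
  by exists 0%N; apply/asboolP; exists (fun=> 0); split; case.
have Qn k : `[< Q k >] -> (k <= n)%N.
  by move=> /asboolP [ws [wi /(irred_bound wi)]]; apply: leq_trans; exact: leq_addl.
have [k /asboolP [ws [wsi wsinj]] kmax] := ex_maxnP Q0 Qn.
exists k, ws; split=> // [|w wi]; first exact: irred_bound wsi wsinj.
apply: contrapT => H.
suff /asboolP /kmax : Q k.+1 by rewrite ltnn.
exists (fun l => if unlift ord0 l is Some l' then ws l' else w); split=> [l|l l'].
  by case: unliftP.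
case: unliftP => [i ->|->]; case: unliftP => [i' ->|->] //.
- by move=> /wsinj ->.
- by move=> /esym e; case: H; exists i.
by move=> e; case: H; exists i'.
Qed.

Hypothesis pointed : forall j (q : 'I_m -> rat), (forall k, 0 <= q k) ->
  (forall i, - (A i j)%:~R = \sum_k q k * (A i k)%:~R) -> forall i, A i j = 0.

Lemma vals_sum (I : Type) (r : seq I) (f : I -> G) :
  vals (\sum_(i <- r) f i) = \sum_(i <- r) vals (f i).
Proof. by apply: big_morph => [x y|]; rewrite ?valsD ?vals0. Qed.

(** If every element of the monoid vanished on some nonzero generator, Farkas' lemma would put the
    negative of that generator into the cone, against [pointed]. Summing one positive witness for
    each generator gives [u]. *)
Lemma interior_ex : exists u, forall j, (exists i, A i j != 0) -> 0 < vals u 0 j.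
Proof.
have u_ex j : exists u, (exists i, A i j != 0) -> 0 < vals u 0 j.
  apply: contrapT => H; case: (H); exists 0 => -[i Aij]; move/eqP: Aij; case.
  have [w wA|q [q0 qE]] := @int_farkas n m (fun k i => A i k) (fun i => - A i j).
    have [|g gw] := @cv_ex (\row_i w i).
      by move=> k; rewrite mxE; under eq_bigr do rewrite mxE; exact: wA.
    under eq_bigr do rewrite mulrN.
    rewrite sumrN oppr_ge0 leNgt; apply/negP => wpos; case: H; exists g => _.
    by rewrite /vals gw mxE; under eq_bigr do rewrite mxE.
  by apply: (pointed q0) => k; rewrite -qE rmorphN.
pose u j := projT1 (cid (u_ex j)).
have uP j : (exists i, A i j != 0) -> 0 < vals (u j) 0 j := projT2 (cid (u_ex j)).
exists (\sum_j u j) => j /uP uj; rewrite vals_sum summxE (bigD1 j) //=.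
by apply: ltr_pwDl => //; apply: sumr_ge0 => k _; exact: vals_ge0.
Qed.

(** The monoid generates the lattice: adding a large multiple of an interior element makes any
    vector nonnegative on the generators of the cone. *)
Lemma cv_diff (w : 'rV_n) : exists g h, w = cv g - cv h.
Proof.
have [u uP] := interior_ex.
pose N := (\sum_j absz ((w *m A) (0 : 'I_1)%R j))%N.
have valsN : vals (u *+ N) = vals u *+ N.
  by elim: N => [|N IH]; rewrite ?mulr0n ?vals0 // !mulrS valsD IH.
have [j|g gE] := @cv_ex (w + cv (u *+ N)).
  rewrite mulmxDl -/(vals _) valsN mxE mulmxnE.
  have [/uP uj|nA] := pselect (exists i, A i j != 0).
    have wN : (absz ((w *m A) 0%R j) <= N)%N by rewrite /N (bigD1 j) //= leq_addr.
    rewrite -mulr_natr natz; move: uj wN; move: (vals u 0 j) (N) ((w *m A) 0 j) => a N1 b; nia.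
  have A0 (v : 'rV_n) : (v *m A) 0 j = 0.
    rewrite mxE big1 // => i _; have [->|Aij] := eqVneq (A i j) 0; first by rewrite mulr0.
    by case: nA; exists i.
  by rewrite /vals !A0 mul0rn addr0.
by exists g, (u *+ N); rewrite gE addrK.
Qed.

(** The unit basis and the irreducibles, at most [n] vectors, generate $\mathbb{Z}^n$; hence they
    form a basis, the rows of [T], whose dual basis consists of the columns of [X]. Coordinates at
    irreducibles, indexed by [S], are nonnegative on all of [G], and Farkas' lemma turns this into
    membership of the dual vectors in the cone. *)
Lemma regular_generators : exists (T X : 'M[int]_n) (S : {set 'I_n}),
  [/\ T *m X = 1%:M, forall i j, 0 <= (T *m A) i j,
      forall i j, i \notin S -> (T *m A) i j = 0 &
      forall i, i \in S -> exists q : 'I_m -> rat, (forall j, 0 <= q j) /\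
        forall k, (X k i)%:~R = \sum_j q j * (A k j)%:~R].
Proof.
have [k [ws [kn wsi wsP]]] := irred_family.
pose J := ({i : 'I_n | i \in I0} + 'I_k)%type.
have Jn : (#|{: J}| <= n)%N by rewrite card_sum card_sig card_ord.
pose f (j : J) : 'I_n := widen_ord Jn (enum_rank j).
have f_inj : injective f by move=> i j /(congr1 val) /= /val_inj /enum_rank_inj.
pose pk i := [pick j | f j == i].
have pkf j : pk (f j) = Some j.
  by rewrite /pk; case: pickP => [j' /eqP /f_inj -> //|/(_ j)]; rewrite eqxx.
pose v (j : J) : 'rV[int]_n := match j with inl i => row (val i) Li | inr l => cv (ws l) end.
(* Rows without a vector are 0; this makes [T] square, so that a one-sided inverse is two-sided. *)
pose T : 'M[int]_n := \matrix_i (if pk i is Some j then v j else 0).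
pose pad (c : J -> int) : 'rV[int]_n := \row_i (if pk i is Some j then c j else 0).
have padT c : pad c *m T = \sum_j c j *: v j.
  rewrite mulmx_sum_row [RHS](partition_big f xpredT) //=; apply: eq_bigr => i _.
  rewrite rowK mxE; case Ei: (pk i) => [j|]; last first.
    rewrite scaler0 big_pred0 // => j; apply/negbTE/eqP => fj.
    by rewrite -fj pkf in Ei.
  have fj : f j = i by move: Ei; rewrite /pk; case: pickP => // j' /eqP <- [->].
  by rewrite -fj; under eq_bigl do rewrite (inj_eq f_inj); rewrite big_pred1_eq.
have genP g : exists c, (forall l, 0 <= c (inr l)) /\ cv g = pad c *m T.
  have [c cE] := vals_comb wsP g.
  have w0 : (cv g - \sum_l cv (ws l) *+ c l) *m A = 0.
    rewrite mulmxBl -/(vals g) cE mulmx_suml -sumrB big1 // => l _.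
    by rewrite -!scaler_nat -scalemxAl subrr.
  have := kerA w0; set w := (X in X *m L); move=> wE.
  exists (fun j => match j with inl i => (w *m L) 0 (val i) | inr l => (c l)%:Z end).
  split=> //; rewrite padT big_sumType /= -[LHS](subrK (\sum_l cv (ws l) *+ c l)) -/w; congr (_ + _).
    by rewrite [LHS]wE big_sub.
  by apply: eq_bigr => l _; rewrite -scaler_nat natz.
have genZ (w : 'rV_n) : exists c, w = c *m T.
  have [g [h ->]] := cv_diff w; have [c [_ ->]] := genP g; have [d [_ ->]] := genP h.
  by exists (pad c - pad d); rewrite mulmxBl.
pose X : 'M[int]_n := \matrix_i projT1 (cid (genZ (row i 1%:M))).
have XT : X *m T = 1%:M.
  apply/row_matrixP => i; rewrite row_mul rowK.
  exact/esym/(projT2 (cid (genZ (row i 1%:M)))).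
have TX := mulmx1C XT.
exists T, X, [set i | if pk i is Some (inr _) then true else false]%SET.
have TA i j : (T *m A) i j = if pk i is Some (inr l) then vals (ws l) 0 j else 0.
  have -> : (T *m A) i j = row i (T *m A) 0 j by rewrite [RHS]mxE.
  rewrite row_mul rowK; case: (pk i) => [[i0|l]|] //=; last by rewrite mul0mx mxE.
  by rewrite LiA ?mxE //; exact: (valP i0).
split=> // [i j|i j|i].
- by rewrite TA; case: (pk i) => [[|l]|] //; exact: vals_ge0.
- by rewrite inE TA; case: (pk i) => [[|l]|].
rewrite inE => iS; apply: int_farkas => w wA.
have [|g gw] := @cv_ex (\row_i w i).
  by move=> j; rewrite mxE; under eq_bigr do rewrite mxE; exact: wA.
have [c [c0 gE]] := genP g.
have -> : \sum_i0 w i0 * X i0 i = (cv g *m X) 0 i.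
  by rewrite gw mxE; under [RHS]eq_bigr do rewrite mxE.
rewrite gE -mulmxA TX mulmx1 mxE.
by move: iS; case: (pk i) => [[|l]|].
Qed.

End IrregularMonoid.

(** The dimension bound that [irred_bound] asks for is automatic: by [ma_trdeg_le] every local ring
    of [K[G]] has dimension at most [n]. *)
Lemma regular_point_generators (G : nmodType) (n m : nat) (A : 'M[int]_(n, m))
    (cv : G -> 'rV[int]_n) (K : fieldType) :
  cv 0 = 0 -> (forall g h, cv (g + h) = cv g + cv h) -> injective cv ->
  (forall g j, 0 <= (cv g *m A) 0 j) ->
  (forall w : 'rV_n, (forall j, 0 <= (w *m A) 0 j) -> exists g, cv g = w) ->
  (forall j (q : 'I_m -> rat), (forall k, 0 <= q k) ->
    (forall i, - (A i j)%:~R = \sum_k q k * (A i k)%:~R) -> forall i, A i j = 0) ->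
  exists P : spec (monoid_algebra K G),
    forall (B : comPzRingType) (be : {rmorphism monoid_algebra K G -> B}), is_loc P be ->
    regular_local B -> exists (T X : 'M[int]_n) (S : {set 'I_n}),
  [/\ T *m X = 1%:M, forall i j, 0 <= (T *m A) i j,
      forall i j, i \notin S -> (T *m A) i j = 0 &
      forall i, i \in S -> exists q : 'I_m -> rat, (forall j, 0 <= q j) /\
        forall k, (X k i)%:~R = \sum_j q j * (A k j)%:~R].
Proof.
move=> cv0 cvD cv_inj cv_ge0 cv_ex pointed; exists (unit_point cv0 cvD cv_ge0 K) => B be beP Breg.
have [I0 [L [Li [LiL LiA kerA]]]] := int_kernel_basis A.
suff Bdim : dim_le B n.
  exact: (regular_generators cv_inj cv_ex beP Breg Bdim LiL LiA kerA pointed).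
apply: (loc_dim_le beP); apply: (@ma_trdeg_le _ _ _ (fun g i => cv g 0 i)) => [i|g h i|g h gh].
- by rewrite cv0 mxE.
- by rewrite cvD mxE.
by apply: cv_inj; apply/rowP.
Qed.

(** * Cones that are regular at the distinguished point *)

Section FiniteCone.
Context (R : realType) (V : vectType R) (s : seq V).

(** In [cone] the coefficients are functions of the vector and the list may repeat vectors; here
    they are indexed by the positions in [s]. *)
Lemma cone_seqP x : cone [set` s] x <->
  exists c : 'I_(size s) -> R, (forall i, 0 <= c i) /\ x = \sum_(i < size s) c i *: s`_i.
Proof.
split=> [[t [c [ts ->]]]|[c [c0 ->]]].
  elim: t ts => [|a t IH] ts.
    by exists (fun=> 0); split=> //; rewrite big_nil big1 // => i _; rewrite scale0r.
  have [|d [d0 dE]] := IH; first by move=> b bt; apply: ts; rewrite inE bt orbT.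
  have [/= sa a0] := ts a (mem_head _ _); rewrite -index_mem in sa.
  exists (fun i => d i + (if i == Ordinal sa then c a else 0)); split=> [i|].
    by rewrite addr_ge0 //; case: ifP.
  under [RHS]eq_bigr do rewrite scalerDl; rewrite [RHS]big_split /= -dE big_cons addrC; congr (_ + _).
  rewrite (bigD1 (Ordinal sa)) //= eqxx big1 => [|i /negbTE ->]; last exact: scale0r.
  by rewrite addr0 nth_index // -index_mem.
(* Positions that hold the same vector are merged and their coefficients added. *)
exists (undup s), (fun a => \sum_(i < size s | s`_i == a) c i); split=> [a|].
  by rewrite mem_undup => sa; split=> //; apply: sumr_ge0.
under [RHS]eq_bigr do rewrite scaler_suml big_mkcond.
rewrite exchange_big; apply: eq_bigr => i _; rewrite -big_mkcond /=.
have si : s`_i \in undup s by rewrite mem_undup mem_nth.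
rewrite (big_rem _ si) /= eqxx big_seq_cond big1 ?addr0 // => a /andP [].
by rewrite mem_rem_uniq ?undup_uniq // inE => /andP [/negbTE ai _] /eqP e; rewrite e eqxx in ai.
Qed.

Lemma cone0 : cone [set` s] 0.
Proof.
by apply/cone_seqP; exists (fun=> 0); split=> //; rewrite big1 // => i _; rewrite scale0r.
Qed.

Lemma coneD x y : cone [set` s] x -> cone [set` s] y -> cone [set` s] (x + y).
Proof.
move=> /cone_seqP [c [c0 ->]] /cone_seqP [d [d0 ->]]; apply/cone_seqP.
exists (fun i => c i + d i); split=> [i|]; first exact: addr_ge0.
by rewrite -big_split; apply: eq_bigr => i _; rewrite scalerDl.
Qed.

Lemma coneZ r x : 0 <= r -> cone [set` s] x -> cone [set` s] (r *: x).
Proof.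
move=> r0 /cone_seqP [c [c0 ->]]; apply/cone_seqP; exists (fun i => r * c i).
split=> [i|]; first exact: mulr_ge0.
by rewrite scaler_sumr; apply: eq_bigr => i _; rewrite scalerA.
Qed.

Lemma cone_sub (B : set V) : (forall b, B b -> cone [set` s] b) -> cone B `<=` cone [set` s].
Proof.
move=> Bs _ [t [c [tB ->]]]; rewrite big_seq.
by apply: big_ind => [|x y|a /tB [/Bs sa ca]]; [exact: cone0|exact: coneD|exact: coneZ].
Qed.

Lemma cone_nth i : (i < size s)%N -> cone [set` s] s`_i.
Proof. by move=> si; apply: cone_mem; exact: mem_nth. Qed.

End FiniteCone.

Lemma Zbasis_tuple (R : realType) (V : vectType R) (N : set V) n (e : n.-tuple V) :
  Zbasis N e <-> N = [set x | exists c : 'I_n -> int, x = \sum_(i < n) e`_i *~ c i] /\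
    forall c : 'I_n -> int, \sum_(i < n) e`_i *~ c i = 0 -> forall i, c i = 0.
Proof. by case: e => s /= sn; have e := eqP sn; case: n / e sn. Qed.

Lemma Zbasis_unimodular (R : realType) (V : vectType R) (N : set V) n (e f : n.-tuple V)
    (T X : 'M[int]_n) : Zbasis N e -> T *m X = 1%:M ->
  (forall i : 'I_n, f`_i = \sum_(k < n) e`_k *~ X k i) -> Zbasis N f.
Proof.
move=> /Zbasis_tuple [NE e_free] TX fE; have XT := mulmx1C TX.
have fcE (c : 'cV[int]_n) : \sum_(i < n) f`_i *~ c i 0 = \sum_(k < n) e`_k *~ (X *m c) k 0.
  under eq_bigr do rewrite fE mulrz_suml.
  rewrite exchange_big; apply: eq_bigr => k _; rewrite mxE mulrz_sumr.
  by apply: eq_bigr => i _; rewrite mulrzA.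
have colS (g : nat -> V) (c : 'I_n -> int) :
    \sum_(i < n) g i *~ c i = \sum_(i < n) g i *~ (\col_i c i) i 0.
  by apply: eq_bigr => i _; rewrite mxE.
apply/Zbasis_tuple; split=> [|c c0 i].
  rewrite NE; apply/seteqP; split=> x /= [c ->]; last first.
    by exists (fun k => (X *m \col_i c i) k 0); rewrite -fcE -(colS (nth 0 f)).
  exists (fun i => (T *m \col_i c i) i 0).
  by rewrite fcE mulmxA XT mul1mx -(colS (nth 0 e)).
have Xc : X *m (\col_i c i) = 0.
  apply/colP => k; rewrite [RHS]mxE.
  by apply: (e_free (fun k => (X *m \col_i c i) k 0)); rewrite -fcE -(colS (nth 0 f)) c0.
have := mul1mx (\col_i c i); rewrite -TX -mulmxA Xc mulmx0 => /colP /(_ i).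
by rewrite !mxE.
Qed.

Section IrregularPoint.
Context (R : realType) (V : vectType R) (N sigma : set V).
Hypotheses (NV : Zstructure N) (sigmaP : polycone N sigma).
Local Notation G := (dual_monoid N sigma).

Lemma regular_of_point (K : fieldType) : exists P : spec (monoid_algebra K G),
  forall (B : comPzRingType) (be : {rmorphism monoid_algebra K G -> B}), is_loc P be ->
    regular_local B -> exists e A, [/\ Zbasis N e, A `<=` [set` e] & sigma = cone A].
Proof.
have [_ _ _ [e0 e0Z e0s]] := NV; have e0b := Zbasis_basis NV e0Z.
pose n := \dim {:V}; pose e : n.-tuple V := Tuple (introT eqP e0s).
have eZ : Zbasis N e by [].
have eb : basis_of {:V} e by [].
have [[A0 [/finite_seqP [s A0s] A0N sE]] nl] := sigmaP.
pose m := size s.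
have Ns (j : 'I_m) : N s`_j by apply: A0N; rewrite A0s /= mem_nth.
pose A : 'M[int]_(n, m) := \matrix_(i, j) Num.floor (coord e i s`_j).
have AE i j : (A i j)%:~R = coord e i s`_j.
  by rewrite mxE; have /(N_coord eZ eb) /(_ i) := Ns j; rewrite intrEfloor => /eqP.
have sAE (j : 'I_m) : s`_j = \sum_(i < n) (A i j)%:~R *: e`_i.
  by rewrite [LHS](coord_sum eb); apply: eq_bigr => i _; rewrite AE.
have ssigma (j : 'I_m) : sigma s`_j by rewrite sE A0s; exact: cone_nth.
pose cv (g : G) : 'rV[int]_n := \row_i dm_coo e g i.
have cvA g j : ((cv g *m A) 0 j)%:~R = dm_val g s`_j.
  rewrite (dm_valE eZ eb) mxE rmorph_sum; apply: eq_bigr => i _.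
  by rewrite /= mxE rmorphM /= AE.
have cvP (w : 'rV_n) : (forall j, 0 <= (w *m A) 0 j) -> exists g, cv g = w.
  move=> w0; have [x|g gE] := @dm_exists R V N n e eZ eb sigma (fun i => w 0 i).
    rewrite {1}sE A0s => /cone_seqP [c [c0 ->]]; rewrite linear_sum sumr_ge0 // => j _.
    rewrite linearZ /= mulr_ge0 // int_functionalE.
    have -> : \sum_i (w 0 i)%:~R * coord e i s`_j = ((w *m A) 0 j)%:~R.
      rewrite mxE rmorph_sum; apply: eq_bigr => i _.
      by rewrite rmorphM /= AE.
    by rewrite ler0z.
  by exists g; apply/rowP => i; rewrite mxE gE.
have sum_sigma (q : 'I_m -> rat) x : (forall j, 0 <= q j) ->
    x = \sum_(j < m) ratr (q j) *: s`_j -> sigma x.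
  move=> q0 ->; rewrite sE A0s; apply/cone_seqP; exists (fun j => ratr (q j)).
  by split=> // j; rewrite ler0q.
(* Rational certificates from Farkas' lemma become real combinations of the generators. *)
have rat_comb (q : 'I_m -> rat) (b : 'I_n -> int) :
    (forall i, (b i)%:~R = \sum_j q j * (A i j)%:~R) ->
    \sum_(i < n) (b i)%:~R *: e`_i = \sum_(j < m) ratr (q j) *: s`_j :> V.
  move=> bE; under [RHS]eq_bigr do rewrite sAE scaler_sumr.
  rewrite exchange_big; apply: eq_bigr => i _.
  have -> : (b i)%:~R = ratr (b i)%:~R :> R by rewrite ratr_int.
  rewrite bE rmorph_sum scaler_suml; apply: eq_bigr => j _.
  by rewrite rmorphM /= ratr_int scalerA.
have [|||||j q q0 qE|P PP] := @regular_point_generators [the nmodType of G] n m A cv K.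
- by apply/rowP => i; rewrite !mxE (dm_coo0 eZ eb).
- by move=> g h; apply/rowP => i; rewrite !mxE (dm_cooD eZ eb).
- by move=> g h /rowP gh; apply: (dm_coo_inj eZ eb) => i; have := gh i; rewrite !mxE.
- move=> g j; rewrite -(ler0z R) cvA.
  by have [_] := (dual_coneP eZ eb _ _).1 (dm_valP g); apply.
- exact: cvP.
(* The certificate puts the negative of a generator into the cone; if the generator were nonzero,
   the cone would contain the line through it. *)
- have sjN : sigma (- s`_j).
    apply: (sum_sigma q) => //; rewrite -(rat_comb q (fun i => - A i j)) => [|i].
      by rewrite sAE -sumrN; apply: eq_bigr => i _; rewrite rmorphN scaleNr.
    by rewrite rmorphN qE.
  have [s0|s0] := eqVneq s`_j 0.
    by move=> i; apply/eqP; rewrite -(eqr_int R) AE s0 linear0.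
  case: nl; exists 0, s`_j; split=> // r; rewrite add0r.
  have [r0|r0] := leP 0 r; first by rewrite sE A0s; apply: coneZ => //; exact: cone_nth.
  rewrite -[r]opprK scaleNr -scalerN; move: sjN; rewrite sE A0s; apply: coneZ.
  by rewrite oppr_ge0 ltW.
exists P => B be beP Breg; have [T [X [S [TX TA0 TAS XS]]]] := PP B be beP Breg.
have XT := mulmx1C TX.
(* The new basis of [N]: the columns of [X], read in the basis [e]. *)
pose f := [tuple \sum_(k < n) e`_k *~ X k i | i < n].
have fE (i : 'I_n) : f`_i = \sum_(k < n) e`_k *~ X k i by rewrite -tnth_nth tnth_mktuple.
exists f, [set` [seq f`_i | i : 'I_n in S]]; split.
- exact: (Zbasis_unimodular eZ TX fE).
- move=> x /mapP [i _ ->]; move: (tnth_nth 0 f i) => <-; exact: mem_tnth.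
apply/seteqP; split; rewrite sE A0s; apply: cone_sub => /= x; last first.
  move=> /mapP [i]; rewrite mem_enum => /XS [q [q0 qE]] ->.
  rewrite -A0s -sE; apply: (sum_sigma q) => //; rewrite -(rat_comb q _ qE) fE.
  by apply: eq_bigr => k _; rewrite scaler_int.
move=> /(nthP 0) [j js <-]; pose jj : 'I_m := Ordinal js.
(* The coordinates of a generator in the new basis are its values under the rows of [T], so they are
   nonnegative, and zero outside [S]. *)
have -> : s`_j = \sum_(i in S) ((T *m A) i jj)%:~R *: f`_i.
  have -> : s`_j = \sum_(i < n) ((T *m A) i jj)%:~R *: f`_i.
    rewrite (sAE jj); under [RHS]eq_bigr do rewrite fE scaler_sumr.
    rewrite exchange_big; apply: eq_bigr => k _.
    have -> : A k jj = (X *m (T *m A)) k jj by rewrite mulmxA XT mul1mx.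
    rewrite mxE rmorph_sum scaler_suml; apply: eq_bigr => i _.
    by rewrite -scaler_int scalerA rmorphM mulrC.
  apply/esym/big_rmcond => i iS.
  by rewrite TAS // scale0r.
apply: big_ind => [|x1 x2|i iS]; [exact: cone0|exact: coneD|].
apply: coneZ; first by rewrite ler0z.
by apply: cone_mem; apply/mapP; exists i; rewrite ?mem_enum.
Qed.

End IrregularPoint.

(** * Toric schemes *)

(** A localization at a prime is nonzero, so its structure can be replaced by that of a nonzero
    ring, as [flat_localized] expects. *)
Lemma flat_localized_pz (A B : comPzRingType) (C : comNzRingType) (G : nmodType)
    (q : spec C) (al : {rmorphism C -> A}) (P : spec (monoid_algebra C G))
    (be : {rmorphism monoid_algebra C G -> B}) (phi : {rmorphism A -> B}) :
  is_loc q al -> is_loc P be -> (forall c, phi (al c) = be (ma_cst G c)) -> flat phi.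
Proof.
move=> alP; have A1 : 1 != 0 :> A.
  apply/eqP => e; have /(loc_unitP alP) : is_unit (al 0) by exists 0; rewrite rmorph0 mul0r e.
  by apply; exact: prime0.
have [A' e] := comNzRing_of A1; case: A / e {A1} al phi alP => al phi alP beP phial.
exact: flat_localized alP beP phial.
Qed.

Definition ma_regular (G : nmodType) : Prop := forall K : fieldType,
  noetherian (monoid_algebra K G) /\
  forall (P : spec (monoid_algebra K G)) (B : comPzRingType)
    (be : {rmorphism monoid_algebra K G -> B}), is_loc P be -> regular_local B.

Section BaseChange.
Context (X XZ S : scheme) (a : mor XZ (Spec int)) (b : mor S (Spec int)).
Context (p : mor X XZ) (t : mor X S).
Hypothesis pb : is_pullback a b p t.

Lemma toric_flat : ma_cover XZ -> flat_mor t.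
Proof.
move=> XZc x; have [G [j [je jx]]] := XZc (p x).
have [C0 [i0 [/open_immersion_emb ie0 iy0]]] := schemeP (t x).
have [C CE] : exists C : comNzRingType, (C : comPzRingType) = C0.
  apply: comNzRing_of; case: iy0 => q _ _; apply/eqP => e; apply: (@prime1 _ q).
  by rewrite e; exact: prime0.
subst C0; have [u [ue _ tu ur]] := pullback_chart pb je ie0.
have [P _ Px] := ur _ jx iy0; rewrite -Px => {jx iy0 Px ur x}.
pose w := spec_map (@ma_cst C G).
have [be [beP beE]] := chart_stalk_loc ue P.
have [al0 [al0P al0E]] := chart_stalk_loc ie0 (w P).
have [tuP tuS] := (mor_eqP _ _).1 tu.
(* The localization at [w P] is moved along the equality of points [i0 (w P) = t (u P)]; the second
   clause keeps track of germs. *)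
have [al [alP alE]] : exists al : {rmorphism C -> stalk (t (u P))}, is_loc (w P) al /\
    forall c (U : opens S) (h : U (i0 (w P))) (h' : U (t (u P))) s, al0 c = germ h s -> al c = germ h' s.
  move: (t (u P)) (esym (tuP P) : i0 (w P) = t (u P)) => y e; case: y / e.
  exists al0; split=> // c U h h' s ->.
  by rewrite (Prop_irrelevance h h').
apply: (flat_localized_pz alP beP) => c.
have [_ _ ub] := ue; apply: (bij_inj (ub P)); rewrite beE.
have [U [h [s sE]]] : exists (U : opens S) (h : U (i0 (w P))) s, al0 c = germ h s.
  by elim/germ_ind: (al0 c) => U h s; exists U, h, s.
have h' : U (t (u P)) by have := tuP P => /= ->.
transitivity (@stalk_map _ _ (i0 \m w) P (germ h s)).
  rewrite (alE _ _ _ h' _ sE); exact: etrans (esym (stalk_map_comp _)) (tuS P U h' h s).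
by rewrite stalk_map_comp -sE al0E -[LHS]/(glob w P c) glob_spec_map.
Qed.

End BaseChange.

Lemma toric_scheme_R (K : fieldType) (W XZ : scheme) (a : mor XZ (Spec int))
    (b : mor (Spec K) (Spec int)) (p : mor W XZ) (t : mor W (Spec K)) : is_pullback a b p t ->
  (forall x : XZ, exists (G : nmodType) (j : mor (spec_lrs (monoid_algebra int G)) XZ),
    [/\ open_emb j, range j x & ma_regular G]) ->
  forall k, scheme_R k W.
Proof.
move=> pb XZc k.
have chart (x : W) : exists (G : nmodType) (u : mor (spec_lrs (monoid_algebra K G)) W),
    [/\ open_emb u, range u x & ma_regular G].
  have [G [j [je jx Gr]]] := XZc (p x).
  have [u [ue _ _ ur]] := pullback_chart pb je (mor_comp_id_open (Spec K)).
  by exists G, u; split=> //; apply: ur => //; exists (t x).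
split=> x; have [G [u [ue ux Gr]]] := chart x; have [Kn Kr] := Gr K.
  by exists (monoid_algebra K G), u; split=> //; exact: emb_open_immersion.
move=> _; have [P _ <-] := ux; have [be [beP _]] := chart_stalk_loc ue P.
exact: Kr beP.
Qed.

Lemma dual_monoid_regular (R : realType) (V : vectType R) (N : set V) (e : seq V) (A : set V) :
  Zstructure N -> Zbasis N e -> A `<=` [set` e] ->
  ma_regular [the nmodType of dual_monoid N (cone A)].
Proof.
move=> NV eZ Ae K; have eb := Zbasis_basis NV eZ.
pose f := in_tuple e; pose A' (i : 'I_(size e)) := A f`_i.
have c0 : forall k, dm_coo f (0 : dual_monoid N (cone A)) k = 0 by exact: (@dm_coo0 R V N _ f eZ eb (cone A)).
have cD := @dm_cooD R V N _ f eZ eb (cone A).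
have cI := @dm_coo_inj R V N _ f eZ eb (cone A).
have cg := @coo_ge0 R V N _ f eZ eb A.
have ce := @regular_gen_ex R V N _ f eZ eb A Ae.
split=> [|P B be].
  exact: (@regular_noetherian [the nmodType of dual_monoid N (cone A)] _ _ c0 cD cI A' cg ce K).
exact: (@regular_cone_local [the nmodType of dual_monoid N (cone A)] _ _ c0 cD cI A' cg ce K).
Qed.

Local Close Scope ring_scope.
Unset Implicit Arguments.

Theorem mainTheorem16 (R : realType) (V : vectType R) (n : nat)
  (dimV : (\dim {:V})%VS = n)
  (N : set V) (NV : Zstructure N)
  (Sigma : set (set V)) (SigmaN : fan N Sigma)
  (S X : scheme) (t : mor X S) (tP : is_toric_scheme N Sigma t) :
  (mor_regular t <-> mor_R n t) /\
  (mor_R n t <-> (regular_fan N Sigma \/ [set: S] = set0)).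
Proof.
have [XZ [a [b [p [[iota [iotaE iotac _ _]] pb]]]]] := tP.
have XZc : ma_cover XZ.
  move=> x; have [sigma [Ss sx]] := iotac x.
  exists [the nmodType of dual_monoid N sigma], (iota sigma Ss); split=> //.
  exact: open_immersion_emb (iotaE _ _).
have RtoF : mor_R n t -> regular_fan N Sigma \/ [set: S] = set0.
  move=> tR; have [S0|/set0P [z _]] := eqVneq [set: S] set0; [by right | left=> sigma Ss].
  have [k _] := residue_field_exists z; have [_ Sp _] := SigmaN.
  have [W [u [ue [_ Wr]]]] := mor_R_fibre_chart pb XZc tR k (open_immersion_emb (iotaE sigma Ss)).
  have [P PP] := regular_of_point NV (Sp _ Ss) k.
  have [be [beP _]] := chart_stalk_loc ue P.
  apply: (PP _ be beP); apply: Wr.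
  have [_ _ _ [e eZ es]] := NV; have eb := Zbasis_basis NV eZ.
  rewrite -dimV -es; apply: (loc_dim_le beP); exact: (@dm_trdeg_le R V N _ (in_tuple e) eZ eb sigma k).
have FtoR : regular_fan N Sigma \/ [set: S] = set0 -> mor_regular t.
  move=> H k; split; first exact: toric_flat pb XZc.
  (* Over the empty scheme there is no point [z], hence no fibre to consider. *)
  move=> z kz K F pF qF W p' q' pb1 pb2; have [Sr|S0] := H; last first.
    by have : [set: S] z by []; rewrite S0.
  apply: (toric_scheme_R (base_change_pullback pb pb1 pb2)) => x.
  have [sigma [Ss sx]] := iotac x; have [e [A [eZ Ae sE]]] := Sr _ Ss.
  exists [the nmodType of dual_monoid N sigma], (iota sigma Ss).
  split=> //; first exact: open_immersion_emb (iotaE _ _).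
  by rewrite sE; exact: dual_monoid_regular NV eZ Ae.
by split; split=> [h|h]; [exact: h | exact: FtoR (RtoF h) | exact: RtoF | exact: FtoR].
Qed.
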